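(* Let $T>0$, let $\rho_b,\rho_f,\nu,\alpha,\mu,k,\beta>0$ and $\lambda\ge 0$, and let $c_0\ge 0$ be arbitrary. Let $\mathbf y_0=[\mathbf u_0,\mathbf u_1,p_0,\mathbf v_0]^T\in X$, and set $d_0=c_0p_0+\alpha\nabla\cdot\mathbf u_0$. Let $\mathbf F_f\in L^2(0,T;(\mathbf H^1_{\#,*}(\Omega_f)\cap\mathbf V)')$, $\mathbf F_b\in L^2(0,T;\mathbf L^2(\Omega_b))$ and $S\in L^2(0,T;[H^1_{\#,*}(\Omega_b)]')$. Then the weak solution $[\mathbf u,p,\mathbf v]^T$ of the Biot-Stokes system with initial data $(\mathbf u_0,\mathbf u_1,d_0,\mathbf v_0)$ and sources $\mathbf F_b,S,\mathbf F_f$ (in the sense defined in the context) is unique; that is, any two weak solutions with the same data and sources coincide.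
   Context: **Domains.** $\Omega_b=(0,1)^3$, $\Omega_f=(0,1)\times(0,1)\times(-1,0)$, interface $\Gamma_I=\partial\Omega_b\cap\partial\Omega_f=(0,1)^2\times\{0\}$, $\Gamma_b=\{x\in\partial\Omega_b: x_3=1\}$, $\Gamma_f=\{x\in\partial\Omega_f:x_3=-1\}$. $\Gamma_{lat}$ is the union of the lateral faces (in the $x_1$ and $x_2$ directions), on which periodic conditions are imposed: quantities on opposite lateral faces are identified whenever their traces are defined. $\mathbf e_i$ are the standard basis vectors; $\mathbf e_3$ is the outward normal to $\Omega_f$ on $\Gamma_I$; the tangent vectors on $\Gamma_I$ are $\mathbf e_1,\mathbf e_2$. **Stresses.** $\mathbf D(\mathbf u)=\frac12(\nabla\mathbf u+(\nabla\mathbf u)^T)$, $\sigma^E(\mathbf u)=2\mu\mathbf D(\mathbf u)+\lambda(\nabla\cdot\mathbf u)\mathbf I$, $\sigma_b(\mathbf u,p)=\sigma^E(\mathbf u)-\alpha p\mathbf I$, $\sigma_f(\mathbf v,p_f)=2\nu\mathbf D(\mathbf v)-p_f\mathbf I$. **Strong form.** In $\Omega_b\times(0,T)$: $\rho_b\mathbf u_{tt}-\nabla\cdot\sigma^E(\mathbf u)+\alpha\nabla p=\mathbf F_b$ and $[c_0p+\alpha\nabla\cdot\mathbf u]_t-\nabla\cdot[k\nabla p]=S$. In $\Omega_f\times(0,T)$: $\rho_f\mathbf v_t-2\nu\nabla\cdot\mathbf D(\mathbf v)+\nabla p_f=\mathbf F_f$, $\nabla\cdot\mathbf v=0$. Boundary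 conditions: $\mathbf u=\mathbf 0$, $p=0$ on $\Gamma_b$; $\mathbf v=\mathbf 0$ on $\Gamma_f$; lateral periodicity. On $\Gamma_I$: $-k\nabla p\cdot\mathbf e_3=(\mathbf v-\mathbf u_t)\cdot\mathbf e_3$; $\beta(\mathbf v-\mathbf u_t)\cdot\boldsymbol\tau=-\boldsymbol\tau\cdot\sigma_f\mathbf e_3$ for $\boldsymbol\tau=\mathbf e_1,\mathbf e_2$; $\sigma_f\mathbf e_3=\sigma_b\mathbf e_3$; $p=-\mathbf e_3\cdot\sigma_f\mathbf e_3$. Initial conditions: $\mathbf u(0)=\mathbf u_0$, $\mathbf u_t(0)=\mathbf u_1$, $[c_0p+\alpha\nabla\cdot\mathbf u](0)=d_0$, $\mathbf v(0)=\mathbf v_0$. **Spaces.** $H^1_\#(\Omega_i)$ ($i=b,f$) is the space of functions in $H^1(\Omega_i)$ whose traces agree on opposite lateral faces. $H^1_{\#,*}(\Omega_b)$ and $\mathbf H^1_{\#,*}(\Omega_f)$ are the subspaces of $H^1_\#(\Omega_b)$, $\mathbf H^1_\#(\Omega_f)$ with zero trace on $\Gamma_b$, $\Gamma_f$ respectively (boldface: vector-valued). $\mathbf U=\mathbf H^1_{\#,*}(\Omega_b)$. $\mathbf V=\{\mathbf v\in\mathbf L^2(\Omega_f):\ \nabla\cdot\mathbf v=0\text{ in }\Omega_f,\ \mathbf v\cdot\mathbf n=0\text{ on }\Gamma_f\}$, with laterally periodic normal traces ($\mathbf v\cdot\mathbf e_i$ agrees on the two faces $x_i=0$, $x_i=1$,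 $i=1,2$). $X=\mathbf U\times\mathbf L^2(\Omega_b)\times L^2(\Omega_b)\times\mathbf V$. Primes denote duals. Define $\mathcal V_b=L^\infty(0,T;\mathbf U)\cap W^{1,\infty}(0,T;\mathbf L^2(\Omega_b))$; $\mathcal Q_b=\{p\in L^2(0,T;H^1_{\#,*}(\Omega_b)): c_0^{1/2}p\in L^\infty(0,T;L^2(\Omega_b))\}$; $\mathcal V_f=L^\infty(0,T;\mathbf V)\cap L^2(0,T;\mathbf H^1_{\#,*}(\Omega_f)\cap\mathbf V)$; $\mathcal V_{sol}=\mathcal V_b\times\mathcal Q_b\times\mathcal V_f$; $\mathcal V_{test}=C^1_0([0,T);\mathbf U\times H^1_{\#,*}(\Omega_b)\times(\mathbf H^1_{\#,*}(\Omega_f)\cap\mathbf V))$, where $C^1_0([0,T);\cdot)$ means continuously differentiable on $[0,T)$ and vanishing near $t=T$ (no condition at $t=0$). **Notation.** $(\cdot,\cdot)_{\mathscr O}$ is the $L^2(\mathscr O)$ inner product, $((\cdot,\cdot))_{\mathscr O}$ the $L^2(0,T;L^2(\mathscr O))$ inner product, $(\langle\cdot,\cdot\rangle)_{\mathscr O}$ the corresponding time-integrated duality pairing; traces on $\Gamma_I$ are not written explicitly. **Weak solution.** $[\mathbf u,p,\mathbf v]^T\in\mathcal V_{sol}$ is a weak solution with initial data $(\mathbf u_0,\mathbf u_1,d_0,\mathbf v_0)$ and sources $\mathbf F_b,S,\mathbf F_f$ if $\mathbf u(0)=\mathbf u_0$ and: (1) for every $[\boldsymbol\xi,q,\boldsymbol\zeta]^T\in\mathcal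 V_{test}$, $$\begin{aligned}&-\rho_b((\mathbf u_t,\boldsymbol\xi_t))_{\Omega_b}+((\sigma_b(\mathbf u,p),\nabla\boldsymbol\xi))_{\Omega_b}-((c_0p+\alpha\nabla\cdot\mathbf u,\partial_tq))_{\Omega_b}+((k\nabla p,\nabla q))_{\Omega_b}\\&-\rho_f((\mathbf v,\boldsymbol\zeta_t))_{\Omega_f}+2\nu((\mathbf D(\mathbf v),\mathbf D(\boldsymbol\zeta)))_{\Omega_f}+((p,(\boldsymbol\zeta-\boldsymbol\xi)\cdot\mathbf e_3))_{\Gamma_I}-((\mathbf v\cdot\mathbf e_3,q))_{\Gamma_I}-((\mathbf u\cdot\mathbf e_3,\partial_tq))_{\Gamma_I}\\&+\beta\sum_{i=1}^2\big[((\mathbf v\cdot\mathbf e_i,(\boldsymbol\zeta-\boldsymbol\xi)\cdot\mathbf e_i))_{\Gamma_I}+((\mathbf u\cdot\mathbf e_i,(\boldsymbol\zeta_t-\boldsymbol\xi_t)\cdot\mathbf e_i))_{\Gamma_I}\big]\\=\;&\rho_b(\mathbf u_1,\boldsymbol\xi(0))_{\Omega_b}+(d_0,q(0))_{\Omega_b}+\rho_f(\mathbf v_0,\boldsymbol\zeta(0))_{\Omega_f}+(\mathbf u_0\cdot\mathbf e_3,q(0))_{\Gamma_I}\\&-\beta\sum_{i=1}^2(\mathbf u_0\cdot\mathbf e_i,(\boldsymbol\zeta(0)-\boldsymbol\xi(0))\cdot\mathbf e_i)_{\Gamma_I}+((\mathbf F_b,\boldsymbol\xi))_{\Omega_b}+(\langle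 S,q\rangle)_{\Omega_b}+(\langle\mathbf F_f,\boldsymbol\zeta\rangle)_{\Omega_f};\end{aligned}$$ (2) the time derivative of the trace satisfies $\partial_t(\mathbf u|_{\Gamma_I})\cdot\mathbf e_i\in L^2(0,T;L^2(\Gamma_I))$ for $i=1,2$. *)

(* Defs.v *)
From mathcomp Require Import all_boot all_order all_algebra.
From mathcomp Require Import all_classical all_reals all_analysis.

Set Implicit Arguments.
Unset Strict Implicit.
Unset Printing Implicit Defensive.

Import Order.TTheory GRing.Theory Num.Theory numFieldNormedType.Exports.

Local Open Scope classical_set_scope.
Local Open Scope ring_scope.

(* Elements of L^2, H^1 and of Bochner spaces are represented by functions;
   equality of classes is equality almost everywhere, and all norms below are
   seminorms on representatives. *)

Section geometry.
Variable R : realType.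

Definition e3 : 'I_3 := ord_max.

Definition coord (x : R * R * R) (i : 'I_3) : R :=
  match val i with 0%N => x.1.1 | 1%N => x.1.2 | _ => x.2 end.

Definition evec (i : 'I_3) : R * R * R :=
  ((val i == 0%N)%:R, (val i == 1%N)%:R, (val i == 2%N)%:R).

(* the point of the plane {x_i = c} whose other coordinates are y.1, y.2 *)
Definition emb (i : 'I_3) (c : R) (y : R * R) : R * R * R :=
  match val i with
  | 0%N => (c, y.1, y.2) | 1%N => (y.1, c, y.2) | _ => (y.1, y.2, c)
  end.

Record box := Box { lo : 'I_3 -> R ; hi : 'I_3 -> R }.

Definition inside (B : box) : set (R * R * R) :=
  [set x | forall i, lo B i < coord x i < hi B i].

Definition Omega_b : box := Box (fun=> 0) (fun=> 1).

Definition Omega_f : box :=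
  Box (fun i => if i == e3 then -1 else 0) (fun i => if i == e3 then 0 else 1).

(* Faces are given by a direction i and a side s: the upper face {x_i = hi i}
   for s = true, the lower face {x_i = lo i} for s = false. *)
Definition face_pos (B : box) (i : 'I_3) (s : bool) : R :=
  if s then hi B i else lo B i.

Definition face_dom (B : box) (i : 'I_3) : set (R * R) :=
  [set y | forall j, j != i -> lo B j < coord (emb i 0 y) j < hi B j].

(* the open slab obtained by removing both bounds in direction i: among the six
   closed faces it meets only the two open faces normal to the i-th axis *)
Definition slab (B : box) (i : 'I_3) : set (R * R * R) :=
  [set x | forall j, j != i -> lo B j < coord x j < hi B j].

(* the half of the slab that meets only the open face (i, s) *)
Definition half_slab (B : box) (i : 'I_3) (s : bool) : set (R * R * R) :=
  slab B i `&`
  [set x | if s then lo B i < coord x i else coord x i < hi B i].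

(* Gamma_I, parametrized by (x_1, x_2) *)
Definition Gamma_I : set (R * R) := [set y | 0 < y.1 < 1 /\ 0 < y.2 < 1].

End geometry.

Arguments Omega_b {R}.
Arguments Omega_f {R}.
Arguments Gamma_I {R}.

Section test_functions.
Variable R : realType.

Fixpoint Ck (k : nat) (f : R * R * R -> R) : Prop :=
  continuous f /\
  (if k is k'.+1 then
     forall i, (forall x, derivable f x (evec R i)) /\
               Ck k' (fun x => 'D_(evec R i) f x)
   else True).

Definition supp (T : topologicalType) (f : T -> R) : set T :=
  closure [set x | f x != 0].

(* C_c^infty(W) *)
Definition testfun (W : set (R * R * R)) (phi : R * R * R -> R) : Prop :=
  [/\ forall k, Ck k phi, compact (supp phi) & supp phi `<=` W].

(* C_c^infty(I), I a set of times *)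
Definition testfun1 (I : set R) (phi : R -> R) : Prop :=
  [/\ forall n t, derivable (derive1n n phi) t 1, compact (supp phi) &
      supp phi `<=` I].

End test_functions.

Section square_integrable.
Context {d : measure_display} {X : measurableType d} {R : realType}.
Variable mu : {measure set X -> \bar R}.

Definition L2 (A : set X) : set (X -> R) :=
  [set f : X -> R | measurable_fun A f /\
           (\int[mu]_(x in A) ((f x) ^+ 2)%:E < +oo)%E].

Definition ip (A : set X) (f g : X -> R) : R := \int[mu]_(x in A) (f x * g x).

End square_integrable.

Section sobolev.
Variable R : realType.

Local Notation sfield := (R * R * R -> R).
Local Notation vfield := ('I_3 -> R * R * R -> R).

(* measurableTypeR R is R with its Borel sigma-algebra *)
Local Notation mR := (measurableTypeR R).

Definition leb2 : {measure set (mR * mR) -> \bar R} :=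
  (@lebesgue_measure R \x @lebesgue_measure R)%E.
Definition leb3 : {measure set (mR * mR * mR) -> \bar R} :=
  (leb2 \x @lebesgue_measure R)%E.

Definition L2box (B : box R) : set sfield := L2 leb3 (inside B).
Definition ipbox (B : box R) (f g : sfield) : R := ip leb3 (inside B) f g.

Definition is_weak_partial (B : box R) (i : 'I_3) (f g : sfield) : Prop :=
  L2box B g /\
  forall phi, testfun (inside B) phi ->
    ipbox B f (fun x => 'D_(evec R i) phi x) = - ipbox B g phi.

(* some version of the weak partial derivative, when there is one in L^2 *)
Definition partial (B : box R) (i : 'I_3) (f : sfield) : sfield :=
  xget (fun=> 0) [set g | is_weak_partial B i f g].

Definition H1 (B : box R) : set sfield :=
  [set f | L2box B f /\ forall i, exists g, is_weak_partial B i f g].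

Definition ipH1 (B : box R) (f g : sfield) : R :=
  ipbox B f g + \sum_(i < 3) ipbox B (partial B i f) (partial B i g).

(* The trace on the face (i, s) is defined by Green's formula: the outward
   normal there is +e_i or -e_i, and the test functions vanish near all the
   other faces. *)
Definition is_trace (B : box R) (i : 'I_3) (s : bool)
    (f : sfield) (g : R * R -> R) : Prop :=
  L2 leb2 (face_dom B i) g /\
  forall phi, testfun (half_slab B i s) phi ->
    ipbox B f (fun x => 'D_(evec R i) phi x) + ipbox B (partial B i f) phi =
    (if s then 1 else -1) *
      ip leb2 (face_dom B i) g (fun y => phi (emb i (face_pos B i s) y)).

Definition trace (B : box R) (i : 'I_3) (s : bool) (f : sfield) : R * R -> R :=
  xget (fun=> 0) [set g | is_trace B i s f g].

Definition H1per (B : box R) : set sfield :=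
  [set f | H1 B f /\
     forall i, i != e3 ->
       exists g, is_trace B i false f g /\ is_trace B i true f g].

(* zero trace on Gamma_b = {x_3 = 1} and on Gamma_f = {x_3 = -1}, respectively *)
Definition H1star_b : set sfield :=
  [set f | H1per Omega_b f /\ is_trace Omega_b e3 true f (fun=> 0)].
Definition H1star_f : set sfield :=
  [set f | H1per Omega_f f /\ is_trace Omega_f e3 false f (fun=> 0)].

Definition vec (D : set sfield) : set vfield := [set u | forall i, D (u i)].

Definition ipv (B : box R) (u v : vfield) : R :=
  \sum_(i < 3) ipbox B (u i) (v i).
Definition ipvH1 (B : box R) (u v : vfield) : R :=
  \sum_(i < 3) ipH1 B (u i) (v i).

Definition Dsym (B : box R) (u : vfield) (i j : 'I_3) : sfield :=
  fun x => (partial B j (u i) x + partial B i (u j) x) / 2.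

Definition divg (B : box R) (u : vfield) : sfield :=
  fun x => \sum_(i < 3) partial B i (u i) x.

(* For v in L^2 with div v = 0, the normal trace is the distribution
   <v . n, phi> = int_Omega v . grad phi on the boundary. *)
Definition ntrace (B : box R) (v : vfield) (phi : sfield) : R :=
  \sum_(j < 3) ipbox B (v j) (fun x => 'D_(evec R j) phi x).

Definition Vset : set vfield :=
  [set v | [/\ vec (L2box Omega_f) v,
    (* div v = 0 *)
    forall phi, testfun (inside Omega_f) phi -> ntrace Omega_f v phi = 0,
    (* v . n = 0 on Gamma_f *)
    forall phi, testfun (half_slab Omega_f e3 false) phi ->
      ntrace Omega_f v phi = 0 &
    (* v . e_i agrees on the faces x_i = 0 and x_i = 1, whose outward normals
       are opposite *)
    forall i phi, i != e3 -> testfun (slab Omega_f i) phi ->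
      (forall y, phi (emb i (lo Omega_f i) y) = phi (emb i (hi Omega_f i) y)) ->
      ntrace Omega_f v phi = 0]].

End sobolev.

Section bochner.
Variable R : realType.

(* the time interval (0,T) *)
Definition itv0 (T : R) : set R := `]0, T[.

Record nspace (V : lmodType R) := NSpace { dom : set V ; nrm : V -> R }.

Definition hnorm (V : Type) (b : V -> V -> R) (x : V) : R := Num.sqrt (b x x).

Definition dual (V : lmodType R) (X : nspace V) : nspace (V -> R) :=
  NSpace
    [set F : V -> R |
      (forall (a : R) x y, dom X x -> dom X y ->
         F (a *: x + y) = a * F x + F y) /\
      exists M : R, forall x, dom X x -> `|F x| <= M * nrm X x]
    (fun F : V -> R =>
       sup [set `|F x| | x in [set x | dom X x /\ nrm X x <= 1]]).

Section fixed_space.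
Variables (T : R) (V : lmodType R) (X : nspace V).

Definition simple_into (s : R -> V) : Prop :=
  exists n (A : 'I_n -> set R) (c : 'I_n -> V),
    [/\ forall i, measurable (A i), forall i, dom X (c i) &
        s = fun t => \sum_(i < n) (\1_(A i) t : R) *: c i].

Definition strongly_measurable (f : R -> V) : Prop :=
  (forall t, 0 < t < T -> dom X (f t)) /\
  exists s : nat -> R -> V, (forall n, simple_into (s n)) /\
    forall t, 0 < t < T -> (fun n => nrm X (s n t - f t)) @ \oo --> (0 : R).

Definition bochner_L2 (f : R -> V) : Prop :=
  strongly_measurable f /\
  (\int[@lebesgue_measure R]_(t in itv0 T) ((nrm X (f t)) ^+ 2)%:E < +oo)%E.

Definition bochner_Linf (f : R -> V) : Prop :=
  strongly_measurable f /\
  exists M : R, {ae @lebesgue_measure R, forall t, 0 < t < T -> nrm X (f t) <= M}.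

(* f belongs to C^1_0([0,T);X), with derivative f' *)
Definition C1_0 (f f' : R -> V) : Prop :=
  [/\ forall t, 0 <= t < T -> dom X (f t) /\ dom X (f' t),
      forall t, 0 <= t < T ->
        nrm X ((s - t)^-1 *: (f s - f t) - f' t)
          @[s --> within `[0, T[ t^'] --> (0 : R),
      forall t, 0 <= t < T ->
        nrm X (f' s - f' t) @[s --> within `[0, T[ (nbhs t)] --> (0 : R) &
      exists2 tau, tau < T & forall t, 0 <= t < T -> tau <= t -> nrm X (f t) = 0].

(* The representative of f that is continuous on [0,T] takes the value x at 0. *)
Definition initial_value (f : R -> V) (x : V) : Prop :=
  exists g : R -> V,
    [/\ forall t, 0 <= t <= T -> dom X (g t),
        forall t, 0 <= t <= T ->
          nrm X (g s - g t) @[s --> within `[0, T] (nbhs t)] --> (0 : R),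
        {ae @lebesgue_measure R, forall t, 0 < t < T -> nrm X (g t - f t) = 0} &
        nrm X (g 0 - x) = 0].

(* int_0^T phi' f dt = - int_0^T phi g dt in the Hilbert space (D, b), the
   integrals being tested against every element of D *)
Definition is_weak_dt (D : set V) (b : V -> V -> R) (f g : R -> V) : Prop :=
  forall e phi, D e -> testfun1 (itv0 T) phi ->
    \int[@lebesgue_measure R]_(t in itv0 T) (derive1 phi t * b (f t) e) =
    - \int[@lebesgue_measure R]_(t in itv0 T) (phi t * b (g t) e).

End fixed_space.

End bochner.

Section biot_stokes.
Variable R : realType.

Local Notation sfield := (R * R * R -> R).
Local Notation vfield := ('I_3 -> R * R * R -> R).
Local Notation Ob := (@Omega_b R).
Local Notation Of := (@Omega_f R).

Definition L2_b : nspace sfield := NSpace (L2box Ob) (hnorm (ipbox Ob)).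
Definition bL2_b : nspace vfield := NSpace (vec (L2box Ob)) (hnorm (ipv Ob)).
Definition Hstar_b : nspace sfield := NSpace (@H1star_b R) (hnorm (ipH1 Ob)).
Definition Uspace : nspace vfield :=
  NSpace (vec (@H1star_b R)) (hnorm (ipvH1 Ob)).
Definition Vspace : nspace vfield := NSpace (@Vset R) (hnorm (ipv Of)).
(* H^1_{#,*}(Omega_f) /\ V *)
Definition HVspace : nspace vfield :=
  NSpace (vec (@H1star_f R) `&` @Vset R) (hnorm (ipvH1 Of)).
Definition L2_I : nspace (R * R -> R) :=
  NSpace (L2 (leb2 R) Gamma_I) (hnorm (ip (leb2 R) Gamma_I)).

Definition ipI (g h : R * R -> R) : R := ip (leb2 R) Gamma_I g h.

(* traces on Gamma_I, from Omega_b and from Omega_f *)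
Definition trb (f : sfield) : R * R -> R := trace Ob e3 false f.
Definition trf (f : sfield) : R * R -> R := trace Of e3 true f.

Record coeffs := Coeffs {
  rho_b : R ; rho_f : R ; nu : R ; alpha : R ; mu : R ; lambda : R ;
  kperm : R ; beta : R ; c0 : R }.

Definition sigma_b (c : coeffs) (u : vfield) (p : sfield) (i j : 'I_3) : sfield :=
  fun x => 2 * mu c * Dsym Ob u i j x
           + (i == j)%:R * (lambda c * divg Ob u x - alpha c * p x).

(* c_0 p + alpha div u *)
Definition fluid_content (c : coeffs) (u : vfield) (p : sfield) : sfield :=
  fun x => c0 c * p x + alpha c * divg Ob u x.

Definition tint (T : R) (h : R -> R) : R :=
  \int[@lebesgue_measure R]_(t in itv0 T) h t.

(* u in L^infty(0,T;U) /\ W^{1,infty}(0,T;L^2), with time derivative ut *)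
Definition in_Vb (T : R) (u ut : R -> vfield) : Prop :=
  [/\ bochner_Linf T Uspace u, bochner_Linf T bL2_b u, bochner_Linf T bL2_b ut &
      is_weak_dt T (dom bL2_b) (ipv Ob) u ut].

Definition in_Qb (T : R) (c : coeffs) (p : R -> sfield) : Prop :=
  bochner_L2 T Hstar_b p /\
  bochner_Linf T L2_b (fun t => Num.sqrt (c0 c) *: p t).

Definition in_Vf (T : R) (v : R -> vfield) : Prop :=
  bochner_Linf T Vspace v /\ bochner_L2 T HVspace v.

Definition weak_lhs (T : R) (c : coeffs) (u ut : R -> vfield) (p : R -> sfield)
    (v xi xit : R -> vfield) (q qt : R -> sfield) (zeta zetat : R -> vfield) : R :=
  - rho_b c * tint T (fun t => ipv Ob (ut t) (xit t))
  + tint T (fun t => \sum_(i < 3) \sum_(j < 3)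
      ipbox Ob (sigma_b c (u t) (p t) i j) (partial Ob j (xi t i)))
  - tint T (fun t => ipbox Ob (fluid_content c (u t) (p t)) (qt t))
  + tint T (fun t => \sum_(i < 3)
      ipbox Ob (fun x => kperm c * partial Ob i (p t) x) (partial Ob i (q t)))
  - rho_f c * tint T (fun t => ipv Of (v t) (zetat t))
  + 2 * nu c * tint T (fun t => \sum_(i < 3) \sum_(j < 3)
      ipbox Of (Dsym Of (v t) i j) (Dsym Of (zeta t) i j))
  + tint T (fun t => ipI (trb (p t))
      (fun y => trf (zeta t e3) y - trb (xi t e3) y))
  - tint T (fun t => ipI (trf (v t e3)) (trb (q t)))
  - tint T (fun t => ipI (trb (u t e3)) (trb (qt t)))
  + beta c * \sum_(i < 3 | i != e3)
      (tint T (fun t => ipI (trf (v t i))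
         (fun y => trf (zeta t i) y - trb (xi t i) y))
       + tint T (fun t => ipI (trb (u t i))
         (fun y => trf (zetat t i) y - trb (xit t i) y))).

Definition weak_rhs (T : R) (c : coeffs)
    (u0 u1 : vfield) (d0 : sfield) (v0 : vfield)
    (Fb : R -> vfield) (S : R -> sfield -> R) (Ff : R -> vfield -> R)
    (xi : R -> vfield) (q : R -> sfield) (zeta : R -> vfield) : R :=
  rho_b c * ipv Ob u1 (xi 0) + ipbox Ob d0 (q 0) + rho_f c * ipv Of v0 (zeta 0)
  + ipI (trb (u0 e3)) (trb (q 0))
  - beta c * \sum_(i < 3 | i != e3)
      ipI (trb (u0 i)) (fun y => trf (zeta 0 i) y - trb (xi 0 i) y)
  + tint T (fun t => ipv Ob (Fb t) (xi t))
  + tint T (fun t => S t (q t))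
  + tint T (fun t => Ff t (zeta t)).

Definition weak_solution (T : R) (c : coeffs)
    (u0 u1 : vfield) (d0 : sfield) (v0 : vfield)
    (Fb : R -> vfield) (S : R -> sfield -> R) (Ff : R -> vfield -> R)
    (u : R -> vfield) (p : R -> sfield) (v : R -> vfield) : Prop :=
  exists ut : R -> vfield,
    [/\ [/\ in_Vb T u ut, in_Qb T c p & in_Vf T v],
        initial_value T bL2_b u u0,
        (forall xi xit q qt zeta zetat,
          C1_0 T Uspace xi xit -> C1_0 T Hstar_b q qt ->
          C1_0 T HVspace zeta zetat ->
          weak_lhs T c u ut p v xi xit q qt zeta zetat =
          weak_rhs T c u0 u1 d0 v0 Fb S Ff xi q zeta) &
        (forall i, i != e3 ->
          exists2 g : R -> R * R -> R, bochner_L2 T L2_I g &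
            is_weak_dt T (dom L2_I) ipI (fun t => trb (u t i)) g)].

End biot_stokes.

(* Main.v *)
(* The difference (u, p, v) of two weak solutions has zero data.  Write
   y = (p, v).  Testing with phi(t) e, phi(t) = int_t^T psi, and varying psi, one
   time derivative is integrated away: for almost every t,
     rho_b (u_t, e) + M11(u, e) + int_0^t A11(u, e) + int_0^t A21(y, e) = 0,
     M12(u, w) + M22(y, w) + int_0^t A22(y, w) = 0
   for all e and w.  The weak solution is not regular enough for the usual
   energy test functions, so the first equation is taken at e = u(t) and the
   second at w = Y(t) := int_0^t y.  Their sum says that the time derivative of
     (rho_b |u|^2 + A11(U, U) + M22(Y, Y)) / 2,  where U(t) = int_0^t u,
   plus M11(u, u) + M12(u, Y) + A21(Y, u) + A22(Y, Y) is zero.  In the latter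
   expression the couplings of Biot and Stokes cancel; it equals
   k |grad P|^2 + 2 nu |D(V)|^2 plus beta times the squared norm of the
   tangential part of u - V on the interface, with Y = (P, V).  Hence u, v
   and grad P vanish, and so does grad p; when c_0 = 0 the pressure is then
   recovered from its zero trace on Gamma_b. *)

Require Import Defs.
From HB Require Import structures.
From mathcomp Require Import all_boot all_order all_algebra.
From mathcomp Require Import all_classical all_reals all_analysis.
From mathcomp Require Import measurable_realfun lebesgue_integral_differentiation.
From mathcomp Require Import ring lra.
Set Implicit Arguments.
Unset Strict Implicit.
Unset Printing Implicit Defensive.
Import Order.TTheory GRing.Theory Num.Theory numFieldNormedType.Exports.
Local Open Scope classical_set_scope.
Local Open Scope ring_scope.

(** * Integrals of real functions *)

(** Two obstacles shape the proof. The spaces consist of representatives with seminorms and are not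
    shown to be complete, so U(t) and Y(t) need not exist as elements. They enter only through
    bounded forms: a functional at Y(t) is the time integral of the functional at y, and a quadratic
    form at Y(t) is a double integral over the square (0,t) x (0,t). The latter is a limit of values
    at genuine elements, so that positivity and the dissipation inequality survive. The second
    obstacle is that the exceptional null set of times in each equation depends on the test element,
    while the elements finally inserted depend on time; strong measurability provides one null set
    for all values of the solution. No energy is differentiated: by symmetry, the integral of a form
    over the triangle r < s < t is half of its integral over the square. Weak derivatives and traces
    are chosen representatives, linear only almost everywhere, and traces with an H^1 bound on the
    faces normal to e_3 have to be constructed from the Green formula that defines them. *)

Lemma sigma_finite_product d1 d2 (T1 : measurableType d1)
    (T2 : measurableType d2) (R : realType)
    (m1 : {sigma_finite_measure set T1 -> \bar R})
    (m2 : {sigma_finite_measure set T2 -> \bar R}) :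
  sigma_finite [set: T1 * T2] (m1 \x m2)%E.
Proof.
have /sigma_finiteP[F [FT ndF Ffin]] := sigma_finiteT m1.
have /sigma_finiteP[G [GT ndG Gfin]] := sigma_finiteT m2.
exists (fun n => F n `*` G n).
  apply/esym; rewrite -subTset => -[x y] _.
  have [n _ Fx] : (\bigcup_i F i) x by rewrite -FT.
  have [k _ Gy] : (\bigcup_i G i) y by rewrite -GT.
  exists (maxn n k) => //; split=> /=.
    exact: (subsetPset _ _ (ndF _ _ (leq_maxl n k))).
  exact: (subsetPset _ _ (ndG _ _ (leq_maxr n k))).
move=> n; have [mF Foo] := Ffin n; have [mG Goo] := Gfin n.
split; first exact: measurableX.
by rewrite product_measure1E// lte_mul_pinfty// ge0_fin_numE.
Qed.

Section leb2_sigma_finite.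
Variable R : realType.
Local Notation mR := (measurableTypeR R).
(** The measure [leb2] carries no sigma-finite structure. This copy of the same product does, and it
    is convertible to [leb2], so that Fubini for [leb2s] times Lebesgue measure applies to
    [leb3]. *)
Definition leb2f : set (mR * mR) -> \bar R :=
  (@lebesgue_measure R \x @lebesgue_measure R)%E.
HB.instance Definition _ := Measure.on leb2f.
HB.instance Definition _ := Measure_isSigmaFinite.Build _ _ _ leb2f
    (sigma_finite_product (@lebesgue_measure R) (@lebesgue_measure R)).
Definition leb2s : {sigma_finite_measure set (mR * mR)%type -> \bar R} := leb2f.
End leb2_sigma_finite.

Lemma cvg0_le (R : realType) (g h : nat -> R) : (forall n, `|g n| <= h n) ->
  h n @[n --> \oo] --> (0 : R) -> g n @[n --> \oo] --> (0 : R).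
Proof.
move=> gh /cvgrPdist_le h0; apply/cvgrPdist_le => e /h0; apply: filterS => n.
rewrite !sub0r !normrN => hn; apply: le_trans (gh n) (le_trans (ler_norm _) hn).
Qed.

Section real_integrals.
Context d (X : measurableType d) (R : realType).
Variable mu : {measure set X -> \bar R}.
Implicit Types (D : set X) (f g h : X -> R).

Definition intble D f := mu.-integrable D (EFin \o f).

Lemma intbleD D f g : measurable D ->
  intble D f -> intble D g -> intble D (fun x => f x + g x).
Proof. by move=> mD If Ig; apply: eq_integrable (integrableD mD If Ig). Qed.

Lemma intbleZ D a f : measurable D -> intble D f -> intble D (fun x => a * f x).
Proof. by move=> mD If; apply: eq_integrable (integrableZl mD a If). Qed.

Lemma intbleB D f g : measurable D ->
  intble D f -> intble D g -> intble D (fun x => f x - g x).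
Proof. by move=> mD If Ig; apply: eq_integrable (integrableB mD If Ig). Qed.

Lemma intble_sum D n (f : 'I_n -> X -> R) : measurable D ->
  (forall i, intble D (f i)) -> intble D (fun x => \sum_(i < n) f i x).
Proof.
move=> mD If; rewrite /intble.
apply: (@eq_integrable _ _ _ _ _ mD (fun x => (\sum_(i < n) (f i x)%:E)%E)).
  by move=> x _ /=; rewrite sumEFin.
by apply: integrable_sum => // i _; exact: If.
Qed.

Lemma intble_meas D f : intble D f -> measurable_fun D f.
Proof. by move=> /measurable_int /measurable_EFinP. Qed.

Lemma intble_le D f g : measurable D -> measurable_fun D f ->
  (forall x, D x -> `|f x| <= g x) -> intble D g -> intble D f.
Proof.
move=> mD mf fg Ig; apply: le_integrable Ig => //; first exact/measurable_EFinP.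
by move=> x Dx /=; rewrite lee_fin (le_trans (fg _ Dx))// ler_norm.
Qed.

Lemma intble_norm D f : measurable D -> intble D f -> intble D (fun x => `|f x|).
Proof. by move=> mD If; exact: integrable_norm. Qed.

Lemma intbleS D D' f : measurable D -> measurable D' -> D `<=` D' ->
  intble D' f -> intble D f.
Proof. by move=> mD mD' DD'; apply: integrableS. Qed.

Lemma intble_cst D a : measurable D -> (mu D < +oo)%E -> intble D (cst a).
Proof.
move=> mD fD; apply: measurable_bounded_integrable => //.
exists `|a|; split; first exact: num_real.
by move=> M aM x _ /=; exact: ltW.
Qed.

Lemma intble_eq D f g : measurable D -> (forall x, D x -> f x = g x) ->
  intble D f -> intble D g.
Proof.
move=> mD fg; apply: eq_integrable => // x /set_mem Dx /=; by rewrite fg.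
Qed.

Lemma intR_eq D f g : (forall x, D x -> f x = g x) ->
  \int[mu]_(x in D) f x = \int[mu]_(x in D) g x.
Proof. by move=> fg; apply: eq_Rintegral => x /set_mem; apply: fg. Qed.

Lemma intR_sum D n (f : 'I_n -> X -> R) : measurable D ->
  (forall i, intble D (f i)) ->
  \int[mu]_(x in D) (\sum_(i < n) f i x) = \sum_(i < n) \int[mu]_(x in D) f i x.
Proof.
move=> mD; elim: n f => [|n IH] f If.
  rewrite big_ord0 -[RHS](mul0r (\int[mu]_(x in D) (cst 0 x))).
  rewrite -RintegralZl//; last exact: integrable0.
  by apply: intR_eq => x _; rewrite big_ord0 mul0r.
rewrite big_ord_recr /= -IH//.
rewrite -RintegralD//; first last.
- exact: If.
- exact: (@intble_sum D n (fun i => f (widen_ord (leqnSn n) i))).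
by apply: intR_eq => x _; rewrite big_ord_recr.
Qed.

Lemma intR_le D f g : measurable D -> intble D f -> intble D g ->
  (forall x, D x -> f x <= g x) ->
  \int[mu]_(x in D) f x <= \int[mu]_(x in D) g x.
Proof. by move=> mD If Ig fg; apply: le_Rintegral. Qed.

Lemma intR_cvg D (f_ : nat -> X -> R) f g : measurable D ->
  (forall n, measurable_fun D (f_ n)) -> 
  (forall x, D x -> (f_ n x) @[n --> \oo] --> f x) ->
  intble D g -> (forall n x, D x -> `|f_ n x| <= g x) ->
  intble D f /\
  (\int[mu]_(x in D) f_ n x) @[n --> \oo] --> \int[mu]_(x in D) f x.
Proof.
move=> mD mf_ f_f Ig fg.
have mf := measurable_fun_cvg mf_ f_f.
have [//| | | | |If _ cvgI] := @dominated_convergence _ X R mu D mD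
    (fun n => EFin \o f_ n) (EFin \o f) (EFin \o g).
- by move=> n; apply/measurable_EFinP.
- exact/measurable_EFinP.
- by apply: aeW => x Dx; apply: cvg_EFin; [exact: nearW|exact: f_f].
- exact: Ig.
- by apply: aeW => x Dx n /=; rewrite lee_fin fg.
split=> //; apply: fine_cvg; rewrite fineK; last exact: integrable_fin_num.
exact: cvgI.
Qed.

Lemma intR_cvg_lim D (f_ : nat -> X -> R) f g : measurable D ->
  (forall n, measurable_fun D (f_ n)) ->
  (forall x, D x -> (f_ n x) @[n --> \oo] --> f x) ->
  intble D g -> (forall n x, D x -> `|f_ n x| <= g x) ->
  (\int[mu]_(x in D) f_ n x) @[n --> \oo] --> \int[mu]_(x in D) f x.
Proof. by move=> mD mf ff Ig fg; have [] := intR_cvg mD mf ff Ig fg. Qed.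

Lemma intR_ae_eq D f g : measurable D -> intble D f -> measurable_fun D g ->
  ae_eq mu D f g -> \int[mu]_(x in D) f x = \int[mu]_(x in D) g x.
Proof.
move=> mD If mg fg; congr fine; apply: ae_eq_integral => //.
- by apply/measurable_EFinP/intble_meas.
- exact/measurable_EFinP.
- by apply: filterS fg => x fg Dx /=; rewrite fg.
Qed.

Lemma intble_fin D f : measurable D -> intble D f ->
  (\int[mu]_(x in D) (f x)%:E)%E = (\int[mu]_(x in D) f x)%:E.
Proof. by move=> mD If; rewrite /Rintegral fineK//; exact: integrable_fin_num. Qed.

Lemma intR_ge0_eq0 D f : measurable D -> intble D f ->
  (forall x, D x -> 0 <= f x) -> \int[mu]_(x in D) f x <= 0 ->
  ae_eq mu D f (cst 0).
Proof.
move=> mD If f0 I0.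
have : ae_eq mu D (EFin \o f) (cst 0%E).
  apply/ae_eq_integral_abs => //; first exact: measurable_int If.
  rewrite (eq_integral (EFin \o f)); last first.
    by move=> x /set_mem Dx /=; rewrite ger0_norm// f0.
  rewrite intble_fin//; congr EFin; apply/eqP; rewrite eq_le I0.
  exact: Rintegral_ge0.
by apply: filterS => x fx Dx; have /= [] := fx Dx.
Qed.

Lemma aeS (P Q : X -> Prop) : (forall x, P x -> Q x) ->
  {ae mu, forall x, P x} -> {ae mu, forall x, Q x}.
Proof. by move=> PQ; exact: filterS. Qed.

Lemma aeI (P Q : X -> Prop) :
  {ae mu, forall x, P x} -> {ae mu, forall x, Q x} ->
  {ae mu, forall x, P x /\ Q x}.
Proof. exact: filterI. Qed.

Lemma intR0 D : \int[mu]_(x in D) (0:R) = 0.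
Proof. by rewrite /Rintegral integral0. Qed.

End real_integrals.

(** * Bounded forms on inner product spaces *)

Section forms.
Variable R : realType.

Definition subsp (V : lmodType R) (D : set V) :=
  D 0 /\ forall (a : R) x y, D x -> D y -> D (a *: x + y).

(** Linearity is required on [D] only: a chosen weak derivative or trace has no reason to be linear
    on functions that have none. *)
Definition lin_on (V : lmodType R) (D : set V) (l : V -> R) :=
  forall (a : R) x y, D x -> D y -> l (a *: x + y) = a * l x + l y.

Definition bilin_on (V V' : lmodType R) (D : set V) (D' : set V')
    (b : V -> V' -> R) :=
  (forall y, D' y -> lin_on D (b ^~ y)) /\ (forall x, D x -> lin_on D' (b x)).

(** There is no definiteness: elements are functions, and a function that vanishes almost everywhere
    has norm zero. *)
Record inner_on (V : lmodType R) (D : set V) (b : V -> V -> R) : Prop := InnerOn {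
  inner_subsp : subsp D ;
  inner_bilin : bilin_on D D b ;
  inner_sym : forall x y, D x -> D y -> b x y = b y x ;
  inner_ge0 : forall x, D x -> 0 <= b x x }.

Definition bdd_lin (V : lmodType R) (D : set V) (b : V -> V -> R) (l : V -> R) :=
  lin_on D l /\ exists2 C, 0 <= C & forall x, D x -> `|l x| <= C * hnorm b x.

Definition bdd_form (V V' : lmodType R) (D : set V) (b : V -> V -> R)
    (D' : set V') (b' : V' -> V' -> R) (B : V -> V' -> R) :=
  bilin_on D D' B /\
  exists2 C, 0 <= C &
    forall x y, D x -> D' y -> `|B x y| <= C * (hnorm b x * hnorm b' y).

Section subspaces.
Variables (V : lmodType R) (D : set V).
Hypothesis sD : subsp D.

Lemma subsp0 : D 0. Proof. by case: sD. Qed.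

Lemma subspD x y : D x -> D y -> D (x + y).
Proof. by move=> Dx Dy; rewrite -[x]scale1r; apply: sD.2. Qed.

Lemma subspZ (a : R) x : D x -> D (a *: x).
Proof. by move=> Dx; rewrite -[_ *: _]addr0; apply: sD.2 => //; exact: subsp0. Qed.

Lemma subspB x y : D x -> D y -> D (x - y).
Proof. by move=> Dx Dy; rewrite -scaleN1r addrC; apply: sD.2. Qed.

Lemma subsp_sum n (c : 'I_n -> V) : (forall i, D (c i)) -> D (\sum_(i < n) c i).
Proof. by move=> Dc; elim/big_ind: _ => //; [exact: subsp0|exact: subspD]. Qed.

Variable l : V -> R.
Hypothesis ll : lin_on D l.

Lemma lin0 : l 0 = 0.
Proof.
have := ll 1 subsp0 subsp0; rewrite scaler0 addr0 mul1r => /eqP.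
by rewrite -subr_eq subrr eq_sym => /eqP.
Qed.

Lemma linD x y : D x -> D y -> l (x + y) = l x + l y.
Proof. by move=> Dx Dy; rewrite -[x in LHS]scale1r ll// mul1r. Qed.

Lemma linZ a x : D x -> l (a *: x) = a * l x.
Proof. by move=> Dx; rewrite -[_ *: _]addr0 ll// ?lin0 ?addr0//; exact: subsp0. Qed.

Lemma linB x y : D x -> D y -> l (x - y) = l x - l y.
Proof. by move=> Dx Dy; rewrite -scaleN1r addrC ll// mulN1r addrC. Qed.

Lemma lin_sum n (c : 'I_n -> V) : (forall i, D (c i)) ->
  l (\sum_(i < n) c i) = \sum_(i < n) l (c i).
Proof.
elim: n c => [|n IH] c Dc; first by rewrite !big_ord0 lin0.
by rewrite !big_ord_recr /= linD ?IH//; exact: subsp_sum.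
Qed.

End subspaces.

Section inner.
Variables (V : lmodType R) (D : set V) (b : V -> V -> R).
Hypothesis ib : inner_on D b.
Let sD := inner_subsp ib.
Let bl := inner_bilin ib.

Lemma hnorm_ge0 x : 0 <= hnorm b x. Proof. exact: sqrtr_ge0. Qed.

Lemma hnorm_sqr x : D x -> hnorm b x ^+ 2 = b x x.
Proof. by move=> Dx; rewrite sqr_sqrtr// (inner_ge0 ib). Qed.

(** The value t = - q / r minimizes the quadratic. Since forms are only semidefinite, r = 0 can
    occur; there the chosen t makes the expression equal to -1 unless q = 0. *)
Lemma discriminant_le (p q r : R) : 0 <= r ->
  (forall t, 0 <= p + 2 * t * q + t ^+ 2 * r) -> q ^+ 2 <= p * r.
Proof.
move=> r0 h; have [r_eq0|r_neq0] := eqVneq r 0.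
  have [->|q0] := eqVneq q 0; first by rewrite r_eq0 mulr0 expr0n.
  have := h (- (p + 1) / (2 * q)); rewrite r_eq0 mulr0 addr0.
  suff -> : 2 * (- (p + 1) / (2 * q)) * q = - (p + 1) by lra.
  by field; rewrite q0.
have rp : 0 < r by rewrite lt_neqAle eq_sym r_neq0.
have := h (- q / r).
have -> : p + 2 * (- q / r) * q + (- q / r) ^+ 2 * r = (p * r - q ^+ 2) / r.
  by field; rewrite r_neq0.
by rewrite pmulr_lge0 ?invr_gt0// subr_ge0.
Qed.

Lemma inner_expand x y (t : R) : D x -> D y ->
  b (x + t *: y) (x + t *: y) = b x x + 2 * t * b x y + t ^+ 2 * b y y.
Proof.
move=> Dx Dy; have Dty : D (t *: y) by exact: subspZ.
have Ds : D (x + t *: y) by exact: subspD.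
rewrite (linD (bl.1 _ Ds))// (linD (bl.2 _ Dx))// (linD (bl.2 _ Dty))//.
rewrite (linZ sD (bl.2 _ Dx))// (linZ sD (bl.1 _ Dx))//.
rewrite (linZ sD (bl.2 _ Dty))// (linZ sD (bl.1 _ Dy))//.
by rewrite (inner_sym ib Dy Dx); ring.
Qed.

Lemma inner_CS_sqr x y : D x -> D y -> b x y ^+ 2 <= b x x * b y y.
Proof.
move=> Dx Dy; apply: discriminant_le; first exact: (inner_ge0 ib).
move=> t; rewrite -inner_expand//; apply: (inner_ge0 ib).
by apply: subspD => //; exact: subspZ.
Qed.

Lemma inner_CS x y : D x -> D y -> `|b x y| <= hnorm b x * hnorm b y.
Proof.
move=> Dx Dy; rewrite -(@ler_pXn2r _ 2)// ?nnegrE// ?mulr_ge0 ?hnorm_ge0//.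
by rewrite exprMn !hnorm_sqr// -normrX ger0_norm ?sqr_ge0// inner_CS_sqr.
Qed.

Lemma hnorm0 : hnorm b 0 = 0.
Proof. by rewrite /hnorm (lin0 sD (bl.1 _ (subsp0 sD))) sqrtr0. Qed.

Lemma hnormZ (a : R) x : D x -> hnorm b (a *: x) = `|a| * hnorm b x.
Proof.
move=> Dx; rewrite /hnorm (linZ sD (bl.1 _ (subspZ sD a Dx)))//.
by rewrite (linZ sD (bl.2 _ Dx))// mulrA -expr2 sqrtrM ?sqr_ge0// sqrtr_sqr.
Qed.

Lemma hnorm_triangle x y : D x -> D y -> hnorm b (x + y) <= hnorm b x + hnorm b y.
Proof.
move=> Dx Dy; rewrite -(@ler_pXn2r _ 2)// ?nnegrE ?addr_ge0 ?hnorm_ge0//.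
rewrite hnorm_sqr; last exact: subspD.
have := inner_expand 1 Dx Dy; rewrite scale1r => ->.
rewrite sqrrD !hnorm_sqr// expr1n mul1r mulr1 lerD2r lerD2l mulr_natl.
by rewrite ler_wMn2r// (le_trans (ler_norm _))// inner_CS.
Qed.

Lemma hnormB_sym x y : D x -> D y -> hnorm b (x - y) = hnorm b (y - x).
Proof.
move=> Dx Dy; have -> : x - y = (-1) *: (y - x) by rewrite scaleN1r opprB.
by rewrite hnormZ ?normrN1 ?mul1r//; exact: subspB.
Qed.

Lemma bdd_form_inner : bdd_form D b D b b.
Proof.
by split=> //; exists 1 => // x y Dx Dy; rewrite mul1r inner_CS.
Qed.

End inner.

Section bounded_forms.
Variables (V V' : lmodType R) (D : set V) (b : V -> V -> R).
Variables (D' : set V') (b' : V' -> V' -> R).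
Implicit Types B : V -> V' -> R.

Lemma bdd_formZ a B : bdd_form D b D' b' B -> bdd_form D b D' b' (fun x y => a * B x y).
Proof.
move=> [[l1 l2] [C C0 hC]]; split.
  split=> [y Dy k x x' Dx Dx' | x Dx k y y' Dy Dy'].
    by rewrite l1//; ring.
  by rewrite (l2 _ Dx)//; ring.
exists (`|a| * C); first by rewrite mulr_ge0.
by move=> x y Dx Dy; rewrite normrM -mulrA ler_wpM2l// hC.
Qed.

Lemma bdd_formD B B' : bdd_form D b D' b' B -> bdd_form D b D' b' B' ->
  bdd_form D b D' b' (fun x y => B x y + B' x y).
Proof.
move=> [[l1 l2] [C C0 hC]] [[l1' l2'] [C' C0' hC']]; split.
  split=> [y Dy k x x' Dx Dx' | x Dx k y y' Dy Dy'].
    by rewrite l1// l1'//; ring.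
  by rewrite (l2 _ Dx)// (l2' _ Dx)//; ring.
exists (C + C'); first by rewrite addr_ge0.
move=> x y Dx Dy; rewrite (le_trans (ler_normD _ _))// mulrDl.
by rewrite lerD ?hC ?hC'.
Qed.

Lemma bdd_form_sum n (P : pred 'I_n) (B : 'I_n -> V -> V' -> R) :
  (forall i, bdd_form D b D' b' (B i)) ->
  bdd_form D b D' b' (fun x y => \sum_(i < n | P i) B i x y).
Proof.
move=> hB; elim: (index_enum _) => [|i s IH].
  under eq_fun do under eq_fun do rewrite big_nil.
  split.
    by split=> [y Dy k x x' Dx Dx' | x Dx k y y' Dy Dy']; rewrite mulr0 addr0.
  by exists 0 => // x y _ _; rewrite mul0r normr0.
under eq_fun do under eq_fun do rewrite big_cons.
by case: (P i) => //; exact: bdd_formD.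
Qed.

Lemma bdd_form_linl B y : bdd_form D b D' b' B -> D' y ->
  bdd_lin D b (B ^~ y).
Proof.
move=> [[l1 l2] [C C0 hC]] Dy; split; first exact: l1.
exists (C * hnorm b' y); first by rewrite mulr_ge0 ?hnorm_ge0.
by move=> x Dx; rewrite (le_trans (hC _ _ Dx Dy))// -mulrA (mulrC (hnorm b' y)).
Qed.

Lemma bdd_form_linr B x : bdd_form D b D' b' B -> D x ->
  bdd_lin D' b' (B x).
Proof.
move=> [[l1 l2] [C C0 hC]] Dx; split; first exact: l2.
exists (C * hnorm b x); first by rewrite mulr_ge0 ?hnorm_ge0.
by move=> y Dy; rewrite (le_trans (hC _ _ Dx Dy))// -mulrA.
Qed.

End bounded_forms.

Lemma bdd_form_flip (V V' : lmodType R) (D : set V) b (D' : set V') b'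
  (B : V -> V' -> R) :
  bdd_form D b D' b' B -> bdd_form D' b' D b (fun y x => B x y).
Proof.
move=> [[l1 l2] [C C0 hC]]; split; first by split.
by exists C => // x y Dx Dy; rewrite (mulrC (hnorm b' x)) hC.
Qed.

End forms.

(** * Bochner measurability and integration *)

Section bochner_calculus.
Variable R : realType.
Variable T : R.
Local Notation mu := (@lebesgue_measure R).
Local Notation I := (itv0 T).

Lemma itv0E (t : R) : I t = (0 < t < T) :> Prop.
Proof. by rewrite /itv0 /= in_itv. Qed.

Lemma measurable_itv0 (t : R) : measurable (itv0 t : set (measurableTypeR R)).
Proof. exact: measurable_itv. Qed.
Hint Resolve measurable_itv0 : core.

Lemma itv0S (s t : R) : s <= t -> itv0 s `<=` itv0 t.
Proof.
move=> st x; rewrite /itv0 /= !in_itv /= => /andP[-> xs].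
exact: lt_le_trans st.
Qed.

Lemma itv0_fin (t : R) : (mu (itv0 t) < +oo)%E.
Proof. by rewrite lebesgue_measure_itv /=; case: ifP => // _; rewrite -EFinD ltry. Qed.

Section measurability.
Variables (V V' : lmodType R) (D : set V) (b : V -> V -> R).
Variables (D' : set V') (b' : V' -> V' -> R) (B : V -> V' -> R).
Hypotheses (ib : inner_on D b) (ib' : inner_on D' b').
Local Notation X := (NSpace D (hnorm b)).
Local Notation X' := (NSpace D' (hnorm b')).

Lemma simple_into_dom s t : simple_into X s -> D (s t).
Proof.
move=> [n [A [c [mA Dc ->]]]]; apply: subsp_sum; first exact: (inner_subsp ib).
by move=> i; apply: subspZ; [exact: (inner_subsp ib)|exact: Dc].
Qed.

Variables (dZ : measure_display) (Z : measurableType dZ) (E : set Z).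
Variables (p q : Z -> measurableTypeR R).
Hypotheses (mE : measurable E).
Hypotheses (mp : measurable_fun E p) (mq : measurable_fun E q).

Lemma measurable_indic_comp (A : set (measurableTypeR R)) (r : Z -> measurableTypeR R) :
  measurable A -> measurable_fun E r ->
  measurable_fun E (fun z => \1_A (r z) : R).
Proof.
move=> mA mr.
have m1 : measurable_fun setT (\1_A : measurableTypeR R -> R) by exact: measurable_indic.
exact: (measurableT_comp m1 mr).
Qed.

Lemma measurable_simple_form s s' : bilin_on D D' B ->
  simple_into X s -> simple_into X' s' ->
  measurable_fun E (fun z => B (s (p z)) (s' (q z))).
Proof.
move=> bB [n [A [c [mA Dc ->]]]] [n' [A' [c' [mA' Dc' ->]]]].
have sD := inner_subsp ib; have sD' := inner_subsp ib'.
have DZ i (a : R) : D (a *: c i) by exact: (subspZ sD a (Dc i)).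
have DZ' i (a : R) : D' (a *: c' i) by exact: (subspZ sD' a (Dc' i)).
rewrite (_ : (fun z => _) = fun z => \sum_(i < n) \sum_(j < n')
   (\1_(A i) (p z) * (\1_(A' j) (q z) * B (c i) (c' j)))); last first.
  apply/funext => z; rewrite (lin_sum sD (bB.1 _ (subsp_sum sD' _)))//.
  apply: eq_bigr => i _; rewrite (lin_sum sD' (bB.2 _ (DZ _ _)))//.
  apply: eq_bigr => j _; rewrite (linZ sD (bB.1 _ (DZ' _ _)))//; last exact: Dc.
  by rewrite (linZ sD' (bB.2 _ (Dc _)))//; exact: Dc'.
apply: measurable_sum => i; apply: measurable_sum => j.
apply: measurable_funM; first exact: (measurable_indic_comp (mA i) mp).
apply: measurable_funM; first exact: (measurable_indic_comp (mA' j) mq).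
exact: measurable_cst.
Qed.

Hypotheses (Ip : forall z, E z -> I (p z)) (Iq : forall z, E z -> I (q z)).

Lemma cvg_form f (s : nat -> R -> V) f' (s' : nat -> R -> V') t t' :
  bdd_form D b D' b' B ->
  D (f t) -> (forall n, D (s n t)) -> D' (f' t') -> (forall n, D' (s' n t')) ->
  (hnorm b (s n t - f t) @[n --> \oo] --> (0 : R)) ->
  (hnorm b' (s' n t' - f' t') @[n --> \oo] --> (0 : R)) ->
  (B (s n t) (s' n t')) @[n --> \oo] --> B (f t) (f' t').
Proof.
move=> [[l1 l2] [C C0 hB]] Df Ds Df' Ds' cs cs'.
have sD := inner_subsp ib; have sD' := inner_subsp ib'.
apply/cvgrPdist_le => e e0.
pose h n := C * (hnorm b (s n t - f t) * (hnorm b' (s' n t' - f' t') + hnorm b' (f' t')))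
    + C * (hnorm b (f t) * hnorm b' (s' n t' - f' t')).
have ch : h n @[n --> \oo] --> (0 : R).
  rewrite (_ : 0 = C * (0 * (0 + hnorm b' (f' t'))) + C * (hnorm b (f t) * 0)); last by ring.
  apply: cvgD; apply: cvgMr; last by apply: cvgMr.
  by apply: cvgM => //; apply: cvgD => //; exact: cvg_cst.
move/cvgrPdist_le : ch => /(_ _ e0); apply: filterS => n.
rewrite sub0r normrN => hn; apply: le_trans (le_trans _ hn).
  exact: lexx.
apply: le_trans (ler_norm _).
rewrite distrC.
have -> : B (s n t) (s' n t') - B (f t) (f' t') =
  B (s n t - f t) (s' n t') + B (f t) (s' n t' - f' t').
  by rewrite (linB (l1 _ (Ds' n)))// (linB (l2 _ Df))//; ring.
rewrite (le_trans (ler_normD _ _))// lerD//.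
  apply: (le_trans (hB _ _ (subspB sD (Ds n) Df) (Ds' n))).
  rewrite ler_wpM2l// ler_wpM2l ?hnorm_ge0//.
  rewrite -{1}(subrK (f' t') (s' n t')); apply: (hnorm_triangle ib') => //.
  exact: subspB.
by apply: hB => //; exact: subspB.
Qed.

(** The maps [p] and [q] allow two uses: both the identity of (0,T), for the integrand of a time
    integral, and the two projections of the square, for the joint measurability that Fubini
    requires. *)
Lemma measurable_form f g : bdd_form D b D' b' B ->
  strongly_measurable T X f -> strongly_measurable T X' g ->
  measurable_fun E (fun z => B (f (p z)) (g (q z))).
Proof.
move=> hB [Df [s [ss sf]]] [Dg [s' [ss' sg]]].
apply: (measurable_fun_cvg (h := fun n z => B (s n (p z)) (s' n (q z)))).
  by move=> n; apply: measurable_simple_form => //; exact: hB.1.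
move=> z Ez; have := Ip Ez; have := Iq Ez; rewrite !itv0E => Iqz Ipz.
apply: cvg_form => //; [exact: Df| |exact: Dg| |exact: sf|exact: sg].
  by move=> n; exact: simple_into_dom.
move=> n; case: (ss' n) => k [A [c [mA Dc ->]]].
apply: subsp_sum; first exact: (inner_subsp ib').
by move=> i; apply: subspZ; [exact: (inner_subsp ib')|exact: Dc].
Qed.

End measurability.

End bochner_calculus.

(** * Fubini's theorem for real functions on products of sets *)

Section real_fubini.
Variables (d1 d2 : measure_display) (X : measurableType d1) (Y : measurableType d2).
Variable R : realType.
Variable m1 : {sigma_finite_measure set X -> \bar R}.
Variable m2 : {sigma_finite_measure set Y -> \bar R}.
Variables (D1 : set X) (D2 : set Y) (mD1 : measurable D1) (mD2 : measurable D2).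

Let pm : {measure set (X * Y)%type -> \bar R} := (m1 \x m2)%E.

Let mD12 : measurable (D1 `*` D2). Proof. exact: measurableX. Qed.

Section with_f.
Variable f : X * Y -> R.
Hypothesis If : intble pm (D1 `*` D2) f.

Let F : X * Y -> \bar R := (EFin \o f) \_ (D1 `*` D2).

Let IF : pm.-integrable setT F.
Proof. by move: If; rewrite /intble integrable_mkcond. Qed.

Let innerFE x : fubini_F m2 F x =
  ((fun x => \int[m2]_(y in D2) (f (x, y))%:E) \_ D1 x)%E.
Proof.
rewrite /fubini_F /F patchE; case: ifPn => xD.
  rewrite [RHS]integral_mkcond; apply: eq_integral => y _.
  rewrite !patchE; congr (if _ then _ else _).
  by rewrite in_setX xD.
rewrite integral0_eq// => y _; rewrite patchE.
by case: ifPn => //; rewrite in_setX (negbTE xD).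
Qed.

Let innerGE y : fubini_G m1 F y =
  ((fun y => \int[m1]_(x in D1) (f (x, y))%:E) \_ D2 y)%E.
Proof.
rewrite /fubini_G /F patchE; case: ifPn => yD.
  rewrite [RHS]integral_mkcond; apply: eq_integral => x _.
  rewrite !patchE; congr (if _ then _ else _).
  by rewrite in_setX yD andbT.
rewrite integral0_eq// => x _; rewrite patchE.
by case: ifPn => //; rewrite in_setX (negbTE yD) andbF.
Qed.

(** An inner integral may be infinite on a null set of parameters; [fine] turns it into a real
    number there without changing the outer integral. *)
Lemma integrable_fine d (Z : measurableType d) (m : {measure set Z -> \bar R})
    (E : set Z) (g : Z -> \bar R) : measurable E -> m.-integrable E g ->
  intble m E (fine \o g) /\
  \int[m]_(x in E) fine (g x) = fine (\int[m]_(x in E) g x)%E.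
Proof.
move=> mE Ig; have mg := measurable_int _ Ig.
have mfg : measurable_fun E (fine \o g) by exact: measurableT_comp.
have mEfg : measurable_fun E (EFin \o (fine \o g)) by exact/measurable_EFinP.
split.
  apply: (le_integrable mE mEfg _ Ig) => x Ex /=.
  by case: (g x) => [r| |] //=; rewrite normr0 leey.
rewrite /Rintegral; congr fine.
apply: ae_eq_integral => //.
have := integrable_ae mE Ig; apply: filterS => x gx Ex /=.
by rewrite fineK// gx.
Qed.

Lemma intble_fubini1 : intble m1 D1 (fun x => \int[m2]_(y in D2) f (x, y)).
Proof.
have := integrable_fubini_F IF.
rewrite (_ : fubini_F m2 F = (fun x => \int[m2]_(y in D2) (f (x, y))%:E)%E \_ D1);
  last exact/funext/innerFE.
rewrite -integrable_mkcond// => I1.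
by have [] := integrable_fine mD1 I1.
Qed.

Lemma intR_fubini1 : \int[m1]_(x in D1) \int[m2]_(y in D2) f (x, y) =
  \int[pm]_(z in D1 `*` D2) f z.
Proof.
have := integrable_fubini_F IF.
rewrite (_ : fubini_F m2 F = (fun x => \int[m2]_(y in D2) (f (x, y))%:E)%E \_ D1);
  last exact/funext/innerFE.
rewrite -integrable_mkcond// => I1.
have [_ ->] := integrable_fine mD1 I1.
rewrite /Rintegral; congr fine.
rewrite [RHS]integral_mkcond -(integral12_prod_meas1 IF) integral_mkcond.
by apply: eq_integral => x _; rewrite innerFE.
Qed.

Let integrable_fubini_G : m2.-integrable setT (fubini_G m1 F).
Proof.
have mF := measurable_int _ IF.
have mG := measurable_fubini_G IF.
apply/integrableP; split=> //.
apply: le_lt_trans ((integrable21ltyP m1 m2 mF).1 IF).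
have mAF := measurableT_comp (@abse_measurable R setT) mF.
apply: ge0_le_integral => //.
- exact: measurableT_comp.
- by apply: (measurable_fun_fubini_tonelli_G (abse \o F)) => //= z; exact: abse_ge0.
- move=> y _; apply: le_abse_integral => //.
  exact: (measurableT_comp mF (measurable_pair2 y)).
Qed.

Lemma intble_fubini2 : intble m2 D2 (fun y => \int[m1]_(x in D1) f (x, y)).
Proof.
have := integrable_fubini_G.
rewrite (_ : fubini_G m1 F = (fun y => \int[m1]_(x in D1) (f (x, y))%:E)%E \_ D2);
  last exact/funext/innerGE.
rewrite -integrable_mkcond// => I1.
by have [] := integrable_fine mD2 I1.
Qed.

Lemma intR_fubini2 : \int[m2]_(y in D2) \int[m1]_(x in D1) f (x, y) =
  \int[pm]_(z in D1 `*` D2) f z.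
Proof.
have := integrable_fubini_G.
rewrite (_ : fubini_G m1 F = (fun y => \int[m1]_(x in D1) (f (x, y))%:E)%E \_ D2);
  last exact/funext/innerGE.
rewrite -integrable_mkcond// => I1.
have [_ ->] := integrable_fine mD2 I1.
rewrite /Rintegral; congr fine.
rewrite [RHS]integral_mkcond -(integral21_prod_meas1 IF) integral_mkcond.
by apply: eq_integral => x _; rewrite innerGE.
Qed.

Lemma ae_intble_fubini1 :
  {ae m1, forall x, D1 x -> intble m2 D2 (fun y => f (x, y))}.
Proof.
have := ae_integrable1 IF; apply: filterS => x Ix D1x.
rewrite /intble integrable_mkcond//.
apply: eq_integrable Ix => // y _; rewrite /F !patchE in_setX.
by rewrite (mem_set D1x).
Qed.

End with_f.

Lemma intble_tensor (f : X -> R) (g : Y -> R) :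
  intble m1 D1 f -> intble m2 D2 g ->
  intble pm (D1 `*` D2) (fun z => f z.1 * g z.2).
Proof.
move=> If Ig.
pose f' := f \_ D1; pose g' := g \_ D2.
have If' : m1.-integrable setT (EFin \o f').
  by move: If; rewrite /intble integrable_mkcond// restrict_EFin.
have Ig' : m2.-integrable setT (EFin \o g').
  by move: Ig; rewrite /intble integrable_mkcond// restrict_EFin.
have mf' : measurable_fun setT f' by apply/measurable_EFinP/(measurable_int _ If').
have mg' : measurable_fun setT g' by apply/measurable_EFinP/(measurable_int _ Ig').
rewrite /intble integrable_mkcond//.
apply: (@eq_integrable _ _ _ _ _ _ (fun z : X * Y => (f' z.1 * g' z.2)%:E)) => //.
  move=> z _; rewrite !patchE /f' /g' !patchE in_setX /=.
  by case: (z.1 \in D1); case: (z.2 \in D2); rewrite ?mulr0 ?mul0r.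
apply/(integrable12ltyP m1 m2).
  apply/measurable_EFinP/measurable_funM.
    exact: (measurableT_comp mf' measurable_fst).
  exact: (measurableT_comp mg' measurable_snd).
under eq_integral => x _.
  under eq_integral => y _ do rewrite /= normrM EFinM.
  rewrite ge0_integralZl//; last first.
    by apply/measurable_EFinP; exact: measurableT_comp.
  over.
rewrite ge0_integralZr//; last 2 first.
- by apply/measurable_EFinP; exact: measurableT_comp.
- exact: integral_ge0.
move/integrableP : If' => [_ oo1]; move/integrableP : Ig' => [_ oo2].
by rewrite lte_mul_pinfty// ?integral_ge0// ge0_fin_numE// integral_ge0.
Qed.

End real_fubini.

(** * Square-integrable functions of time and bounded forms *)

Section bochner_integrability.
Variable R : realType.
Variable T : R.
Local Notation mu := (@lebesgue_measure R).
Local Notation I := (itv0 T).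
Hint Resolve measurable_itv0 : core.

Lemma measurable_form_diag (V V' : lmodType R) (D : set V) b (D' : set V') b'
    (B : V -> V' -> R) f g : inner_on D b -> inner_on D' b' ->
  bdd_form D b D' b' B ->
  strongly_measurable T (NSpace D (hnorm b)) f ->
  strongly_measurable T (NSpace D' (hnorm b')) g ->
  measurable_fun I (fun t => B (f t) (g t)).
Proof.
move=> ib ib' hB sf sg.
have mid : measurable_fun I (idfun : measurableTypeR R -> measurableTypeR R).
  exact: measurable_id.
exact: (measurable_form ib ib' mid mid (fun _ h => h) (fun _ h => h) hB sf sg).
Qed.

Section one_space.
Variables (V : lmodType R) (D : set V) (b : V -> V -> R).
Hypothesis ib : inner_on D b.
Local Notation X := (NSpace D (hnorm b)).

Lemma sm_dom f t : strongly_measurable T X f -> I t -> D (f t).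
Proof. by move=> [Df _]; rewrite itv0E => /Df. Qed.

Lemma measurable_hnorm_sqr f : strongly_measurable T X f ->
  measurable_fun I (fun t => hnorm b (f t) ^+ 2).
Proof.
move=> sf.
have := measurable_form_diag ib ib (bdd_form_inner ib) sf sf.
apply: eq_measurable_fun => t /set_mem It.
by rewrite (hnorm_sqr ib)//; exact: (sm_dom sf).
Qed.

Lemma measurable_hnorm f : strongly_measurable T X f ->
  measurable_fun I (fun t => hnorm b (f t)).
Proof.
move=> sf.
have mb := measurable_form_diag ib ib (bdd_form_inner ib) sf sf.
have ms : measurable_fun setT (@Num.sqrt R : measurableTypeR R -> measurableTypeR R).
  by apply: continuous_measurable_fun; exact: sqrt_continuous.
exact: (measurableT_comp ms mb).
Qed.

Lemma intble_hnorm_sqr f : bochner_L2 T X f ->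
  intble mu I (fun t => hnorm b (f t) ^+ 2).
Proof.
move=> [sf If]; apply/integrableP; split.
  by apply/measurable_EFinP; exact: measurable_hnorm_sqr.
apply: (eq_ind _ (fun z => (z < +oo)%E) If); apply: eq_integral => t _ /=.
by rewrite ger0_norm// sqr_ge0.
Qed.

Lemma intble_itv0_cst t (a : R) : intble mu (itv0 t) (fun=> a).
Proof. by apply: intble_cst => //; exact: itv0_fin. Qed.

Lemma intble_hnorm f : bochner_L2 T X f -> intble mu I (fun t => hnorm b (f t)).
Proof.
move=> bf; apply: (@intble_le _ _ _ mu I _ (fun t => 1 + hnorm b (f t) ^+ 2)) => //.
- by apply: measurable_hnorm; case: bf.
- move=> t It; rewrite ger0_norm ?hnorm_ge0//.
  by have := sqr_ge0 (hnorm b (f t) - 2^-1); nra.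
- by apply: intbleD => //; [exact: intble_itv0_cst|exact: intble_hnorm_sqr].
Qed.

Lemma bochner_L2_cst e : D e -> bochner_L2 T X (fun=> e).
Proof.
move=> De; split; last first.
  have /integrableP[_] := intble_itv0_cst T (hnorm b e ^+ 2).
  by under eq_integral do rewrite /= ger0_norm ?sqr_ge0//.
split=> //; exists (fun n t => e); split; last first.
  by move=> t _; under eq_fun do rewrite subrr /= (hnorm0 ib); exact: cvg_cst.
move=> n; exists 1%N, (fun=> setT), (fun=> e); split=> //.
by apply/funext => t; rewrite big_ord1 indicT scale1r.
Qed.

Lemma bochner_L2_of_Linf f : bochner_Linf T X f -> bochner_L2 T X f.
Proof.
move=> [sf [M fM]]; split=> //.
apply: (@le_lt_trans _ _ (\int[mu]_(t in I) (M ^+ 2)%:E)%E).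
  apply: ae_ge0_le_integral => //.
  - by move=> t _; rewrite lee_fin sqr_ge0.
  - by apply/measurable_EFinP; exact: measurable_hnorm_sqr.
  - by move=> t _ /=; rewrite lee_fin sqr_ge0.
  apply: aeS fM => t fM; rewrite itv0E => /fM {}fM.
  by rewrite lee_fin ler_pXn2r// ?nnegrE ?hnorm_ge0// (le_trans (hnorm_ge0 _ _) fM).
have /integrableP[_] := intble_itv0_cst T (M ^+ 2).
by under eq_integral do rewrite /= ger0_norm ?sqr_ge0//.
Qed.

Lemma simple_intoD s s' : simple_into X s -> simple_into X s' ->
  simple_into X (fun t => s t + s' t).
Proof.
move=> [n [A [c [mA Dc ->]]]] [n' [A' [c' [mA' Dc' ->]]]].
exists (n + n')%N, (fun i => match fintype.split i with inl j => A j | inr j => A' j end),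
  (fun i => match fintype.split i with inl j => c j | inr j => c' j end).
split=> [i|i|]; [by case: (fintype.split i)|by case: (fintype.split i)|].
apply/funext => t; rewrite big_split_ord /=; congr (_ + _); apply: eq_bigr => i _.
  by rewrite (unsplitK (inl i)).
by rewrite (unsplitK (inr i)).
Qed.

Lemma simple_intoZ (a : R) s : simple_into X s -> simple_into X (fun t => a *: s t).
Proof.
move=> [n [A [c [mA Dc ->]]]]; exists n, A, (fun i => a *: c i); split=> //.
  by move=> i; apply: (subspZ (inner_subsp ib)); exact: Dc.
apply/funext => t; rewrite scaler_sumr; apply: eq_bigr => i _.
by rewrite !scalerA mulrC.
Qed.

Lemma strongly_measurableB f g :
  strongly_measurable T X f -> strongly_measurable T X g ->
  strongly_measurable T X (f - g).
Proof.
have sD := inner_subsp ib.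
move=> [Df [s [ss sf]]] [Dg [s' [ss' sg]]]; split.
  by move=> t tT; apply: subspB => //; [exact: Df|exact: Dg].
exists (fun n t => s n t + (-1) *: s' n t); split.
  by move=> n; apply: simple_intoD => //; exact: simple_intoZ.
move=> t tT.
have c0 : hnorm b (s n t - f t) + hnorm b (s' n t - g t) @[n --> \oo] --> (0 : R).
  by rewrite -[0 in X in _ --> X]addr0; apply: cvgD; [exact: sf|exact: sg].
apply: cvg0_le c0 => n; rewrite ger0_norm ?hnorm_ge0//=.
have Ds := simple_into_dom ib t (ss n); have Ds' := simple_into_dom ib t (ss' n).
have -> : s n t + -1 *: s' n t - (f - g) t = (s n t - f t) + (g t - s' n t).
  by rewrite /= !fctE scaleN1r opprD opprK addrACA (addrC (- s' n t)).
rewrite (hnormB_sym ib Ds' (Dg t tT)).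
apply: (hnorm_triangle ib); apply: subspB => //; [exact: Df|exact: Dg].
Qed.

Lemma bochner_L2B f g : bochner_L2 T X f -> bochner_L2 T X g ->
  bochner_L2 T X (f - g).
Proof.
move=> bf bg; have sfg := strongly_measurableB bf.1 bg.1; split=> //.
have sD := inner_subsp ib.
have : intble mu I (fun t => 2 * hnorm b (f t) ^+ 2 + 2 * hnorm b (g t) ^+ 2).
  by apply: intbleD => //; apply: intbleZ => //; exact: intble_hnorm_sqr.
move/(intble_le (measurable_itv0 T) (measurable_hnorm_sqr sfg)) => Ifg.
have /integrableP[_] : intble mu I (fun t => hnorm b ((f - g) t) ^+ 2).
  apply: Ifg => t It; rewrite ger0_norm ?sqr_ge0//.
  have Dft := sm_dom bf.1 It; have Dgt := sm_dom bg.1 It.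
  have DNg : D (- g t) by rewrite -scaleN1r; exact: subspZ.
  have := hnorm_triangle ib Dft DNg.
  have -> : hnorm b (- g t) = hnorm b (g t).
    by rewrite -scaleN1r (hnormZ ib)// normrN1 mul1r.
  move=> h.
  have : hnorm b ((f - g) t) ^+ 2 <= (hnorm b (f t) + hnorm b (g t)) ^+ 2.
    by rewrite ler_pXn2r// ?nnegrE ?addr_ge0 ?hnorm_ge0.
  by have := sqr_ge0 (hnorm b (f t) - hnorm b (g t)); nra.
apply: le_lt_trans; rewrite le_eqVlt; apply/orP; left; apply/eqP.
by apply: eq_integral => t _ /=; rewrite ger0_norm// sqr_ge0.
Qed.

End one_space.

Section two_spaces.
Variables (V V' : lmodType R) (D : set V) (b : V -> V -> R).
Variables (D' : set V') (b' : V' -> V' -> R) (B : V -> V' -> R).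
Hypotheses (ib : inner_on D b) (ib' : inner_on D' b').
Local Notation X := (NSpace D (hnorm b)).
Local Notation X' := (NSpace D' (hnorm b')).
Hypothesis hB : bdd_form D b D' b' B.

Lemma intble_form f g : bochner_L2 T X f -> bochner_L2 T X' g ->
  intble mu I (fun t => B (f t) (g t)).
Proof.
move=> bf bg; have [_ [C C0 hC]] := hB.
apply: (@intble_le _ _ _ mu I _
  (fun t => C * (hnorm b (f t) ^+ 2 + hnorm b' (g t) ^+ 2))) => //.
- exact: (measurable_form_diag ib ib' hB bf.1 bg.1).
- move=> t It; apply: le_trans (hC _ _ (sm_dom bf.1 It) (sm_dom bg.1 It)) _.
  rewrite ler_wpM2l//.
  have := hnorm_ge0 b (f t); have := hnorm_ge0 b' (g t).
  by have := sqr_ge0 (hnorm b (f t) - hnorm b' (g t)); nra.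
- apply: intbleZ => //; apply: intbleD => //.
    exact: (intble_hnorm_sqr ib bf).
  exact: (intble_hnorm_sqr ib' bg).
Qed.

Lemma intble_form_linl f e : bochner_L2 T X f -> D' e ->
  intble mu I (fun t => B (f t) e).
Proof. by move=> bf De; apply: (intble_form bf (bochner_L2_cst ib' De)). Qed.

Lemma intble_form_linr e f : D e -> bochner_L2 T X' f ->
  intble mu I (fun t => B e (f t)).
Proof. by move=> De bf; apply: (intble_form (bochner_L2_cst ib De) bf). Qed.

Lemma intble_form2 f g : bochner_L2 T X f -> bochner_L2 T X' g ->
  intble (leb2 R) (I `*` I) (fun z => B (f z.1) (g z.2)).
Proof.
move=> bf bg; have [_ [C C0 hC]] := hB.
have mII : measurable ((I : set (measurableTypeR R)) `*` (I : set (measurableTypeR R))).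
  by apply: measurableX; exact: measurable_itv0.
apply: (@intble_le _ _ _ (leb2 R) (I `*` I) _
  (fun z : measurableTypeR R * measurableTypeR R => C * (hnorm b (f z.1) * hnorm b' (g z.2)))) => //.
- apply: (@measurable_form R T V V' D b D' b' B ib ib' _ _ _ fst snd _ _ _ _ f g
      hB bf.1 bg.1).
  + by apply: measurable_funTS; exact: measurable_fst.
  + by apply: measurable_funTS; exact: measurable_snd.
  + by move=> z [].
  + by move=> z [].
- by move=> z [I1 I2]; exact: hC (sm_dom bf.1 I1) (sm_dom bg.1 I2).
- apply: intbleZ => //.
  exact: (intble_tensor (measurable_itv0 T) (measurable_itv0 T)
    (intble_hnorm ib bf) (intble_hnorm ib' bg)).
Qed.

End two_spaces.

End bochner_integrability.

(** * Approximation of the time integral of a square-integrable function *)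

Section bochner_approximation.
Variable R : realType.
Variable T : R.
Local Notation mu := (@lebesgue_measure R).
Local Notation I := (itv0 T).
Hint Resolve measurable_itv0 : core.
Variables (V : lmodType R) (D : set V) (b : V -> V -> R).
Hypothesis ib : inner_on D b.
Local Notation X := (NSpace D (hnorm b)).

Lemma inner_mul : inner_on [set: R^o] (fun r r' : R^o => r * r').
Proof.
split=> //; last by move=> x _; rewrite -expr2 sqr_ge0.
  split=> [y _ a x x' _ _|x _ a y y' _ _]; first by rewrite mulrDl -mulrA.
  by rewrite mulrDr mulrCA.
by move=> x y _ _; rewrite mulrC.
Qed.

(** A functional is a form against the one-dimensional space, so measurability and integrability for
    forms cover functionals. *)
Lemma bdd_lin_form (l : V -> R) : bdd_lin D b l ->
  bdd_form D b [set: R^o] (fun r r' : R^o => r * r') (fun x (r : R^o) => l x * r).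
Proof.
move=> [ll [C C0 hC]]; split.
  split=> [r _ a x x' Dx Dx'|x Dx a r r' _ _].
    by rewrite ll//; ring.
  by rewrite mulrDr; congr (_ + _); rewrite mulrCA.
exists C => // x r Dx _; rewrite /hnorm -expr2 sqrtr_sqr normrM mulrA.
by rewrite ler_wpM2r// hC.
Qed.

Lemma measurable_lin (l : V -> R) f : bdd_lin D b l ->
  strongly_measurable T X f -> measurable_fun I (fun t => l (f t)).
Proof.
move=> hl sf.
have := measurable_form_diag ib inner_mul (bdd_lin_form hl) sf
  (bochner_L2_cst T inner_mul (e := (1 : R^o)) Logic.I).1.
by apply: eq_measurable_fun => t _; rewrite mulr1.
Qed.

Lemma intble_lin (l : V -> R) f : bdd_lin D b l ->
  bochner_L2 T X f -> intble mu I (fun t => l (f t)).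
Proof.
move=> hl bf.
have := intble_form_linl ib inner_mul (bdd_lin_form hl) bf (e := (1 : R^o)) Logic.I.
by apply: intble_eq => // t _; rewrite mulr1.
Qed.

Lemma simple_strongly_measurable s : simple_into X s -> strongly_measurable T X s.
Proof.
move=> ss; split; first by move=> t _; exact: (simple_into_dom ib).
exists (fun=> s); split=> // t _.
by under eq_fun do rewrite subrr /= (hnorm0 ib); exact: cvg_cst.
Qed.

(** For a simple function the integral is a finite combination of its coefficients, hence an element
    of [D]. The factor [\1_E] allows the truncation used for a general function. *)
Lemma simple_integral s (E : set R) t : simple_into X s ->
  measurable (E : set (measurableTypeR R)) -> exists2 H, D H &
  forall l, lin_on D l -> \int[mu]_(x in itv0 t) (\1_E x * l (s x)) = l H.
Proof.
move=> [n [A [c [mA Dc ->]]]] mE; have sD := inner_subsp ib.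
exists (\sum_(i < n) (\int[mu]_(x in itv0 t) (\1_E x * \1_(A i) x)) *: c i).
  by apply: subsp_sum => // i; apply: subspZ => //; exact: Dc.
move=> l ll.
have Ii i : intble mu (itv0 t) (fun x => \1_E x * \1_(A i) x).
  apply: (@intble_le _ _ _ mu _ _ (fun=> 1)) => //; last first.
  - exact: intble_itv0_cst.
  - move=> x _; rewrite !indicE; case: (x \in E); case: (x \in A i);
      by rewrite ?(mul0r, mulr0, mulr1) ?normr0 ?normr1.
  - apply: measurable_funM; apply: measurable_indic; first exact: mE.
    exact: (mA i).
rewrite (lin_sum sD ll); last by move=> i; apply: subspZ => //; exact: Dc.
transitivity (\int[mu]_(x in itv0 t) (\sum_(i < n)
    l (c i) * (\1_E x * \1_(A i) x))).
  apply: intR_eq => x _; rewrite (lin_sum sD ll); last first.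
    by move=> i; apply: subspZ => //; exact: Dc.
  rewrite mulr_sumr; apply: eq_bigr => i _; rewrite (linZ sD ll); last exact: Dc.
  by rewrite mulrA mulrC.
rewrite intR_sum//; last by move=> i; exact: intbleZ.
apply: eq_bigr => i _; rewrite RintegralZl//; last exact: Ii.
by rewrite (linZ sD ll) ?(mulrC (l _))//; exact: Dc.
Qed.

(* The H n are integrals of simple functions approximating f; they play the
   role of the Bochner integral of f on (0,t), which need not exist since D is
   not known to be complete. *)
Lemma bochner_approximation f t : bochner_L2 T X f -> t <= T ->
  exists H : nat -> V, [/\ forall n, D (H n),
    forall l, bdd_lin D b l ->
      l (H n) @[n --> \oo] --> \int[mu]_(s in itv0 t) l (f s) &
    forall B, bdd_form D b D b B ->
      B (H n) (H n) @[n --> \oo] -->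
        \int[mu]_(s in itv0 t) \int[mu]_(r in itv0 t) B (f s) (f r)].
Proof.
move=> bf tT; have [sf _] := bf; have [Df [s [ss sf0]]] := sf.
have sD := inner_subsp ib; have tI := itv0S tT.
(* Pointwise convergence of the simple functions gives no domination. Cutting off where s_n is at
   distance more than 1 from f makes 1 + |f| a dominating function, and every time belongs to [E n]
   for n large. *)
pose E n := I `&` [set x | hnorm b (s n x - f x) <= 1].
have mE n : measurable (E n : set (measurableTypeR R)).
  have := measurable_hnorm ib (strongly_measurableB ib (simple_strongly_measurable (ss n)) sf).
  move=> /(_ (measurable_itv0 T) _ (measurable_itv `]-oo, 1%R])).
  by congr measurable; apply: eq_set => x /=.
have /choice[H HP] : forall n, exists H, D H /\
    forall l, lin_on D l -> \int[mu]_(x in itv0 t) (\1_(E n) x * l (s n x)) = l H.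
  by move=> n; have [H DH hH] := simple_integral t (ss n) (mE n); exists H.
have DH n : D (H n) by have [] := HP n.
have HE n := (HP n).2.
have Dfx x : itv0 t x -> D (f x) by move=> tx; exact: (sm_dom sf (tI _ tx)).
have Ds n x : D (s n x) by exact: (simple_into_dom ib).
have sn_le n x : itv0 t x -> E n x -> hnorm b (s n x) <= 1 + hnorm b (f x).
  move=> tx [_ /= ?]; rewrite -[s n x](subrK (f x)).
  apply: le_trans (hnorm_triangle ib _ _) _; [|exact: Dfx|by rewrite lerD2r].
  by apply: subspB => //; exact: Dfx.
have lsn_le l C n x : 0 <= C -> (forall x, D x -> `|l x| <= C * hnorm b x) -> itv0 t x ->
    `|\1_(E n) x * l (s n x)| <= C * (1 + hnorm b (f x)).
  move=> C0 hl tx; rewrite indicE.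
  have [xE|xE] /= := boolP (x \in E n); last first.
    by rewrite mul0r normr0 mulr_ge0// addr_ge0// hnorm_ge0.
  rewrite mul1r (le_trans (hl _ (Ds _ _)))// ler_wpM2l//.
  by apply: sn_le => //; exact: set_mem.
have mlsn l n : bdd_lin D b l ->
    measurable_fun (itv0 t) (fun x => \1_(E n) x * l (s n x)).
  move=> hl; apply: measurable_funM; first by apply: measurable_indic; exact: mE.
  exact: (measurable_funS (measurable_itv0 T) tI (measurable_lin hl (simple_strongly_measurable (ss n)))).
have If1 : intble mu (itv0 t) (fun x => 1 + hnorm b (f x)).
  apply: intbleD => //; first exact: intble_itv0_cst.
  apply: (intbleS (measurable_itv0 t) (measurable_itv0 T) tI).
  exact: (intble_hnorm ib).
have nearE x : itv0 t x -> \forall n \near \oo, \1_(E n) x = 1 :> R.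
  move=> tx; have := tI _ tx; rewrite itv0E => xT.
  have /cvgrPdist_le /(_ 1 ltr01) := sf0 _ xT; apply: filterS => m.
  rewrite sub0r normrN ger0_norm ?hnorm_ge0// => xE.
  by rewrite indicE mem_set//; split=> //; exact: tI.
have cvgl l : bdd_lin D b l ->
    l (H n) @[n --> \oo] --> \int[mu]_(s in itv0 t) l (f s).
  move=> hl; have [ll [C C0 hC]] := hl.
  under eq_fun do rewrite -(HE _ _ ll).
  apply: (@intR_cvg_lim _ _ _ mu (itv0 t) _ _ (fun x => C * (1 + hnorm b (f x)))) => //.
  - by move=> n; exact: mlsn.
  - move=> x tx; have := tI _ tx; rewrite itv0E => xT.
    have cs : l (s n x) @[n --> \oo] --> l (f x).
      apply/cvgrPdist_le => e e0.
      have : C * hnorm b (s n x - f x) @[n --> \oo] --> (0 : R).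
        by rewrite -[X in _ --> X](mulr0 C); apply: cvgMr; exact: sf0.
      move=> /cvgrPdist_le /(_ _ e0); apply: filterS => n.
      rewrite sub0r normrN => he; rewrite distrC -(linB ll)//; last exact: Dfx.
      apply: le_trans (hC _ _) (le_trans (ler_norm _) he).
      by apply: subspB => //; exact: Dfx.
    apply: cvg_trans cs; apply: near_eq_cvg.
    by apply: filterS (nearE _ tx) => n /= ->; rewrite mul1r.
  - exact: intbleZ.
  - by move=> n x tx; exact: lsn_le.
exists H; split=> // B hB; have [[Bl Br] [C C0 hC]] := hB.
pose M := \int[mu]_(x in itv0 t) (1 + hnorm b (f x)).
have M0 : 0 <= M.
  by apply: Rintegral_ge0 => x _; rewrite addr_ge0// hnorm_ge0.
(* Both arguments of B(H_n, H_n) move with n; this bound, uniform in n, controls the error made when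
   the first one is replaced by its limit. *)
have BH x n : D x -> `|B x (H n)| <= C * hnorm b x * M.
  move=> Dx; have hl := bdd_form_linr hB Dx.
  have bl y : D y -> `|B x y| <= (C * hnorm b x) * hnorm b y.
    by move=> Dy; rewrite -mulrA hC.
  have C0' : 0 <= C * hnorm b x by rewrite mulr_ge0// hnorm_ge0.
  have Il : intble mu (itv0 t) (fun y => \1_(E n) y * B x (s n y)).
    apply: (@intble_le _ _ _ mu (itv0 t) _ (fun y => C * hnorm b x * (1 + hnorm b (f y)))) => //.
      exact: mlsn.
      by move=> y ty; exact: lsn_le.
    exact: intbleZ.
  rewrite -(HE n _ hl.1) (le_trans (le_normr_Rintegral _ _))//.
  rewrite /M -RintegralZl//; apply: intR_le => //.
  - exact: intble_norm.
  - exact: intbleZ.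
  - by move=> y ty; exact: lsn_le.
(* Only the first [H n] is written back as an integral. The integrand at x then tends to the
   integral of B(f(x), f(r)) over r, by the convergence of functionals just shown. *)
under eq_fun do rewrite -(HE _ _ (Bl _ (DH _))).
apply: (@intR_cvg_lim _ _ _ mu (itv0 t) _ _ (fun x => C * M * (1 + hnorm b (f x)))) => //.
- by move=> n; exact: (mlsn _ n (bdd_form_linl hB (DH n))).
- move=> x tx; have := tI _ tx; rewrite itv0E => xT.
  have c1 := cvgl _ (bdd_form_linr hB (Dfx _ tx)).
  have c2 : B (s n x) (H n) - B (f x) (H n) @[n --> \oo] --> (0 : R).
    have c3 : C * hnorm b (s n x - f x) * M @[n --> \oo] --> (0 : R).
      rewrite -[X in _ --> X](mul0r M); apply: cvgMl.
      by rewrite -[X in _ --> X](mulr0 C); apply: cvgMr; exact: sf0.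
    apply: cvg0_le c3 => n; rewrite -(linB (Bl _ (DH n)))//; last exact: Dfx.
    by apply: BH; apply: subspB => //; exact: Dfx.
  have c4 : B (s n x) (H n) @[n --> \oo] --> \int[mu]_(r in itv0 t) B (f x) (f r).
    rewrite -[X in _ --> X]add0r.
    rewrite (_ : (fun n => B (s n x) (H n)) = fun n => (B (s n x) (H n) - B (f x) (H n)) + B (f x) (H n)).
      exact: cvgD.
    by apply/funext => n; rewrite subrK.
  apply: cvg_trans c4; apply: near_eq_cvg.
  by apply: filterS (nearE _ tx) => n /= ->; rewrite mul1r.
- exact: intbleZ.
- move=> n x tx; apply: (lsn_le (fun y => B y (H n))) => //; first by rewrite mulr_ge0.
  by move=> y Dy; rewrite (le_trans (BH _ _ Dy))// mulrAC.
Qed.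

End bochner_approximation.

Section ae_sign.
Variables (d : measure_display) (X : measurableType d) (R : realType).
Variable mu : {measure set X -> \bar R}.
Variables (D : set X) (mD : measurable D).

Lemma intR_ae_le0 f : intble mu D f -> {ae mu, forall x, D x -> f x <= 0} ->
  \int[mu]_(x in D) f x <= 0.
Proof.
move=> If f0; have mf := intble_meas If.
rewrite (@intR_ae_eq _ _ _ mu D f (fun x => Num.min (f x) 0) mD If).
- rewrite -[X in _ <= X](intR0 mu D); apply: intR_le => //.
  + apply: (intble_le mD _ _ (intble_norm mD If)).
      by apply: measurable_minr => //; exact: measurable_cst.
    move=> x _; case: (leP (f x) 0) => //.
    by rewrite normr0.
  + exact: integrable0.
  + by move=> x _; rewrite ge_min lexx orbT.
- by apply: measurable_minr => //; exact: measurable_cst.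
- by apply: aeS f0 => x fx Dx; rewrite min_l// fx.
Qed.

Lemma intR_ae_le0_eq0 f : intble mu D f -> {ae mu, forall x, D x -> f x <= 0} ->
  0 <= \int[mu]_(x in D) f x -> ae_eq mu D f (cst 0).
Proof.
move=> If f0 I0; have mf := intble_meas If.
have mg : measurable_fun D (fun x => Num.max (- f x) 0).
  apply: measurable_maxr; last exact: measurable_cst.
  exact: measurableT_comp.
have fg : ae_eq mu D (fun x => -1 * f x) (fun x => Num.max (- f x) 0).
  by apply: aeS f0 => x fx Dx; rewrite mulN1r max_l// oppr_ge0 fx.
have Ig : intble mu D (fun x => Num.max (- f x) 0).
  apply: (intble_le mD mg _ (intble_norm mD If)) => x _.
  by case: (leP (- f x) 0) => _; rewrite ?normr0 ?normrN.
have : ae_eq mu D (fun x => Num.max (- f x) 0) (cst 0).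
  apply: intR_ge0_eq0 => //; first by move=> x _; rewrite le_max lexx orbT.
  rewrite -(intR_ae_eq mD _ mg fg); last exact: intbleZ.
  by rewrite RintegralZl// mulN1r oppr_le0.
move=> /aeI /(_ fg); apply: aeS => x [g0 /[swap] Dx]; move: (g0 Dx) => -> /(_ Dx).
by rewrite /= mulN1r => /eqP; rewrite oppr_eq0 => /eqP.
Qed.

End ae_sign.

(** * Functions of time determined by their integrals *)

Section one_dimensional.
Variable R : realType.
Local Notation mu := (@lebesgue_measure R).
Hint Resolve measurable_itv0 : core.

Lemma ae_itv_exists (P : R -> Prop) (a c : R) : a < c ->
  {ae mu, forall x, P x} -> exists2 x, a < x < c & P x.
Proof.
move=> ac [N [mN N0 PN]]; apply: contrapT => nP.
have sub : `]a, c[%classic `<=` N.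
  move=> x; rewrite /= in_itv /= => xac; apply: PN => Px.
  by apply: nP; exists x.
have : (mu `]a, c[%classic <= mu N)%E by apply: le_measure => //; rewrite inE.
by rewrite N0 lebesgue_measure_itv /= lte_fin ac -EFinD lee_fin leNgt subr_gt0 ac.
Qed.

Lemma intR_itv0_left_cvg (T t : R) (h : R -> R) (s : nat -> R) :
  intble mu (itv0 T) h -> t <= T -> (forall n, t - n.+1%:R^-1 < s n < t) ->
  \int[mu]_(x in itv0 (s n)) h x @[n --> \oo] --> \int[mu]_(x in itv0 t) h x.
Proof.
move=> Ih tT hs.
have It : intble mu (itv0 t) h.
  exact: (intbleS (measurable_itv0 t) (measurable_itv0 T) (itv0S tT)).
have sS n : itv0 t `&` itv0 (s n) = itv0 (s n).
  by apply: setIidr; apply: itv0S; case/andP: (hs n) => _ /ltW.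
rewrite (_ : (fun n => _) = fun n => \int[mu]_(x in itv0 t) (h \_ (itv0 (s n))) x).
  apply: (@intR_cvg_lim _ _ _ mu (itv0 t) _ _ (fun x => `|h x|)) => //.
  - move=> n; apply/(measurable_restrict _ (measurable_itv0 _) (measurable_itv0 _)).
    by rewrite sS; apply: measurable_funS (intble_meas It) => //; rewrite -(sS n); exact: subIsetl.
  - move=> x; rewrite itv0E => /andP[x0 xt].
    have e0 : 0 < t - x by rewrite subr_gt0.
    apply: cvg_near_cst; near=> n.
    rewrite patchE mem_set// itv0E x0/=.
    case/andP: (hs n) => + _; apply: le_lt_trans.
    rewrite lerBrDr -lerBrDl; near: n.
    by have /cvgrPdist_le /(_ _ e0) := @cvg_harmonic R; apply: filterS => n /=;
      rewrite sub0r normrN ger0_norm.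
  - exact: intble_norm.
  - by move=> n x _; rewrite patchE; case: ifP => _; rewrite ?normr0.
by apply/funext => n; rewrite -Rintegral_mkcondr sS.
Unshelve. all: by end_near.
Qed.

(** Lebesgue differentiation: almost everywhere, the extension of [h] by zero is the derivative of
    its cumulative integral, here a constant. *)
Lemma ae_eq0_of_cumulative (D : set R) (h : R -> R) :
  measurable (D : set (measurableTypeR R)) -> intble mu D h ->
  (forall x, \int[mu]_(t in `]-oo, x] `&` D) h t = 0) ->
  ae_eq mu D h (cst 0).
Proof.
move=> mD Ih h0; pose g := h \_ D.
have Ig : mu.-integrable setT (EFin \o g).
  by move: Ih; rewrite /intble integrable_mkcond// restrict_EFin.
have Igy y : mu.-integrable `]-oo, y] (EFin \o g).
  by apply: (integrableS measurableT) => //; exact: measurable_itv.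
have lg : locally_integrable [set: R] g.
  exact: (@integrable_locally R h _ mD Ih).
have F0 x : \int[mu]_(t in `]-oo, x]) g t = 0 by rewrite /g -Rintegral_mkcondr.
have := FTC1Ny Igy lg; apply: aeS => x [_].
rewrite (_ : (fun x0 => _) = cst 0); last exact/funext/F0.
by rewrite derive1_cst => + Tx; rewrite /g patchE mem_set.
Qed.

Lemma ae_eq0_of_integrals (T : R) (h : R -> R) : intble mu (itv0 T) h ->
  {ae mu, forall t, itv0 T t -> \int[mu]_(x in itv0 t) h x = 0} ->
  ae_eq mu (itv0 T) h (cst 0).
Proof.
move=> Ih h0.
have I0 t : t <= T -> \int[mu]_(x in itv0 t) h x = 0.
  move=> tT; have [t0|t0] := leP t 0.
    rewrite (_ : itv0 t = set0); first exact: Rintegral_set0.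
    by rewrite -subset0 => x; rewrite itv0E => /andP[x0 /(lt_trans x0)]; rewrite ltNge t0.
  (* The hypothesis holds for almost every time only. Such times accumulate at t from the left, and
     dominated convergence carries it over to t itself. *)
  have ex n : exists x, t - n.+1%:R^-1 < x < t /\ \int[mu]_(x in itv0 x) h x = 0.
    have lt1 : Num.max 0 (t - n.+1%:R^-1) < t by rewrite gt_max t0 gtrBl invr_gt0 /= ltr0n.
    have [x /andP[]] := ae_itv_exists lt1 h0.
    rewrite gt_max => /andP[x0 ltx] xt hx; exists x; split; first by rewrite ltx.
    by apply: hx; rewrite itv0E x0 (lt_le_trans xt tT).
  have [s hs] := choice ex.
  have := intR_itv0_left_cvg Ih tT (fun n => (hs n).1).
  under eq_fun do rewrite (hs _).2.
  by move=> /(cvg_unique (@Rhausdorff R)) /(_ (cvg_cst _)).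
apply: ae_eq0_of_cumulative => // x; have [Tx|xT] := leP T x.
  rewrite setIidr ?I0// => y; rewrite itv0E /= in_itv /= => /andP[_ yT].
  exact: ltW (lt_le_trans yT Tx).
rewrite (_ : _ `&` _ = `]0, x]%classic).
  rewrite -Rintegral_itv_bndo_bndc; first exact: I0 (ltW xT).
  exact: (intbleS (measurable_itv0 x) (measurable_itv0 T) (itv0S (ltW xT))).
apply/seteqP; split=> y; rewrite /= itv0E !in_itv /=.
  by move=> [-> /andP[->]].
by move=> /andP[-> yx]; rewrite yx (le_lt_trans yx xT).
Qed.

End one_dimensional.

Lemma intR_split_point (R : realType) (t s : R) (h : R -> R) :
  intble (@lebesgue_measure R) (itv0 t) h ->
  \int[@lebesgue_measure R]_(r in itv0 t) (h r * (r < s)%R%:R) +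
  \int[@lebesgue_measure R]_(r in itv0 t) (h r * (s < r)%R%:R) =
  \int[@lebesgue_measure R]_(r in itv0 t) h r.
Proof.
move=> Ih; set mu := lebesgue_measure.
have mt := measurable_itv0 t.
have IA (P : pred R) (E : set (measurableTypeR R)) :
    measurable E -> (forall r, P r = (r \in E)) ->
    intble mu (itv0 t) (fun r => h r * (P r)%:R).
  move=> mE PE; apply: (@intble_le _ _ _ mu _ _ (fun r => `|h r|)).
  - exact: mt.
  - apply: measurable_funM; first exact: intble_meas Ih.
    have : measurable_fun (itv0 t) (\1_E : measurableTypeR R -> R).
      exact: measurable_indic.
    by apply: eq_measurable_fun => r _; rewrite indicE PE.
  - by move=> r _; case: (P r); rewrite ?mulr1// mulr0 normr0.
  - exact: intble_norm.
have IL : intble mu (itv0 t) (fun r => h r * (r < s)%R%:R).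
  apply: (IA (fun r => r < s) _ (measurable_itv `]-oo, s[)) => r.
  by apply/idP/idP => [rs|/set_mem]; [apply/mem_set|]; rewrite /= in_itv.
have IR : intble mu (itv0 t) (fun r => h r * (s < r)%R%:R).
  apply: (IA (fun r => s < r) _ (measurable_itv `]s, +oo[)) => r.
  by apply/idP/idP => [rs|/set_mem]; [apply/mem_set|]; rewrite /= in_itv /= andbT.
rewrite -(RintegralD mt IL IR).
apply: (intR_ae_eq mt (intbleD mt IL IR) (intble_meas Ih)).
exists [set s]; split; first exact: measurable_set1.
  exact: lebesgue_measure_set1.
move=> r /= /not_implyP[_]; apply: contra_notP => /eqP rs.
by case: (ltgtP r s) rs; rewrite ?mulr1 ?mulr0 ?addr0 ?add0r.
Qed.

(** * Integrals over the triangle r < s *)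

Section triangle.
Variable R : realType.
Local Notation mu := (@lebesgue_measure R).
Local Notation mR := (measurableTypeR R).
Hint Resolve measurable_itv0 : core.
Variables (T : R) (k : R -> R -> R).
Let k2 (z : mR * mR) := k z.1 z.2.
Hypothesis Ik2 : intble (leb2 R) (itv0 T `*` itv0 T) k2.
Hypothesis Ik : forall t, itv0 T t -> intble mu (itv0 T) (k ^~ t).
Variable t : R.
Hypothesis tT : t <= T.

Let L : set (mR * mR) := [set z | z.1 < z.2].

Let mL : measurable L.
Proof.
have /(_ measurableT [set true] I) := @measurable_fun_ltr _ _ R setT _ _
  (@measurable_fst _ _ mR mR) (@measurable_snd _ _ mR mR).
by rewrite setTI.
Qed.

Let kL (z : mR * mR) := k2 z * \1_L z.

Let IkL : intble (leb2 R) (itv0 t `*` itv0 t) kL.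
Proof.
have mtt : measurable ((itv0 t : set mR) `*` (itv0 t : set mR)).
  by apply: measurableX; exact: measurable_itv0.
have Ik2t : intble (leb2 R) (itv0 t `*` itv0 t) k2.
  apply: (@intbleS _ _ _ (leb2 R) _ (itv0 T `*` itv0 T)) => //.
    by apply: measurableX; exact: measurable_itv0.
  by move=> z [] /(itv0S tT) ? /(itv0S tT).
apply: (@intble_le _ _ _ (leb2 R) (itv0 t `*` itv0 t) _
  (fun z : mR * mR => `|k2 z|)) => //.
- by apply: measurable_funM; [exact: intble_meas Ik2t|exact: measurable_indic].
- move=> z _; rewrite /kL indicE normrM -[leRHS]mulr1 ler_wpM2l//.
  by case: (z \in L); rewrite ?normr1 ?normr0.
- exact: intble_norm.
Qed.

Let inner_kL s : itv0 t s ->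
  \int[mu]_(r in itv0 t) kL (r, s) = \int[mu]_(r in itv0 s) k r s.
Proof.
rewrite itv0E => /andP[s0 st].
transitivity (\int[mu]_(r in itv0 t) ((k ^~ s) \_ (itv0 s)) r).
  apply: intR_eq => r; rewrite itv0E => /andP[r0 rt].
  rewrite patchE /kL /k2 indicE /=.
  have -> : ((r, s) \in L) = (r < s) by apply/idP/idP => [/set_mem|rs] //; exact/mem_set.
  have -> : (r \in itv0 s) = (r < s).
    apply/idP/idP => [/set_mem|rs]; first by rewrite itv0E => /andP[].
    by apply/mem_set; rewrite itv0E r0.
  by case: (r < s); rewrite ?mulr1 ?mulr0.
rewrite -Rintegral_mkcondr setIidr//; exact: itv0S (ltW st).
Qed.

Lemma intble_triangle :
  intble mu (itv0 t) (fun s => \int[mu]_(r in itv0 s) k r s).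
Proof.
have := intble_fubini2 (measurable_itv0 t) (measurable_itv0 t) IkL.
by apply: intble_eq => // s ts; exact: inner_kL.
Qed.

(** Fubini and symmetry identify the integrals over r < s and over s < r, and in each slice the
    diagonal is a single point. With [k r s] = B(f(r), f(s)) this is the substitute for integrating
    d/dt B(F,F) = 2 B(F,F') for a primitive F of f. *)
Lemma intR_triangle : (forall r s, k r s = k s r) ->
  \int[mu]_(s in itv0 t) \int[mu]_(r in itv0 s) k r s =
  2^-1 * \int[mu]_(s in itv0 t) \int[mu]_(r in itv0 t) k r s.
Proof.
move=> ksym.
have A : \int[mu]_(s in itv0 t) \int[mu]_(r in itv0 s) k r s =
    \int[mu]_(s in itv0 t) \int[mu]_(r in itv0 t) kL (r, s).
  by apply: intR_eq => s ts; rewrite inner_kL.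
have B : \int[mu]_(s in itv0 t) \int[mu]_(r in itv0 t) kL (r, s) =
    \int[mu]_(s in itv0 t) \int[mu]_(r in itv0 t) kL (s, r).
  transitivity (\int[leb2 R]_(z in itv0 t `*` itv0 t) kL z).
    exact: (intR_fubini2 (measurable_itv0 t) (measurable_itv0 t) IkL).
  apply: esym; exact: (intR_fubini1 (measurable_itv0 t) (measurable_itv0 t) IkL).
have kLl r s : kL (r, s) = k r s * (r < s)%R%:R.
  rewrite /kL /k2 indicE; congr (_ * (nat_of_bool _)%:R).
  by apply/idP/idP => [/set_mem|rs]; [|apply/mem_set].
have kLr r s : kL (s, r) = k r s * (s < r)%R%:R by rewrite kLl ksym.
suff S : \int[mu]_(s in itv0 t) \int[mu]_(r in itv0 t) kL (r, s) +
    \int[mu]_(s in itv0 t) \int[mu]_(r in itv0 t) kL (s, r) =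
    \int[mu]_(s in itv0 t) \int[mu]_(r in itv0 t) k r s.
  by rewrite -S A -B; field.
have mt := measurable_itv0 t.
rewrite -(RintegralD mt (intble_fubini2 mt mt IkL) (intble_fubini1 mt mt IkL)).
apply: intR_eq => s ts; rewrite /= -[RHS](intR_split_point s).
  by congr (_ + _); apply: intR_eq => r _; [exact: kLl|exact: kLr].
apply: (intbleS mt (measurable_itv0 T) (itv0S tT)).
by apply: Ik; exact: itv0S ts.
Qed.

End triangle.

(** * From fixed test elements to the values of the solution *)

Section bdd_lin_closure.
Variables (R : realType) (T : R) (V : lmodType R) (D : set V) (b : V -> V -> R).
Hypothesis ib : inner_on D b.
Local Notation mu := (@lebesgue_measure R).
Local Notation X := (NSpace D (hnorm b)).
Hint Resolve measurable_itv0 : core.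

Lemma bdd_linD l l' : bdd_lin D b l -> bdd_lin D b l' ->
  bdd_lin D b (fun x => l x + l' x).
Proof.
move=> [ll [C C0 hC]] [ll' [C' C0' hC']]; split.
  by move=> a x y Dx Dy; rewrite ll// ll'//; ring.
exists (C + C'); first by rewrite addr_ge0.
move=> x Dx; rewrite (le_trans (ler_normD _ _))// mulrDl.
by rewrite lerD ?hC ?hC'.
Qed.

Lemma bdd_linZ a l : bdd_lin D b l -> bdd_lin D b (fun x => a * l x).
Proof.
move=> [ll [C C0 hC]]; split.
  by move=> c x y Dx Dy; rewrite ll//; ring.
exists (`|a| * C); first by rewrite mulr_ge0.
by move=> x Dx; rewrite normrM -mulrA ler_wpM2l// hC.
Qed.

Variables (V' : lmodType R) (D' : set V') (b' : V' -> V' -> R).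
Hypothesis ib' : inner_on D' b'.
Local Notation X' := (NSpace D' (hnorm b')).

(** This functional plays the role of B(G(t), .), where G(t) is the integral of [g] over (0,t), an
    element that may not exist. *)
Lemma bdd_lin_int (B : V' -> V -> R) g t : bdd_form D' b' D b B ->
  bochner_L2 T X' g -> t <= T ->
  bdd_lin D b (fun e => \int[mu]_(s in itv0 t) B (g s) e).
Proof.
move=> hB bg tT; have [[Bl Br] [C C0 hC]] := hB.
have tS := itv0S tT.
have IB e : D e -> intble mu (itv0 t) (fun s => B (g s) e).
  move=> De; apply: (intbleS (measurable_itv0 t) (measurable_itv0 T) tS).
  exact: (intble_form_linl ib' ib hB bg De).
have Ih : intble mu (itv0 t) (fun s => hnorm b' (g s)).
  apply: (intbleS (measurable_itv0 t) (measurable_itv0 T) tS).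
  exact: (intble_hnorm ib' bg).
have Dg s : itv0 t s -> D' (g s) by move=> ts; exact: (sm_dom bg.1 (tS _ ts)).
split.
  move=> a x y Dx Dy; rewrite -RintegralZl//; last exact: IB.
  rewrite -RintegralD//; [|by apply: intbleZ => //; exact: IB|exact: IB].
  by apply: intR_eq => s ts; rewrite (Br _ (Dg _ ts)).
exists (C * \int[mu]_(s in itv0 t) hnorm b' (g s)).
  by rewrite mulr_ge0//; apply: Rintegral_ge0 => s _; exact: hnorm_ge0.
move=> e De; rewrite (le_trans (le_normr_Rintegral _ (IB _ De)))//.
rewrite mulrAC -RintegralZl//; apply: intR_le => //.
- by apply: intble_norm => //; exact: IB.
- exact: intbleZ.
- by move=> s ts; rewrite mulrAC -mulrA hC//; exact: Dg.
Qed.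

(* f takes its values in the closure of the countable set of coefficients of
   simple functions, so the exceptional null set can be chosen uniformly. *)
Lemma ae_eval_eq0 f (G : R -> V -> R) : strongly_measurable T X f ->
  (forall t, itv0 T t -> bdd_lin D b (G t)) ->
  (forall e, D e -> {ae mu, forall t, itv0 T t -> G t e = 0}) ->
  {ae mu, forall t, itv0 T t -> forall r, itv0 T r -> G t (f r) = 0}.
Proof.
move=> sf hG G0; have sD := inner_subsp ib.
have [Df [s [ss sf0]]] := sf.
have : {ae mu, forall t, forall n, itv0 T t -> forall r, G t (s n r) = 0}.
  apply: ae_foralln => n; have [m [A [c [mA Dc sE]]]] := ss n.
  (* Completed by zeros, the coefficients form a sequence, so that only countably many null sets are
     discarded. *)
  pose c' k := if insub k is Some i then c i else 0.
  have Dc' k : D (c' k).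
    by rewrite /c'; case: insubP => [i _ _|_]; [exact: Dc|exact: subsp0].
  have : {ae mu, forall t, forall k, itv0 T t -> G t (c' k) = 0}.
    by apply: ae_foralln => k; exact: G0.
  apply: aeS => t Gt0 It r; have ll := (hG t It).1.
  rewrite sE (lin_sum sD ll); last by move=> i; apply: subspZ => //; exact: Dc.
  rewrite big1// => i _; rewrite (linZ sD ll); last exact: Dc.
  have := Gt0 (val i) It; rewrite /c' valK => ->.
  by rewrite mulr0.
apply: aeS => t Gt0 It r Ir; have [ll [C C0 hC]] := hG t It.
have Dr := sm_dom sf Ir; have Ds n : D (s n r) by exact: (simple_into_dom ib).
have : G t (s n r) - G t (f r) @[n --> \oo] --> (0 : R).
  have c0 : C * hnorm b (s n r - f r) @[n --> \oo] --> (0 : R).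
    by rewrite -[X in _ --> X](mulr0 C); apply: cvgMr; apply: sf0; rewrite -itv0E.
  apply: cvg0_le c0 => n; rewrite -(linB ll)//; apply: hC; exact: subspB.
under eq_fun do rewrite Gt0// sub0r.
move=> /(cvg_unique (@Rhausdorff R)) /(_ (cvg_cst _)) /eqP.
by rewrite eq_sym oppr_eq0 => /eqP.
Qed.

Lemma ae_form_diag_eq0 (B : V -> V -> R) f : bdd_form D b D b B ->
  strongly_measurable T X f ->
  (forall e, D e -> {ae mu, forall t, itv0 T t -> B (f t) e = 0}) ->
  {ae mu, forall t, itv0 T t -> B (f t) (f t) = 0}.
Proof.
move=> hB sf B0.
have hG t : itv0 T t -> bdd_lin D b (B (f t)).
  by move=> It; apply: (bdd_form_linr hB); exact: (sm_dom sf).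
by apply: aeS (ae_eval_eq0 sf hG B0) => t Bt It; exact: Bt.
Qed.

(** The double integral is the limit of the values of [B] on the diagonal at the approximations
    [H n]. *)
Lemma double_integral_ge0 (B : V -> V -> R) f t : bdd_form D b D b B ->
  (forall x, D x -> 0 <= B x x) -> bochner_L2 T X f -> t <= T ->
  0 <= \int[mu]_(s in itv0 t) \int[mu]_(r in itv0 t) B (f s) (f r).
Proof.
move=> hB B0 bf tT; have [H [DH _ /(_ _ hB) cB]] := bochner_approximation ib bf tT.
apply: (ler_cvg_to (cvg_cst 0) cB); apply: nearW => n; exact: B0.
Qed.

(** Cauchy-Schwarz for the semidefinite form [B], applied to the approximations [H n] and a fixed e,
    shows that the integral of B(f, e) over (0,t) vanishes for almost every t. Hence B(f(t), e) = 0
    almost everywhere for each e, and e can then be taken equal to f(t). *)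
Lemma ae_energy_eq0 (B : V -> V -> R) f : bdd_form D b D b B ->
  (forall x y, D x -> D y -> B x y = B y x) ->
  (forall x, D x -> 0 <= B x x) -> bochner_L2 T X f ->
  {ae mu, forall t, itv0 T t ->
    \int[mu]_(s in itv0 t) \int[mu]_(r in itv0 t) B (f s) (f r) = 0} ->
  {ae mu, forall t, itv0 T t -> B (f t) (f t) = 0}.
Proof.
move=> hB Bsym B0 bf E0.
have iB : inner_on D B by split=> //; [exact: (inner_subsp ib)|exact: hB.1].
apply: (ae_form_diag_eq0 hB bf.1) => e De.
have hl := bdd_form_linl hB De.
apply: ae_eq0_of_integrals; first exact: (intble_lin ib hl bf).
apply: aeS E0 => t E0 It; have tT : t <= T by move: It; rewrite itv0E => /andP[_ /ltW].
have [H [DH cl cB]] := bochner_approximation ib bf tT.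
have c1 : B (H n) e ^+ 2 @[n --> \oo] --> (\int[mu]_(s in itv0 t) B (f s) e) ^+ 2.
  by rewrite expr2; apply: cvgM; exact: (cl _ hl).
have c2 : B (H n) (H n) * B e e @[n --> \oo] --> (0 : R).
  by rewrite -[X in _ --> X](mul0r (B e e)); apply: cvgMl; rewrite -(E0 It); exact: cB.
have : (\int[mu]_(s in itv0 t) B (f s) e) ^+ 2 <= 0.
  apply: (ler_cvg_to c1 c2); apply: nearW => n; exact: (inner_CS_sqr iB).
by rewrite exprn_even_le0//= => /eqP.
Qed.

End bdd_lin_closure.

(** * Uniqueness for an abstract degenerate evolution system *)

Section abstract_uniqueness.
Variables (R : realType) (T : R).
Local Notation mu := (@lebesgue_measure R).
Variables (V1 V2 : lmodType R).
Variables (D0 D1 : set V1) (b0 b1 : V1 -> V1 -> R).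
Variables (D2 : set V2) (b2 : V2 -> V2 -> R).
Hypotheses (ib0 : inner_on D0 b0) (ib1 : inner_on D1 b1) (ib2 : inner_on D2 b2).
Hypothesis b0_bdd : bdd_form D0 b0 D1 b1 b0.
Hypothesis D10 : D1 `<=` D0.
Hint Resolve measurable_itv0 : core.

(** Index 1 stands for the displacement, index 2 for the pair of pressure and fluid velocity. The
    [M] forms come from terms whose test function carries a time derivative, the [A] forms from the
    others. [K22] is the part of the dissipation that is kept. *)
Variables (M11 A11 : V1 -> V1 -> R) (M12 : V1 -> V2 -> R) (A21 : V2 -> V1 -> R).
Variables (M22 A22 K22 : V2 -> V2 -> R).
Hypotheses (hM11 : bdd_form D1 b1 D1 b1 M11) (hA11 : bdd_form D1 b1 D1 b1 A11).
Hypotheses (hM12 : bdd_form D1 b1 D2 b2 M12) (hA21 : bdd_form D2 b2 D1 b1 A21).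
Hypotheses (hM22 : bdd_form D2 b2 D2 b2 M22) (hA22 : bdd_form D2 b2 D2 b2 A22).
Hypothesis hK22 : bdd_form D2 b2 D2 b2 K22.
Hypothesis A11_sym : forall x y, D1 x -> D1 y -> A11 x y = A11 y x.
Hypothesis M22_sym : forall x y, D2 x -> D2 y -> M22 x y = M22 y x.
Hypothesis K22_sym : forall x y, D2 x -> D2 y -> K22 x y = K22 y x.
Hypothesis A11_ge0 : forall x, D1 x -> 0 <= A11 x x.
Hypothesis M22_ge0 : forall x, D2 x -> 0 <= M22 x x.
Hypothesis K22_ge0 : forall x, D2 x -> 0 <= K22 x x.
Hypothesis dissipation : forall x y, D1 x -> D2 y ->
  K22 y y <= M11 x x + M12 x y + A21 y x + A22 y y.

Variables (rho : R) (u ut : R -> V1) (y : R -> V2).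
Hypothesis rho_gt0 : 0 < rho.
Hypothesis bu : bochner_L2 T (NSpace D1 (hnorm b1)) u.
Hypothesis but : bochner_L2 T (NSpace D0 (hnorm b0)) ut.
Hypothesis by_ : bochner_L2 T (NSpace D2 (hnorm b2)) y.

Hypothesis eq1 : forall e, D1 e -> {ae mu, forall t, itv0 T t ->
  rho * b0 (ut t) e + M11 (u t) e +
  \int[mu]_(s in itv0 t) A11 (u s) e + \int[mu]_(s in itv0 t) A21 (y s) e = 0}.
Hypothesis eq2 : forall e, D2 e -> {ae mu, forall t, itv0 T t ->
  M12 (u t) e + M22 (y t) e + \int[mu]_(s in itv0 t) A22 (y s) e = 0}.
Hypothesis u_ut : forall e, D0 e -> {ae mu, forall t, itv0 T t ->
  b0 (u t) e - \int[mu]_(s in itv0 t) b0 (ut s) e = 0}.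

Let Iw t : itv0 T t -> t <= T. Proof. by rewrite itv0E => /andP[_ /ltW]. Qed.
Let Du t : itv0 T t -> D1 (u t). Proof. exact: (sm_dom bu.1). Qed.
Let Dut t : itv0 T t -> D0 (ut t). Proof. exact: (sm_dom but.1). Qed.
Let Dy t : itv0 T t -> D2 (y t). Proof. exact: (sm_dom by_.1). Qed.

Let eq1_diag : {ae mu, forall t, itv0 T t ->
  rho * b0 (ut t) (u t) + M11 (u t) (u t) +
  \int[mu]_(s in itv0 t) A11 (u s) (u t) +
  \int[mu]_(s in itv0 t) A21 (y s) (u t) = 0}.
Proof.
have h : forall t, itv0 T t -> bdd_lin D1 b1 (fun e =>
  rho * b0 (ut t) e + M11 (u t) e +
  \int[mu]_(s in itv0 t) A11 (u s) e + \int[mu]_(s in itv0 t) A21 (y s) e).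
  move=> t It; apply: bdd_linD; last exact: (bdd_lin_int ib1 ib2 hA21 by_ (Iw It)).
  apply: bdd_linD; last exact: (bdd_lin_int ib1 ib1 hA11 bu (Iw It)).
  apply: bdd_linD; last exact: (bdd_form_linr hM11 (Du It)).
  by apply: bdd_linZ; exact: (bdd_form_linr b0_bdd (Dut It)).
by apply: aeS (ae_eval_eq0 ib1 bu.1 h eq1) => t E It; exact: E.
Qed.

(** Available for all [y r] off one null set of times t, and then integrated over r in (0,t), this
    replaces the choice of Y(t) as a test element. *)
Let eq2_all : {ae mu, forall t, itv0 T t -> forall r, itv0 T r ->
  M12 (u t) (y r) + M22 (y t) (y r) + \int[mu]_(s in itv0 t) A22 (y s) (y r) = 0}.
Proof.
apply: (ae_eval_eq0 (G := fun t e => M12 (u t) e + M22 (y t) e +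
  \int[mu]_(s in itv0 t) A22 (y s) e) ib2 by_.1 _ eq2) => t It.
apply: bdd_linD; last exact: (bdd_lin_int ib2 ib2 hA22 by_ (Iw It)).
apply: bdd_linD; first exact: (bdd_form_linr hM12 (Du It)).
exact: (bdd_form_linr hM22 (Dy It)).
Qed.

Let b0u_bdd t : itv0 T t -> bdd_lin D0 b0 (fun e =>
  b0 (u t) e - \int[mu]_(s in itv0 t) b0 (ut s) e).
Proof.
move=> It; apply: bdd_linD.
  exact: (bdd_form_linr (bdd_form_inner ib0) (D10 (Du It))).
have := bdd_linZ (-1) (bdd_lin_int ib0 ib0 (bdd_form_inner ib0) but (Iw It)).
by under eq_fun do rewrite mulN1r.
Qed.

(** At r = t this expresses b0(u, u_t) through the symmetric kernel b0(u_t(s), u_t(t)); the chain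
    rule for |u|^2 thereby becomes a case of the triangle identity. *)
Let u_ut_all : {ae mu, forall t, itv0 T t -> forall r, itv0 T r ->
  b0 (u t) (ut r) - \int[mu]_(s in itv0 t) b0 (ut s) (ut r) = 0}.
Proof.
exact: (ae_eval_eq0 (G := fun t e => b0 (u t) e -
  \int[mu]_(s in itv0 t) b0 (ut s) e) ib0 but.1 b0u_bdd u_ut).
Qed.

(** Applied to [ut], [u] and [y]: the three summands of [J] below integrate to halves of nonnegative
    double integrals, the three parts of the energy. *)
Let kE (V : lmodType R) (D : set V) b (B : V -> V -> R) f : inner_on D b ->
  bdd_form D b D b B -> bochner_L2 T (NSpace D (hnorm b)) f ->
  (forall x y, D x -> D y -> B x y = B y x) ->
  (forall x, D x -> 0 <= B x x) ->
  forall t, t <= T ->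
  [/\ intble mu (itv0 t) (fun s => \int[mu]_(r in itv0 s) B (f r) (f s)),
      \int[mu]_(s in itv0 t) \int[mu]_(r in itv0 s) B (f r) (f s) =
      2^-1 * \int[mu]_(s in itv0 t) \int[mu]_(r in itv0 t) B (f s) (f r) &
      0 <= \int[mu]_(s in itv0 t) \int[mu]_(r in itv0 t) B (f s) (f r)].
Proof.
move=> ib hB bf Bsym B0 t tT.
(* off (0,T) the values of f are unconstrained *)
pose f' s := if s \in itv0 T then f s else 0.
have ff' s : itv0 T s -> f' s = f s by move=> Ts; rewrite /f' mem_set.
have Df' s : D (f' s).
  rewrite /f'; case: ifP => [/set_mem|_]; first exact: (sm_dom bf.1).
  exact: (subsp0 (inner_subsp ib)).
have tS := itv0S tT.
pose k r s := B (f' r) (f' s).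
have Ik2 : intble (leb2 R) (itv0 T `*` itv0 T)
    (fun z : measurableTypeR R * measurableTypeR R => k z.1 z.2).
  apply: (@intble_eq _ _ _ (leb2 R) _ _ _ _ _ (intble_form2 ib ib hB bf bf)).
    by apply: measurableX; exact: measurable_itv0.
  by move=> z [z1 z2]; rewrite /k !ff'.
have Ik s : itv0 T s -> intble mu (itv0 T) (k ^~ s).
  move=> Ts; apply: (intble_eq _ _ (intble_form_linl ib ib hB bf (Df' s))) => //.
  by move=> r Tr; rewrite /k (ff' r).
have E1 s : itv0 t s -> \int[mu]_(r in itv0 s) k r s = \int[mu]_(r in itv0 s) B (f r) (f s).
  move=> ts; apply: intR_eq => r sr; rewrite /k !ff' //; first exact: tS.
  by apply: (itv0S (Iw (tS _ ts))).
split.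
- by apply: (intble_eq _ _ (intble_triangle Ik2 tT)).
- rewrite -(intR_eq mu E1) (intR_triangle Ik2 Ik tT).
    congr (_ * _); apply: intR_eq => s ts; apply: intR_eq => r tr.
    by rewrite /k !ff'; [apply: Bsym; exact: (sm_dom bf.1 (tS _ _))|exact: tS|exact: tS].
  by move=> r s; apply: Bsym.
- exact: (double_integral_ge0 ib hB B0 bf tT).
Qed.

(** Formally [J] is the time derivative of the energy, and [K] below is K22(Y(t), Y(t)). *)
Let J t := rho * (\int[mu]_(s in itv0 t) b0 (ut s) (ut t)) +
  (\int[mu]_(s in itv0 t) A11 (u s) (u t)) +
  (\int[mu]_(s in itv0 t) M22 (y s) (y t)).

Let K t := \int[mu]_(s in itv0 t) \int[mu]_(r in itv0 t) K22 (y s) (y r).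

Let J_le : {ae mu, forall t, itv0 T t -> K t <= - J t}.
Proof.
apply: aeS (aeI (aeI eq1_diag eq2_all) u_ut_all) => t [[e1 e2] e3] It.
have tT := Iw It; have tS := itv0S tT.
have {}e1 := e1 It; have {}e2 := e2 It; have := e3 It _ It.
have -> : b0 (u t) (ut t) = b0 (ut t) (u t).
  by apply: (inner_sym ib0); [exact: D10 (Du It)|exact: Dut].
move=> /eqP; rewrite subr_eq0 => /eqP {}e3; rewrite e3 in e1.
have IM12 : intble mu (itv0 t) (fun r => M12 (u t) (y r)).
  apply: (intbleS (measurable_itv0 t) (measurable_itv0 T) tS).
  exact: (intble_form_linr ib1 ib2 hM12 (Du It) by_).
have IM22 : intble mu (itv0 t) (fun r => M22 (y t) (y r)).
  apply: (intbleS (measurable_itv0 t) (measurable_itv0 T) tS).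
  exact: (intble_form_linr ib2 ib2 hM22 (Dy It) by_).
have E : \int[mu]_(r in itv0 t) M12 (u t) (y r) +
  \int[mu]_(r in itv0 t) M22 (y t) (y r) +
  \int[mu]_(r in itv0 t) \int[mu]_(s in itv0 t) A22 (y s) (y r) = 0.
  rewrite -RintegralD//.
  have -> : \int[mu]_(r in itv0 t) \int[mu]_(s in itv0 t) A22 (y s) (y r) =
     - \int[mu]_(r in itv0 t) (M12 (u t) (y r) + M22 (y t) (y r)).
    rewrite -[RHS]mulN1r -RintegralZl//; last exact: intbleD.
    apply: intR_eq => r tr; rewrite mulN1r; apply/eqP; rewrite -addr_eq0.
    by rewrite addrC e2//; exact: tS.
  by rewrite subrr.
have MS : \int[mu]_(r in itv0 t) M22 (y t) (y r) = \int[mu]_(s in itv0 t) M22 (y s) (y t).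
  by apply: intR_eq => r tr; apply: M22_sym; apply: Dy => //; exact: tS.
(* The dissipation inequality is available for elements of [D2] only. It is applied to u(t) and the
   approximations [H n] of Y(t), and then passed to the limit. *)
have [H [DH cl cB]] := bochner_approximation ib2 by_ tT.
suff : K t <= M11 (u t) (u t) + \int[mu]_(r in itv0 t) M12 (u t) (y r) +
  \int[mu]_(s in itv0 t) A21 (y s) (u t) +
  \int[mu]_(r in itv0 t) \int[mu]_(s in itv0 t) A22 (y s) (y r).
  by rewrite /J; rewrite MS in E; move: e1 E; lra.
have c1 := cB _ hK22.
(* [A22] is not assumed symmetric, and the inner integral is over its first argument; hence the
   flip. *)
have c2 := cB _ (bdd_form_flip hA22).
have c3 := cl _ (bdd_form_linr hM12 (Du It)).
have c4 := cl _ (bdd_form_linl hA21 (Du It)).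
have c5 : M11 (u t) (u t) + M12 (u t) (H n) + A21 (H n) (u t) + A22 (H n) (H n)
    @[n --> \oo] --> M11 (u t) (u t) + \int[mu]_(r in itv0 t) M12 (u t) (y r) +
  \int[mu]_(s in itv0 t) A21 (y s) (u t) +
  \int[mu]_(r in itv0 t) \int[mu]_(s in itv0 t) A22 (y s) (y r).
  apply: cvgD c2; apply: cvgD c4; apply: cvgD c3; exact: cvg_cst.
apply: (ler_cvg_to c1 c5); apply: nearW => n; apply: dissipation; [exact: Du|exact: DH].
Qed.

(** The integral of [J] over (0,t) is half of a nonnegative expression, whereas J <= - K <= 0 almost
    everywhere. So [J] and [K] vanish almost everywhere and each part of the energy vanishes at
    every time. A vanishing double integral makes the values of its function null; in particular u_t
    is null, and with it its primitive u. *)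
Theorem abstract_uniqueness : {ae mu, forall t, itv0 T t ->
  [/\ b0 (u t) (u t) = 0, M22 (y t) (y t) = 0 & K22 (y t) (y t) = 0]}.
Proof.
have K0 t : t <= T -> 0 <= K t.
  by move=> tT; exact: (double_integral_ge0 ib2 hK22 K22_ge0 by_ tT).
have e0 := kE ib0 (bdd_form_inner ib0) but (inner_sym ib0) (inner_ge0 ib0).
have e1 := kE ib1 hA11 bu A11_sym A11_ge0.
have e2 := kE ib2 hM22 by_ M22_sym M22_ge0.
have IJ t : t <= T -> intble mu (itv0 t) J.
  move=> tT; have [I0 _ _] := e0 t tT; have [I1 _ _] := e1 t tT.
  have [I2 _ _] := e2 t tT.
  apply: intbleD => //; apply: intbleD => //; exact: intbleZ.
have EJ t : t <= T -> \int[mu]_(s in itv0 t) J s = 2^-1 *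
    (rho * (\int[mu]_(s in itv0 t) \int[mu]_(r in itv0 t) b0 (ut s) (ut r)) +
     (\int[mu]_(s in itv0 t) \int[mu]_(r in itv0 t) A11 (u s) (u r)) +
     (\int[mu]_(s in itv0 t) \int[mu]_(r in itv0 t) M22 (y s) (y r))).
  move=> tT; have [I0 E0 _] := e0 t tT; have [I1 E1 _] := e1 t tT.
  have [I2 E2 _] := e2 t tT.
  have mt := measurable_itv0 t; have I0' := intbleZ rho mt I0.
  rewrite (RintegralD mt (intbleD mt I0' I1) I2) (RintegralD mt I0' I1).
  by rewrite (RintegralZl _ mt I0) E0 E1 E2 mulrCA -!mulrDr.
have J_le0 : {ae mu, forall t, itv0 T t -> J t <= 0}.
  apply: aeS J_le => t h It; have := h It; have := K0 _ (Iw It); lra.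
have J0 : ae_eq mu (itv0 T) J (cst 0).
  apply: intR_ae_le0_eq0 => //; first exact: IJ.
  have [_ _ p0] := e0 _ (lexx T); have [_ _ p1] := e1 _ (lexx T).
  have [_ _ p2] := e2 _ (lexx T).
  by rewrite EJ// mulr_ge0// ?invr_ge0// !addr_ge0// mulr_ge0// ltW.
have KE : {ae mu, forall t, itv0 T t -> K t = 0}.
  apply: aeS (aeI J_le J0) => t [h1 h2] It; have := h1 It; have := h2 It.
  have := K0 _ (Iw It); move=> /= h3 h4; rewrite h4 oppr0 => h5.
  by apply/eqP; rewrite eq_le h3 h5.
have E0 t : itv0 T t ->
    \int[mu]_(s in itv0 t) \int[mu]_(r in itv0 t) b0 (ut s) (ut r) = 0 /\
    \int[mu]_(s in itv0 t) \int[mu]_(r in itv0 t) M22 (y s) (y r) = 0.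
  move=> It; have tT := Iw It.
  have [_ _ p0] := e0 _ tT; have [_ _ p1] := e1 _ tT; have [_ _ p2] := e2 _ tT.
  have : \int[mu]_(s in itv0 t) J s <= 0.
    apply: intR_ae_le0 => //; first exact: IJ.
    by apply: aeS J_le0 => s h ts; apply: h; exact: (itv0S tT).
  rewrite EJ// pmulr_rle0 ?invr_gt0//.
  set x0 := Rintegral _ _ _ in p0 *; set x1 := Rintegral _ _ _ in p1 *.
  set x2 := Rintegral _ _ _ in p2 *.
  have := mulr_ge0 (ltW rho_gt0) p0 => rx0 le0.
  have /eqP : rho * x0 = 0 by lra.
  by rewrite mulf_eq0 gt_eqF//= => /eqP ->; split=> //; lra.
have aeE0 := aeW mu E0.
have ut0 : {ae mu, forall t, itv0 T t -> b0 (ut t) (ut t) = 0}.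
  apply: (ae_energy_eq0 ib0 (bdd_form_inner ib0) (inner_sym ib0) (inner_ge0 ib0) but).
  by apply: aeS aeE0 => t h It; have [] := h It.
have y0 : {ae mu, forall t, itv0 T t -> M22 (y t) (y t) = 0}.
  apply: (ae_energy_eq0 ib2 hM22 M22_sym M22_ge0 by_).
  by apply: aeS aeE0 => t h It; have [] := h It.
have k0 := ae_energy_eq0 ib2 hK22 K22_sym K22_ge0 by_ KE.
have u0 : {ae mu, forall t, itv0 T t -> b0 (u t) (u t) = 0}.
  have ib01 : bdd_form D1 b1 D1 b1 b0.
    have [_ [C C0 hC]] := b0_bdd.
    (* The embedding of [D1] in [D0] is bounded: [b0_bdd] at (x, x) gives |x|_0^2 <= C |x|_0 |x|_1,
       and one factor |x|_0 is divided out. *)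
    have b01 x : D1 x -> hnorm b0 x <= C * hnorm b1 x.
      move=> Dx; have := hC _ _ (D10 Dx) Dx.
      rewrite ger0_norm ?(inner_ge0 ib0)// -?(hnorm_sqr ib0)//; try exact: D10.
      have [->|n0] := eqVneq (hnorm b0 x) 0; first by rewrite mulr_ge0 ?hnorm_ge0.
      have n1 : 0 < hnorm b0 x by rewrite lt_neqAle eq_sym n0 hnorm_ge0.
      by rewrite expr2 mulrCA ler_pM2l.
    have [Bl Br] := inner_bilin ib0; split.
      split=> [z Dz a x x' Dx Dx' | x Dx a z z' Dz Dz'].
        by apply: Bl; exact: D10.
      by apply: Br; exact: D10.
    exists (C * C); first by rewrite mulr_ge0.
    move=> x z Dx Dz; apply: le_trans (inner_CS ib0 (D10 Dx) (D10 Dz)) _.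
    rewrite mulrACA; apply: ler_pM; rewrite ?hnorm_ge0//; exact: b01.
  apply: (ae_form_diag_eq0 ib1 ib01 bu.1) => e De.
  apply: aeS (u_ut (D10 De)) => t h It; have /eqP := h It.
  rewrite subr_eq0 => /eqP ->.
  rewrite -[RHS](intR0 mu (itv0 t)); apply: intR_ae_eq => //.
  - apply: (intbleS (measurable_itv0 t) (measurable_itv0 T) (itv0S (Iw It))).
    exact: (intble_form_linl ib0 ib0 (bdd_form_inner ib0) but (D10 De)).
  - apply: aeS ut0 => s h0 ts; have Is := itv0S (Iw It) ts.
    have := inner_CS_sqr ib0 (Dut Is) (D10 De); rewrite h0// mul0r.
    by rewrite exprn_even_le0//= => /eqP.
apply: aeS (aeI (aeI u0 y0) k0) => t [[h1 h2] h3] It; split; [exact: h1|exact: h2|exact: h3].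
Qed.

End abstract_uniqueness.

(** * Smooth bumps and determining families *)

Section flat_functions.
Variable R : realType.
Implicit Types (P Q : {poly R}) (f g : R -> R).

(* These functions are stable under derivation; flat 1 is x |-> exp (-1/x),
   extended by 0. *)
Definition flat P (x : R) : R :=
  if 0 < x then P.[x^-1] * expR (- x^-1) else 0.

Lemma expr_le_expR n (y : R) : 0 <= y -> y ^+ n <= n`!%:R * expR y.
Proof.
case: n => [|n] y0.
  by rewrite expr0 fact0 mul1r (le_trans _ (expR_ge1Dx y))// lerDl.
have := expR_ge1Dxn n y0; rewrite -ler_pdivrMl ?ltr0n ?fact_gt0// mulrC.
by apply: le_trans; rewrite lerDr.
Qed.

Lemma horner_le_expR Q : exists2 C, 0 <= C &
  forall y : R, 0 <= y -> `|Q.[y]| <= C * expR y.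
Proof.
exists (\sum_(i < size Q) `|Q`_i| * i`!%:R); first exact: sumr_ge0.
move=> y y0; rewrite horner_coef (le_trans (ler_norm_sum _ _ _))// mulr_suml.
apply: ler_sum => i _; rewrite normrM -mulrA ler_wpM2l//.
by rewrite ger0_norm ?exprn_ge0// expr_le_expR.
Qed.

(** The exponential absorbs every power of 1/x. One power more than those of [P] is spent, and this
    leaves the factor |x|. *)
Lemma flat_bound P : exists2 C, 0 <= C & forall x, `|flat P x| <= C * `|x|.
Proof.
have [C C0 hC] := horner_le_expR (P * 'X).
exists C => // x; rewrite /flat; case: ifPn => x0; last first.
  by rewrite normr0 mulr_ge0.
have y0 : 0 < x^-1 by rewrite invr_gt0.
have := hC _ (ltW y0); rewrite hornerM hornerX normrM (gtr0_norm y0) => h.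
rewrite normrM (gtr0_norm (expR_gt0 _)) (gtr0_norm x0) expRN.
rewrite -ler_pdivrMr// -(ler_pM2r (expR_gt0 x^-1)).
by rewrite mulrAC divfK ?gt_eqF ?expR_gt0.
Qed.

(** In the variable y = 1/x, d/dx is - y^2 d/dy, and the derivative of P(y) exp(-y) in y is (P' -
    P)(y) exp(-y). At 0 the derivative is 0 by [flat_bound]. *)
Lemma is_derive_flat P (x : R) :
  is_derive x 1 (flat P) (flat ('X^2 * (P - P^`())) x).
Proof.
have [x0|x0|x0] := ltgtP x 0.
- have -> : flat ('X^2 * (P - P^`())) x = 0 by rewrite /flat ltNge (ltW x0).
  apply: (@near_eq_is_derive R R R (cst 0)).
  have : nbhs x [set y | y < 0] by exact: (open_nbhs_nbhs (conj (@open_lt _ 0) x0)).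
  by apply: filterS => y y0; rewrite /flat ltNge (ltW y0).
- apply: (@near_eq_is_derive R R R (fun y => P.[y^-1] * expR (- y^-1))).
    have : nbhs x [set y | y > 0] by exact: (open_nbhs_nbhs (conj (@open_gt _ 0) x0)).
    by apply: filterS => y y0; rewrite /flat y0.
  rewrite /flat x0.
  have xn0 : x != 0 by rewrite gt_eqF.
  have dV : is_derive x 1 (fun y : R => y^-1) (- x ^- 2).
    have := @is_deriveV R id x 1 1 xn0 (is_derive_id x (1 : R)).
    by rewrite /GRing.scale /= mulr1.
  have dP := is_derive1_comp (is_derive_poly P x^-1) dV.
  have dE : is_derive x 1 (fun y => expR (- y^-1)) (expR (- x^-1) * x ^- 2).
    have dN : is_derive x 1 (fun y : R => - y^-1) (x ^- 2).
      by have := is_deriveN dV; rewrite opprK.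
    exact: (is_derive1_comp (is_derive_expR _) dN).
  have [h1 h2] := is_deriveM dP dE; apply: DeriveDef; first exact: h1.
  apply: (etrans h2); rewrite /= /GRing.scale /= hornerM hornerXn hornerD hornerN.
  by rewrite exprVn; ring.
- subst x; have -> : flat ('X^2 * (P - P^`())) 0 = 0 by rewrite /flat ltxx.
  have c0 : h^-1 *: (flat P (h *: 1 + 0) - flat P 0) @[h --> 0^'] --> (0 : R).
    (* The difference quotient at 0 is again a flat function, for the polynomial [P * 'X]. *)
    have E h : h != 0 -> h^-1 *: (flat P (h *: 1 + 0) - flat P 0) = flat (P * 'X) h.
      move=> h0; rewrite addr0 {2}/flat ltxx subr0 /flat /GRing.scale /= mulr1.
      by case: ifP => _; rewrite ?mulr0// hornerM hornerX; ring.
    have [C C0 hC] := flat_bound (P * 'X).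
    apply/cvgrPdist_le => e e0.
    have d0 : 0 < e / (C + 1) by rewrite divr_gt0// ltr_wpDl.
    exists (e / (C + 1)) => // h hd hn0.
    have {}hd : `|h| < e / (C + 1) by rewrite -normrN -(sub0r h).
    rewrite E// sub0r normrN (le_trans (hC h))//.
    rewrite (le_trans (ler_wpM2l C0 (ltW hd)))//.
    rewrite mulrCA ger_pMr// ler_pdivrMr ?mul1r ?lerDl// ltr_wpDl//.
  apply: DeriveDef; first by apply/cvg_ex; exists 0.
  exact: (cvg_lim (@Rhausdorff R) c0).
Qed.

Fixpoint times_derivable (n : nat) f : Prop :=
  if n is m.+1 then (forall x, derivable f x 1) /\ times_derivable m (derive1 f)
  else True.

Definition smooth f := forall n, times_derivable n f.

Lemma smooth_derivable f (x : R) : smooth f -> derivable f x 1.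
Proof. by move=> /(_ 1%N) [+ _]; exact. Qed.

Lemma smooth_derive1 f : smooth f -> smooth (derive1 f).
Proof. by move=> sf n; have [] := sf n.+1. Qed.

Lemma smooth_derive1n f n (x : R) : smooth f -> derivable (derive1n n f) x 1.
Proof.
elim: n f => [|n IH] f sf; first exact: smooth_derivable.
by rewrite derive1Sn; apply: IH; exact: smooth_derive1.
Qed.

Lemma smooth_continuous f : smooth f -> continuous f.
Proof.
move=> sf x; apply/differentiable_continuous/derivable1_diffP.
exact: smooth_derivable.
Qed.

Lemma times_derivableD n f g : times_derivable n f -> times_derivable n g ->
  times_derivable n (fun x => f x + g x).
Proof.
elim: n f g => //= n IH f g [df tf] [dg tg]; split.
  by move=> x; exact: derivableD.
rewrite (_ : derive1 _ = fun x => (derive1 f) x + (derive1 g) x); first exact: IH.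
by apply/funext => x; rewrite !derive1E; exact: (deriveD (df x) (dg x)).
Qed.

Lemma times_derivableW n f : times_derivable n.+1 f -> times_derivable n f.
Proof.
elim: n f => // n IH f [df tf]; split=> //; exact: IH.
Qed.

Lemma times_derivableM n f g : times_derivable n f -> times_derivable n g ->
  times_derivable n (fun x => f x * g x).
Proof.
elim: n f g => // n IH f g tf tg; have [[df tf'] [dg tg']] := (tf, tg); split.
  by move=> x; exact: derivableM.
rewrite (_ : derive1 _ = fun x => f x * (derive1 g) x + g x * (derive1 f) x).
  by apply: times_derivableD; apply: IH => //; exact: times_derivableW.
by apply/funext => x; rewrite !derive1E; exact: (deriveM (df x) (dg x)).
Qed.

Lemma smoothM f g : smooth f -> smooth g -> smooth (fun x => f x * g x).
Proof. by move=> sf sg n; exact: times_derivableM. Qed.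

Lemma smoothD f g : smooth f -> smooth g -> smooth (fun x => f x + g x).
Proof. by move=> sf sg n; exact: times_derivableD. Qed.

Lemma smooth_cst (a : R) : smooth (cst a).
Proof.
move=> n; elim: n a => //= n IH a; split; first by move=> x; exact: derivable_cst.
rewrite (_ : derive1 _ = cst 0); first exact: IH.
by apply/funext => x; rewrite derive1_cst.
Qed.

Lemma is_derive_affine (m q x : R) : is_derive x 1 (fun y => m * y + q) m.
Proof.
have := is_deriveD (is_deriveZ m (is_derive_id x (1 : R))) (is_derive_cst q x (1 : R)).
by rewrite addr0 /GRing.scale /= mulr1.
Qed.

Lemma smooth_affine f (m q : R) : smooth f -> smooth (fun x => f (m * x + q)).
Proof.
move=> sf n; elim: n f sf => //= n IH f sf.
have d (x : R) : is_derive x 1 (fun x => f (m * x + q)) ((derive1 f) (m * x + q) * m).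
  apply: (is_derive1_comp (f := f) (g := fun x => m * x + q)).
    by rewrite derive1E; apply: derivableP; exact: smooth_derivable.
  exact: is_derive_affine.
split; first by move=> x; have [] := d x.
rewrite (_ : derive1 _ = fun x => (derive1 f) (m * x + q) * cst m x).
  apply: times_derivableM; last exact: smooth_cst.
  by apply: IH; exact: smooth_derive1.
by apply/funext => x; rewrite derive1E; have [_ ->] := d x.
Qed.

Lemma smooth_flat P : smooth (flat P).
Proof.
move=> n; elim: n P => //= n IH P; split.
  by move=> x; have [] := is_derive_flat P x.
rewrite (_ : derive1 _ = flat ('X^2 * (P - P^`()))); first exact: IH.
by apply/funext => x; rewrite derive1E; have [_ ->] := is_derive_flat P x.
Qed.

Lemma smooth_primitive f g : smooth f -> (forall x : R, is_derive x 1 g (f x)) -> smooth g.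
Proof.
move=> sf dg [|n] //=; split; first by move=> x; have [] := dg x.
rewrite (_ : derive1 _ = f); first exact: sf.
by apply/funext => x; rewrite derive1E; have [_ ->] := dg x.
Qed.

(** A smooth substitute for the indicator of (a, c). Growing n steepens both flanks while the values
    stay in [0, 1], so that dominated convergence recovers integrals over (a, c). *)
Definition cbump (a c : R) (n : nat) (x : R) : R :=
  flat 1 (n.+1%:R * x + - (n.+1%:R * a)) * flat 1 (- n.+1%:R * x + n.+1%:R * c).

Lemma smooth_cbump a c n : smooth (cbump a c n).
Proof. by apply: smoothM; apply: smooth_affine; exact: smooth_flat. Qed.

Lemma flat1_ge0 x : 0 <= flat 1 x.
Proof. by rewrite /flat; case: ifP => // _; rewrite hornerC mul1r expR_ge0. Qed.

Lemma flat1_le1 x : flat 1 x <= 1.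
Proof.
rewrite /flat; case: ifP => // x0; rewrite hornerC mul1r -expR0 ler_expR.
by rewrite oppr_le0 invr_ge0 ltW.
Qed.

Lemma cbump_ge0 a c n x : 0 <= cbump a c n x.
Proof. by rewrite mulr_ge0// flat1_ge0. Qed.

Lemma cbump_le1 a c n x : cbump a c n x <= 1.
Proof. by rewrite -[leRHS]mulr1 ler_pM ?flat1_ge0 ?flat1_le1. Qed.

Lemma cbump_out a c n x : ~~ (a < x < c) -> cbump a c n x = 0.
Proof.
rewrite negb_and -!leNgt => /orP[xa|cx]; rewrite /cbump /flat.
  rewrite ifF ?mul0r//; apply/negbTE; rewrite -leNgt subr_le0.
  by rewrite ler_wpM2l.
rewrite [X in _ * X]ifF ?mulr0//; apply/negbTE; rewrite -leNgt mulNr addrC.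
by rewrite subr_le0 ler_wpM2l.
Qed.

Lemma flat1_cvg (x : R) : 0 < x -> flat 1 (n.+1%:R * x) @[n --> \oo] --> (1 : R).
Proof.
move=> x0; rewrite (_ : (fun n => _) = fun n => expR (- (n.+1%:R^-1 * x^-1))); last first.
  by apply/funext => n; rewrite /flat pmulr_rgt0// x0 hornerC mul1r invfM.
have h : - (n.+1%:R^-1 * x^-1) @[n --> \oo] --> (0 : R).
  rewrite -[X in _ --> X]oppr0; apply: cvgN; rewrite -[X in _ --> X](mul0r x^-1).
  by apply: cvgMl; exact: cvg_harmonic.
by rewrite -[X in _ --> X]expR0; exact: (continuous_cvg _ (@continuous_expR R 0) h).
Qed.

Lemma cbump_cvg a c x : cbump a c n x @[n --> \oo] --> (\1_(`]a, c[%classic) x : R).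
Proof.
rewrite indicE; have [xac|xac] := boolP (a < x < c).
  rewrite mem_set/= ?in_itv//=; case/andP: xac => ax xc.
  rewrite (_ : (fun n => _) = fun n => flat 1 (n.+1%:R * (x - a)) * flat 1 (n.+1%:R * (c - x))).
    by rewrite -[X in _ --> X]mulr1; apply: cvgM; apply: flat1_cvg; rewrite subr_gt0.
  by apply/funext => n; rewrite /cbump; congr (flat 1 _ * flat 1 _); ring.
rewrite memNset/= ?in_itv/=; last exact/negP.
by under eq_fun do rewrite cbump_out//; exact: cvg_cst.
Qed.

End flat_functions.

(** * Measurability of continuous functions of two and three variables *)

Section continuous_measurable.
Variable R : realType.
Local Notation mR := (measurableTypeR R).

(** The last variable is rounded down to the grid of step 1/(n+1): on each of countably many strips
    the function depends on the other variables only, and by continuity the rounded functions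
    converge. No comparison of the product sigma-algebra with the Borel sets of the product topology
    is involved. *)
Lemma measurable_caratheodory d (X : measurableType d) (f : X * R -> R) :
  (forall x, continuous (fun y => f (x, y))) ->
  (forall y, measurable_fun setT (fun x => f (x, y))) ->
  measurable_fun setT (f : X * mR -> mR).
Proof.
move=> cf mf.
pose q n (y : R) : R := (Num.floor (n.+1%:R * y))%:~R / n.+1%:R.
have qy y : q n y @[n --> \oo] --> y.
  have c0 : q n y - y @[n --> \oo] --> (0 : R).
    apply: cvg0_le (@cvg_harmonic R) => n.
    have n0 : 0 < n.+1%:R :> R by rewrite ltr0n.
    have -> : q n y - y = - ((n.+1%:R * y - (Num.floor (n.+1%:R * y))%:~R) / n.+1%:R).
      by rewrite /q; field; rewrite addrC natr1 gt_eqF.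
    have := Num.Theory.floor_itv (n.+1%:R * y); rewrite intrD => /andP[h1 h2].
    rewrite normrN normrM (gtr0_norm (x := _^-1)) ?invr_gt0// ger0_norm ?subr_ge0//.
    by rewrite -[leRHS]mul1r ler_wpM2r ?invr_ge0 ?ler0n// lerBlDr addrC ltW.
  rewrite -[X in _ --> X]add0r (_ : (fun n => _) = fun n => (q n y - y) + y).
    by apply: cvgD => //; exact: cvg_cst.
  by apply/funext => n; rewrite subrK.
apply: (measurable_fun_cvg (h := fun n (z : X * mR) => f (z.1, q n z.2))); last first.
  move=> [x y] _ /=.
  exact: (continuous_cvg _ (cf x y) (qy y)).
move=> n.
pose E k : set (X * mR) :=
  if unpickle k is Some m then [set z | Num.floor (n.+1%:R * z.2) = m :> int] else set0.
have EP m (z : X * mR) : (Num.floor (n.+1%:R * z.2) = m) <->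
    `[m%:~R, (m + 1)%:~R[%classic (n.+1%:R * z.2).
  rewrite /= in_itv /=; split=> [<-|h]; last exact/Num.Theory.floor_def.
  exact: Num.Theory.floor_itv.
have mE k : measurable (E k).
  rewrite /E; case: unpickle => [m|//].
  have mg : measurable_fun setT (fun z : X * mR => n.+1%:R * z.2 : mR).
    apply: measurable_funM; first exact: measurable_cst.
    exact: measurable_snd.
  have := mg measurableT _ (measurable_itv `[m%:~R, (m + 1)%:~R[); rewrite setTI.
  congr measurable; apply/seteqP; split=> z /=; by move=> /EP.
rewrite (_ : setT = \bigcup_k E k); last first.
  apply/esym; rewrite -subTset => z _.
  exists (pickle (Num.floor (n.+1%:R * z.2))); first exact: Logic.I.
  rewrite /E pickleK; exact: erefl.
apply/measurable_fun_bigcup => // k; rewrite /E.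
case: unpickle (mE k) => [m|] mEm; last exact: measurable_fun_set0.
have : measurable_fun [set z : X * mR | Num.floor (n.+1%:R * z.2) = m :> int]
    (fun z => f (z.1, m%:~R / n.+1%:R)).
  apply: measurable_funTS.
  exact: (measurableT_comp (mf (m%:~R / n.+1%:R)) measurable_fst).
by apply: eq_measurable_fun => z /set_mem /= zm; rewrite /q zm.
Qed.

Lemma continuous_pairr (U V : topologicalType) (u : U) : continuous (fun v : V => (u, v)).
Proof. by move=> v; apply: cvg_pair; [exact: cvg_cst|exact: cvg_id]. Qed.

Lemma continuous_pairl (U V : topologicalType) (v : V) : continuous (fun u : U => (u, v)).
Proof. by move=> u; apply: cvg_pair; [exact: cvg_id|exact: cvg_cst]. Qed.

Lemma continuous_measurable2 (f : R * R -> R) : continuous f ->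
  measurable_fun setT (f : mR * mR -> mR).
Proof.
move=> cf; apply: measurable_caratheodory => [x|y].
  by move=> y; apply: (continuous_comp (g := f)); [exact: continuous_pairr|exact: cf].
apply: continuous_measurable_fun => x.
by apply: (continuous_comp (g := f)); [exact: continuous_pairl|exact: cf].
Qed.

Lemma continuous_measurable3 (f : R * R * R -> R) : continuous f ->
  measurable_fun setT (f : mR * mR * mR -> mR).
Proof.
move=> cf; apply: measurable_caratheodory => [x|y].
  by move=> y; apply: (continuous_comp (g := f)); [exact: continuous_pairr|exact: cf].
apply: continuous_measurable2 => x.
by apply: (continuous_comp (g := f)); [exact: continuous_pairl|exact: cf].
Qed.

End continuous_measurable.

(** * Countable families of test functions that determine an integrable function *)

Section determining.

(** The index set is countable so that null sets depending on the index can be united; this makes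
    the property pass to products. *)
Definition determining d (X : measurableType d) (R : realType)
    (mu : {measure set X -> \bar R}) (D : set X) (K : countType)
    (Phi : K -> X -> R) :=
  [/\ forall k, measurable_fun D (Phi k),
      forall k x, D x -> `|Phi k x| <= 1 &
      forall f, intble mu D f ->
        (forall k, \int[mu]_(x in D) (f x * Phi k x) = 0) ->
        ae_eq mu D f (cst 0)].

Lemma ae_forall_count d (X : measurableType d) (R : realType)
    (mu : {measure set X -> \bar R}) (K : countType) (P : K -> X -> Prop) :
  (forall k, {ae mu, forall x, P k x}) -> {ae mu, forall x, forall k, P k x}.
Proof.
move=> h.
have : {ae mu, forall x, forall n, if unpickle n is Some k then P k x else True}.
  apply: ae_foralln => n; case: (unpickle n) => [k|]; first exact: h.
  exact: aeW.
by apply: aeS => x hx k; have := hx (pickle k); rewrite pickleK.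
Qed.

Lemma intble_mulr_bdd d (X : measurableType d) (R : realType)
    (mu : {measure set X -> \bar R}) (D : set X) (f g : X -> R) :
  measurable D -> intble mu D f -> measurable_fun D g ->
  (forall x, D x -> `|g x| <= 1) -> intble mu D (fun x => f x * g x).
Proof.
move=> mD If mg g1; apply: (@intble_le _ _ _ mu D _ (fun x => `|f x|)) => //.
- by apply: measurable_funM => //; exact: intble_meas If.
- by move=> x Dx; rewrite normrM ler_piMr// g1.
- exact: intble_norm.
Qed.

Section product.
Variables (d1 d2 : measure_display) (X : measurableType d1) (Y : measurableType d2).
Variable R : realType.
Variable m1 : {sigma_finite_measure set X -> \bar R}.
Variable m2 : {sigma_finite_measure set Y -> \bar R}.
Variables (D1 : set X) (D2 : set Y) (mD1 : measurable D1) (mD2 : measurable D2).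
Variables (K L : countType) (Phi : K -> X -> R) (Psi : L -> Y -> R).
Let pm : {measure set (X * Y)%type -> \bar R} := (m1 \x m2)%E.

(** For fixed l, the integral of f(x, .) against [Psi l] is a function of x orthogonal to every
    [Phi k], hence null. By countability, almost every slice f(x, .) is orthogonal to all [Psi l],
    hence null, and Fubini applied to |f| concludes. *)
Lemma determining_prod : determining m1 D1 Phi -> determining m2 D2 Psi ->
  determining pm (D1 `*` D2)
    (fun (k : K * L) (z : X * Y) => Phi k.1 z.1 * Psi k.2 z.2).
Proof.
move=> [mPhi Phi1 hPhi] [mPsi Psi1 hPsi].
have mD12 : measurable (D1 `*` D2) by exact: measurableX.
have mP1 k : measurable_fun (D1 `*` D2) (fun z => Phi k z.1).
  have sub : (fst @` (D1 `*` D2)) `<=` D1 by move=> _ [[a c] [h _] <-].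
  apply: (measurable_comp mD1 sub (mPhi k)).
  by apply: measurable_funTS; exact: measurable_fst.
have mP2 l : measurable_fun (D1 `*` D2) (fun z => Psi l z.2).
  have sub : (snd @` (D1 `*` D2)) `<=` D2 by move=> _ [[a c] [_ h] <-].
  apply: (measurable_comp mD2 sub (mPsi l)).
  by apply: measurable_funTS; exact: measurable_snd.
split.
- by move=> k; apply: measurable_funM.
- by move=> k z [z1 z2]; rewrite normrM -[leRHS]mulr1 ler_pM ?Phi1 ?Psi1.
move=> f If f0.
have I2 l : intble pm (D1 `*` D2) (fun z => f z * Psi l z.2).
  by apply: intble_mulr_bdd => // z [_ z2]; exact: Psi1.
have inner0 l : ae_eq m1 D1 (fun x => \int[m2]_(y in D2) (f (x, y) * Psi l y)) (cst 0).
  apply: hPhi; first exact: (intble_fubini1 mD1 mD2 (I2 l)).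
  move=> k.
  have I3 : intble pm (D1 `*` D2) (fun z => f z * Psi l z.2 * Phi k z.1).
    by apply: intble_mulr_bdd => // z [z1 _]; exact: Phi1.
  transitivity (\int[m1]_(x in D1) \int[m2]_(y in D2) (f (x, y) * Psi l y * Phi k x)).
    apply: (intR_ae_eq mD1).
    - apply: intble_mulr_bdd => //; first exact: (intble_fubini1 mD1 mD2 (I2 l)).
      by move=> x Dx; exact: Phi1.
    - exact: intble_meas (intble_fubini1 mD1 mD2 I3).
    - apply: aeS (ae_intble_fubini1 mD1 mD2 (I2 l)) => x Ix Dx.
      by rewrite -RintegralZr//; exact: Ix.
  rewrite (intR_fubini1 mD1 mD2 I3) -[RHS](f0 (k, l)).
  by apply: intR_eq => z _ /=; rewrite -mulrA (mulrC (Psi _ _)).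
have := aeI (ae_forall_count inner0) (ae_intble_fubini1 mD1 mD2 If) => ae1.
have J0 : ae_eq m1 D1 (fun x => \int[m2]_(y in D2) `|f (x, y)|) (cst 0).
  apply: aeS ae1 => x [h1 h2] Dx /=.
  have Ifx := h2 Dx.
  have fx0 : ae_eq m2 D2 (fun y => f (x, y)) (cst 0).
    by apply: hPsi => // l; exact: h1.
  rewrite -[RHS](intR0 m2 D2); apply: intR_ae_eq => //; first exact: intble_norm.
  by apply: aeS fx0 => y h Dy; rewrite h// normr0.
have If' := intble_norm mD12 If.
have := intR_ae_eq mD1 (intble_fubini1 mD1 mD2 If') (measurable_cst _) J0.
rewrite intR0 (intR_fubini1 mD1 mD2 If') => E0.
have := intR_ge0_eq0 mD12 If' (fun z _ => normr_ge0 _).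
rewrite E0 => /(_ (lexx 0)); apply: aeS => z h Dz.
by have /eqP := h Dz; rewrite /= normr_eq0 => /eqP.
Qed.

End product.

Section one_dim.
Variable R : realType.
Local Notation mu := (@lebesgue_measure R).

(** Endpoints that do not keep strictly inside the interval give the zero function, so that one
    countable index type serves all intervals. *)
Definition rbump (lo hi : R) (k : rat * rat * nat) : R -> R :=
  if (lo < ratr k.1.1) && (ratr k.1.2 < hi)
  then cbump (ratr k.1.1) (ratr k.1.2) k.2 else cst 0.

Lemma rbump_norm_le1 lo hi k x : `|rbump lo hi k x| <= 1.
Proof.
rewrite /rbump; case: ifP => _; last by rewrite normr0.
by rewrite ger0_norm ?cbump_ge0 ?cbump_le1.
Qed.

Lemma smooth_rbump lo hi k : smooth (rbump lo hi k).
Proof. by rewrite /rbump; case: ifP => _; [exact: smooth_cbump|exact: smooth_cst]. Qed.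

(** As n grows the bumps tend to indicators of intervals with rational ends, and these to the
    indicator of (lo, x). Thus all cumulative integrals of the function vanish. *)
Lemma determining_rbump lo hi :
  determining mu (`]lo, hi[%classic : set (measurableTypeR R)) (rbump lo hi).
Proof.
have mD : measurable (`]lo, hi[%classic : set (measurableTypeR R)).
  exact: measurable_itv.
split.
- move=> k; apply: measurable_funTS; apply: continuous_measurable_fun.
  exact/smooth_continuous/smooth_rbump.
- by move=> k x _; exact: rbump_norm_le1.
move=> f If f0.
have I0 (a c : rat) : lo < ratr a -> ratr c < hi ->
    \int[mu]_(x in `]lo, hi[) (f x * \1_(`]ratr a, ratr c[%classic) x) = 0.
  move=> la ch.
  have c1 : \int[mu]_(x in `]lo, hi[) (f x * rbump lo hi (a, c, n) x) @[n --> \oo]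
     --> \int[mu]_(x in `]lo, hi[) (f x * \1_(`]ratr a, ratr c[%classic) x).
    apply: (intR_cvg_lim mD (g := fun x => `|f x|)).
    - move=> n; apply: measurable_funM; first exact: intble_meas If.
      apply: measurable_funTS; apply: continuous_measurable_fun.
      exact/smooth_continuous/smooth_rbump.
    - move=> x _; rewrite /rbump /= la ch /=; apply: cvgMr; exact: cbump_cvg.
    - exact: intble_norm.
    - by move=> n x _; rewrite normrM ler_piMr// rbump_norm_le1.
  have : \int[mu]_(x in `]lo, hi[) (f x * rbump lo hi (a, c, n) x) @[n --> \oo] --> (0 : R).
    by under eq_fun do rewrite f0; exact: cvg_cst.
  by move=> /(cvg_unique (@Rhausdorff R)) /(_ c1) <-.
have I1 x : lo < x -> x <= hi -> \int[mu]_(t in `]lo, x[) f t = 0.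
  move=> lx xh.
  have exa n : exists a : rat, lo < ratr a < lo + n.+1%:R^-1.
    have h : lo < lo + n.+1%:R^-1 by rewrite ltrDl invr_gt0 ltr0n.
    by have [a] := rat_in_itvoo h; rewrite in_itv /= => ?; exists a.
  have exc n : exists a : rat, x - n.+1%:R^-1 < ratr a < x.
    have h : x - n.+1%:R^-1 < x by rewrite gtrBl invr_gt0 ltr0n.
    by have [a] := rat_in_itvoo h; rewrite in_itv /= => ?; exists a.
  have [a ha] := choice exa; have [c hc] := choice exc.
  have sub : `]lo, x[%classic `<=` `]lo, hi[%classic.
    by move=> t; rewrite /= !in_itv /= => /andP[-> tx]; exact: lt_le_trans tx xh.
  have c1 : \int[mu]_(t in `]lo, hi[) (f t * \1_(`]ratr (a n), ratr (c n)[%classic) t)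
     @[n --> \oo] --> \int[mu]_(t in `]lo, hi[) (f t * \1_(`]lo, x[%classic) t).
    apply: (intR_cvg_lim mD (g := fun x => `|f x|)).
    - move=> n; apply: measurable_funM; first exact: intble_meas If.
      by apply: measurable_indic; exact: measurable_itv.
    - move=> t; rewrite /= in_itv /= => /andP[lt th]; apply: cvgMr.
      apply: cvg_near_cst; rewrite !indicE; have [tx|xt] := ltP t x; last first.
        near=> n; congr (nat_of_bool _)%:R.
        rewrite [RHS]memNset/=; last by rewrite in_itv /= lt (ltNge t x) xt.
        rewrite memNset//= in_itv /=; apply/negP; rewrite negb_and -!leNgt.
        by case/andP: (hc n) => _ /ltW cx; rewrite (le_trans cx xt) orbT.
      near=> n; congr (nat_of_bool _)%:R.
      rewrite [RHS]mem_set/=; last by rewrite in_itv /= lt.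
      rewrite mem_set//= in_itv /=; apply/andP; split.
        case/andP: (ha n) => _ /lt_trans; apply; rewrite -ltrBrDl; near: n.
        have e0 : 0 < (t - lo) / 2 by rewrite divr_gt0// subr_gt0.
        have /cvgrPdist_le /(_ _ e0) := @cvg_harmonic R; apply: filterS => n /=.
        rewrite sub0r normrN ger0_norm// => /le_lt_trans; apply.
        by rewrite ltr_pdivrMr// ltr_pMr ?subr_gt0// ltr1n.
      case/andP: (hc n) => + _; apply: lt_trans; rewrite ltrBrDr -ltrBrDl; near: n.
      have e0 : 0 < (x - t) / 2 by rewrite divr_gt0// subr_gt0.
      have /cvgrPdist_le /(_ _ e0) := @cvg_harmonic R; apply: filterS => n /=.
      rewrite sub0r normrN ger0_norm// => /le_lt_trans; apply.
      by rewrite ltr_pdivrMr// ltr_pMr ?subr_gt0// ltr1n.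
    - exact: intble_norm.
    - move=> n t _; rewrite normrM ler_piMr// indicE.
      by case: (t \in _); rewrite ?normr1 ?normr0.
  have E : \int[mu]_(t in `]lo, hi[) (f t * \1_(`]lo, x[%classic) t) = 0.
    have c2 : \int[mu]_(t in `]lo, hi[) (f t * \1_(`]ratr (a n), ratr (c n)[%classic) t)
       @[n --> \oo] --> (0 : R).
      under eq_fun => n.
        rewrite I0; last 2 first.
        - by case/andP: (ha n).
        - by case/andP: (hc n) => _ /lt_le_trans; apply.
        over.
      exact: cvg_cst.
    by rewrite (cvg_unique (@Rhausdorff R) c1 c2).
  rewrite -E -[in LHS](setIidr sub) Rintegral_mkcondr; apply: intR_eq => t _.
  rewrite patchE indicE; case: ifP => tx; first by rewrite mulr1.
  by rewrite mulr0.
apply: ae_eq0_of_cumulative => // x; have [hx|xh] := leP hi x.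
  have [lh|hl] := ltP lo hi; last first.
    rewrite (_ : _ `&` _ = set0) ?Rintegral_set0// -subset0 => t [_ /=].
    by rewrite in_itv /= => /andP[/lt_trans h /h]; rewrite ltNge hl.
  rewrite setIidr ?I1// => t; rewrite /= !in_itv /= => /andP[_ th].
  exact: ltW (lt_le_trans th hx).
have [lx|xl] := ltP lo x; last first.
  rewrite (_ : _ `&` _ = set0) ?Rintegral_set0// -subset0 => t [] /=.
  rewrite !in_itv /= => tx /andP[lt _].
  by have := lt_le_trans lt (le_trans tx xl); rewrite ltxx.
rewrite (_ : _ `&` _ = `]lo, x]%classic).
  rewrite -Rintegral_itv_bndo_bndc; first exact: I1 _ lx (ltW xh).
  apply: (intbleS _ mD _ If) => //.
  by move=> t; rewrite /= !in_itv /= => /andP[-> tx]; exact: lt_trans tx xh.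
apply/seteqP; split=> y; rewrite /= !in_itv /=.
  by move=> [-> /andP[->]].
by move=> /andP[-> yx]; rewrite yx (le_lt_trans yx xh).
Unshelve. all: by end_near. Qed.

End one_dim.

End determining.

(** * Iterated partial derivatives in three variables *)

Section Ck_theory.
Variable R : realType.
Implicit Types (f g phi : R * R * R -> R) (W : set (R * R * R)).

Lemma Ck_continuous k f : Ck k f -> continuous f.
Proof. by case: k => [|k] []. Qed.

Lemma CkW k f : Ck k.+1 f -> Ck k f.
Proof.
elim: k f => [|k IH] f [cf h]; split=> // i; have [dfi Di] := h i.
by split=> //; exact: IH.
Qed.

Lemma Ck_cst k (a : R) : Ck k (cst a : R * R * R -> R).
Proof.
elim: k a => [|k IH] a; split=> //; try exact: cst_continuous.
move=> i; split; first by move=> x; exact: derivable_cst.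
rewrite (_ : (fun x => _) = cst 0); first exact: IH.
by apply/funext => x; rewrite derive_cst.
Qed.

Lemma CkD k f g : Ck k f -> Ck k g -> Ck k (fun x => f x + g x).
Proof.
elim: k f g => [|k IH] f g [cf hf] [cg hg]; split=> //.
- by move=> x; apply: continuousD; [exact: cf|exact: cg].
- by move=> x; apply: continuousD; [exact: cf|exact: cg].
move=> i; have [dfi Df] := hf i; have [dgi Dg] := hg i; split.
  by move=> x; exact: derivableD.
rewrite (_ : (fun x => _) = fun x => 'D_(evec R i) f x + 'D_(evec R i) g x).
  exact: IH.
by apply/funext => x; exact: (deriveD (dfi x) (dgi x)).
Qed.

Lemma CkM k f g : Ck k f -> Ck k g -> Ck k (fun x => f x * g x).
Proof.
elim: k f g => [|k IH] f g hf hg; have [cf hf'] := hf; have [cg hg'] := hg; split=> //.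
- by move=> x; apply: continuousM; [exact: cf|exact: cg].
- by move=> x; apply: continuousM; [exact: cf|exact: cg].
move=> i; have [dfi Df] := hf' i; have [dgi Dg] := hg' i; split.
  by move=> x; exact: derivableM.
rewrite (_ : (fun x => _) = fun x => f x * 'D_(evec R i) g x + g x * 'D_(evec R i) f x).
  by apply: CkD; apply: IH => //; exact: CkW.
by apply/funext => x; exact: (deriveM (dfi x) (dgi x)).
Qed.

Lemma is_derive_line (V : normedModType R) (f : V -> R) x v (d : R) :
  is_derive (0 : R) (1 : R) (fun h : R => f (h *: v + x)) d -> is_derive x v f d.
Proof.
move=> [df <-]; apply: DeriveDef; first exact/derivable1P.
rewrite /derive; congr (lim (_ @ 0^')); apply/funext => h /=.
by rewrite addr0 scale0r add0r [_%:A]mulr1.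
Qed.

Lemma is_derive_along (V : normedModType R) (f : V -> R) x v : derivable f x v ->
  is_derive (0 : R) (1 : R) (fun h : R => f (h *: v + x)) ('D_v f x).
Proof.
move=> /derivable1P df; apply: DeriveDef; first exact: df.
rewrite /derive; congr (lim (_ @ 0^')); apply/funext => h /=.
by rewrite addr0 scale0r add0r [_%:A]mulr1.
Qed.

Lemma coordD (x y : R * R * R) (i : 'I_3) : Defs.coord (x + y) i = Defs.coord x i + Defs.coord y i :> R.
Proof. by rewrite /Defs.coord; case: (val i) => [|[|?]]. Qed.

Lemma coordZ (a : R) (x : R * R * R) (i : 'I_3) : Defs.coord (a *: x) i = a * Defs.coord x i.
Proof. by rewrite /Defs.coord; case: (val i) => [|[|?]]. Qed.

Lemma coord_evec (i j : 'I_3) : Defs.coord (evec R j) i = (j == i)%:R.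
Proof. by case: i => -[|[|[|//]]] ?; case: j => -[|[|[|//]]] ?. Qed.

Lemma coord_continuous (i : 'I_3) : continuous (fun x : R * R * R => Defs.coord x i).
Proof.
move=> x; rewrite /Defs.coord; case: (val i) => [|[|?]].
- by apply: (@continuous_comp _ _ _ fst fst); exact: cvg_fst.
- by apply: (@continuous_comp _ _ _ fst snd); [exact: cvg_fst|exact: cvg_snd].
- exact: cvg_snd.
Qed.

Lemma is_derive_coord (a : R -> R) (i j : 'I_3) (x : R * R * R) : smooth a ->
  is_derive x (evec R j) (fun x => a (Defs.coord x i)) (derive1 a (Defs.coord x i) * (j == i)%:R).
Proof.
move=> sa; apply: is_derive_line.
rewrite (_ : (fun h => _) = fun h => a ((j == i)%:R * h + Defs.coord x i)); last first.
  by apply/funext => h; rewrite coordD coordZ coord_evec mulrC.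
have := @is_derive1_comp _ a (fun h => (j == i)%:R * h + Defs.coord x i) 0
  (derive1 a (Defs.coord x i)) (j == i)%:R.
rewrite mulr0 add0r; apply; last exact: is_derive_affine.
by rewrite derive1E; apply: derivableP; exact: smooth_derivable.
Qed.

Lemma Ck_coord k (a : R -> R) (i : 'I_3) : smooth a -> Ck k (fun x => a (Defs.coord x i)).
Proof.
elim: k a => [|k IH] a sa.
  split=> // x; apply: (@continuous_comp (R * R * R)%type R R (fun x => Defs.coord x i) a).
    exact: coord_continuous.
  exact: smooth_continuous.
split.
  move=> x; apply: (@continuous_comp (R * R * R)%type R R (fun x => Defs.coord x i) a).
    exact: coord_continuous.
  exact: smooth_continuous.
move=> j; split; first by move=> x; have [] := is_derive_coord i j x sa.
rewrite (_ : (fun x => _) = fun x => derive1 a (Defs.coord x i) * cst (j == i)%:R x).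
  by apply: CkM; [apply: IH; exact: smooth_derive1|exact: Ck_cst].
by apply/funext => x; have [_ ->] := is_derive_coord i j x sa.
Qed.

Lemma shift_e3 (h : R) (x : R * R * R) : (h *: evec R e3 + x).1 = x.1.
Proof.
rewrite [LHS]surjective_pairing [RHS]surjective_pairing; congr (_, _).
  change (Defs.coord (h *: evec R e3 + x) (@Ordinal 3 0 isT) = Defs.coord x (@Ordinal 3 0 isT)).
  by rewrite coordD coordZ coord_evec mulr0 add0r.
change (Defs.coord (h *: evec R e3 + x) (@Ordinal 3 1 isT) = Defs.coord x (@Ordinal 3 1 isT)).
by rewrite coordD coordZ coord_evec mulr0 add0r.
Qed.

Lemma shift_e3E (h t : R) (y : R * R) : h *: evec R e3 + (y, t) = (y, h + t).
Proof.
rewrite [LHS]surjective_pairing shift_e3; congr (_, _).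
change (Defs.coord (h *: evec R e3 + (y, t)) e3 = h + t).
by rewrite coordD coordZ coord_evec eqxx mulr1.
Qed.

Lemma slice_continuous (c : R) :
  continuous (fun x : R * R * R => (x.1, c) : R * R * R).
Proof.
move=> x.
exact: (@cvg_pair _ _ _ (nbhs x) (nbhs x.1) (nbhs c) _ _ _ fst (cst c) cvg_fst (cvg_cst c)).
Qed.

Lemma Ck_slice k phi (c : R) : Ck k phi -> Ck k (fun x => phi (x.1, c)).
Proof.
elim: k phi => [|k IH] phi [cphi h].
  split=> // x; apply: (@continuous_comp (R * R * R)%type (R * R * R)%type R (fun x => (x.1, c)) phi).
    exact: slice_continuous.
  exact: cphi.
split.
  move=> x; apply: (@continuous_comp (R * R * R)%type (R * R * R)%type R (fun x => (x.1, c)) phi).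
    exact: slice_continuous.
  exact: cphi.
move=> i; have [di Di] := h i.
have E x : is_derive x (evec R i) (fun x => phi (x.1, c))
   ('D_(evec R i) phi (x.1, c) * (i != e3)%:R).
  apply: is_derive_line; have [->|ie] := eqVneq i e3.
    rewrite (_ : (fun h => _) = cst (phi (x.1, c))); last first.
      apply/funext => r; congr (phi (_, _)).
      exact: shift_e3.
    by rewrite mulr0; exact: is_derive_cst.
  rewrite mulr1 (_ : (fun h => _) = fun h => phi (h *: evec R i + (x.1, c))); last first.
    apply/funext => r; congr phi; rewrite [RHS]surjective_pairing; congr (_, _).
    change (c = Defs.coord (r *: evec R i + (x.1, c)) e3).
    by rewrite coordD coordZ coord_evec (negbTE ie) mulr0 add0r.
  exact: is_derive_along (di (x.1, c)).
split; first by move=> x; have [] := E x.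
rewrite (_ : (fun x => _) = fun x => 'D_(evec R i) phi (x.1, c) * cst (i != e3)%:R x).
  by apply: CkM; [exact: (IH _ Di)|exact: Ck_cst].
by apply/funext => x; have [_ ->] := E x.
Qed.

Lemma derive_slice_e3 phi (c : R) x : 'D_(evec R e3) (fun x => phi (x.1, c)) x = 0.
Proof.
have : is_derive x (evec R e3) (fun x => phi (x.1, c)) 0; last by move=> [].
apply: is_derive_line.
rewrite (_ : (fun h => _) = cst (phi (x.1, c))); first exact: is_derive_cst.
by apply/funext => r; congr (phi (_, _)); exact: shift_e3.
Qed.

End Ck_theory.

(** * Weak derivatives and traces on a box *)

Section L2_theory.
Variables (d : measure_display) (X : measurableType d) (R : realType).
Variables (mu : {measure set X -> \bar R}) (A : set X).
Hypothesis mA : measurable A.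
Implicit Types f g : X -> R.

Lemma L2_sqr f : L2 mu A f -> intble mu A (fun x => f x ^+ 2).
Proof.
move=> [mf If]; apply/integrableP; split.
  by apply/measurable_EFinP; exact: measurable_funX.
apply: (eq_ind _ (fun z => (z < +oo)%E) If); apply: eq_integral => t _ /=.
by rewrite ger0_norm// sqr_ge0.
Qed.

Lemma L2P f : measurable_fun A f -> intble mu A (fun x => f x ^+ 2) -> L2 mu A f.
Proof.
move=> mf /integrableP[_ If]; split=> //.
apply: (eq_ind _ (fun z => (z < +oo)%E) If); apply: eq_integral => t _ /=.
by rewrite ger0_norm// sqr_ge0.
Qed.

Lemma L2_intbleM f g : L2 mu A f -> L2 mu A g -> intble mu A (fun x => f x * g x).
Proof.
move=> Lf Lg; apply: (@intble_le _ _ _ mu A _ (fun x => f x ^+ 2 + g x ^+ 2)) => //.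
- by apply: measurable_funM; [case: Lf|case: Lg].
- move=> x _; rewrite normrM.
  have := sqr_ge0 (`|f x| - `|g x|); rewrite sqrrB !real_normK ?num_real//.
  have := mulr_ge0 (normr_ge0 (f x)) (normr_ge0 (g x)).
  by rewrite -mulr_natr; lra.
- by apply: intbleD => //; exact: L2_sqr.
Qed.

Lemma subsp_L2 : subsp (L2 mu A : set (X -> R)).
Proof.
split.
  apply: L2P; first exact: measurable_cst.
  by apply: (intble_eq mA _ (integrable0 mu A)) => x _ /=; rewrite expr0n.
move=> a f g Lf Lg; apply: L2P.
  apply: measurable_funD; last by case: Lg.
  by apply: measurable_funM; [exact: measurable_cst|case: Lf].
have : intble mu A (fun x => a ^+ 2 * f x ^+ 2 + 2 * a * (f x * g x) + g x ^+ 2).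
  apply: intbleD; [by []| |exact: L2_sqr]; apply: intbleD; [by []|..].
    by apply: intbleZ => //; exact: L2_sqr.
  by apply: intbleZ => //; exact: L2_intbleM.
by apply: intble_eq => // x _; rewrite !fctE /GRing.scale /=; ring.
Qed.

Lemma inner_L2 : inner_on (L2 mu A : set (X -> R)) (ip mu A).
Proof.
split; first exact: subsp_L2.
- split=> [g Lg a f f' Lf Lf'|f Lf a g g' Lg Lg']; rewrite /ip.
    rewrite -RintegralZl//; last exact: L2_intbleM.
    rewrite -RintegralD//; [|by apply: intbleZ => //; exact: L2_intbleM|exact: L2_intbleM].
    by apply: intR_eq => x _; rewrite !fctE /GRing.scale /=; ring.
  rewrite -RintegralZl//; last exact: L2_intbleM.
  rewrite -RintegralD//; [|by apply: intbleZ => //; exact: L2_intbleM|exact: L2_intbleM].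
  by apply: intR_eq => x _; rewrite !fctE /GRing.scale /=; ring.
- by move=> f g _ _; apply: intR_eq => x _; rewrite mulrC.
- by move=> f _; apply: Rintegral_ge0 => x _; rewrite -expr2 sqr_ge0.
Qed.

Lemma ip_eq0 f : L2 mu A f -> ip mu A f f = 0 -> ae_eq mu A f (cst 0).
Proof.
move=> Lf f0; have If := L2_intbleM Lf Lf.
have : ae_eq mu A (fun x => f x * f x) (cst 0).
  by apply: intR_ge0_eq0 => //; [move=> x _; rewrite -expr2 sqr_ge0|rewrite -f0].
apply: aeS => x h Ax; have /eqP := h Ax.
by rewrite mulf_eq0 orbb => /eqP.
Qed.

Lemma ip_ael f f' g : L2 mu A f -> L2 mu A f' -> L2 mu A g -> ae_eq mu A f f' ->
  ip mu A f g = ip mu A f' g.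
Proof.
move=> Lf Lf' Lg ff'; apply: intR_ae_eq => //; first exact: L2_intbleM.
  exact: intble_meas (L2_intbleM Lf' Lg).
by apply: aeS ff' => x h Ax; rewrite h.
Qed.

Lemma L2_bounded f (M : R) : (mu A < +oo)%E -> measurable_fun A f ->
  (forall x, A x -> `|f x| <= M) -> L2 mu A f.
Proof.
move=> fA mf fM; apply: L2P => //.
apply: (@intble_le _ _ _ mu A _ (cst (M ^+ 2))) => //; last exact: intble_cst.
  exact: measurable_funX.
move=> x Ax; rewrite /= ger0_norm ?sqr_ge0// -real_normK ?num_real//.
by rewrite lerXn2r ?nnegrE ?fM// (le_trans (normr_ge0 (f x)))// fM.
Qed.

Lemma L2_intble f : (mu A < +oo)%E -> L2 mu A f -> intble mu A f.
Proof.
move=> fA Lf.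
have L1 : L2 mu A (cst 1) by apply: (@L2_bounded _ 1) => // x _; rewrite normr1.
by have := L2_intbleM Lf L1; apply: intble_eq => // x _; rewrite mulr1.
Qed.

Lemma ip_sub_ae f g : L2 mu A f -> L2 mu A g -> ip mu A (f - g) (f - g) = 0 ->
  ae_eq mu A f g.
Proof.
move=> Lf Lg /ip_eq0 h; have := h (subspB subsp_L2 Lf Lg).
by apply: aeS => x hx Ax; have /eqP := hx Ax; rewrite !fctE subr_eq0 => /eqP.
Qed.

End L2_theory.

Section testfun_theory.
Variable R : realType.
Local Notation R3 := (R * R * R)%type.
Local Notation mR := (measurableTypeR R).
Implicit Types (phi psi g : R3 -> R) (W K : set R3).

Lemma supp_out phi x : ~ supp phi x -> phi x = 0.
Proof.
move=> nx; apply: contrapT => /eqP px; apply: nx.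
exact: subset_closure.
Qed.

Lemma supp_sub phi K : closed K -> (forall x, phi x != 0 -> K x) -> supp phi `<=` K.
Proof.
move=> cK pK; rewrite [X in _ `<=` X]((closure_id K).1 cK).
exact: closureS.
Qed.

Lemma testfunI W phi K : (forall k, Ck k phi) -> compact K -> K `<=` W ->
  (forall x, phi x != 0 -> K x) -> testfun W phi.
Proof.
move=> Cphi cK KW pK.
have cl : closed K.
  by apply: compact_closed => //; exact: norm_hausdorff.
have sK := supp_sub cl pK.
split=> //; first exact: (subclosed_compact (@closed_closure _ _) cK sK).
exact: subset_trans KW.
Qed.

Lemma derive_supp_out phi i x : ~ supp phi x -> 'D_(evec R i) phi x = 0.
Proof.
move=> nx; rewrite -[RHS](derive_cst (0 : R) x (evec R i)).
apply: near_eq_derive.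
have : nbhs x (~` supp phi).
  apply: open_nbhs_nbhs; split=> //; apply: closed_openC; exact: closed_closure.
by apply: filterS => y ny; exact: supp_out.
Qed.

Lemma testfun_derive W phi i : testfun W phi -> testfun W (fun x => 'D_(evec R i) phi x).
Proof.
move=> [Cphi cs sW]; apply: (testfunI _ cs sW) => [k|x].
  by have [_ /(_ i) []] := Cphi k.+1.
by move=> /eqP h; apply: contrapT => /(derive_supp_out i).
Qed.

Lemma testfun_bounded W phi : testfun W phi -> exists2 M, 0 <= M &
  forall x, `|phi x| <= M.
Proof.
move=> [Cphi cs sW].
have cphi : continuous phi := Ck_continuous (Cphi 0%N).
have ci : compact (phi @` supp phi).
  by apply: continuous_compact => //; exact: continuous_subspaceT.
have [M [_ hM]] := compact_bounded ci.
exists (`|M| + 1); first by rewrite addr_ge0.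
move=> x; have [sx|nx] := pselect (supp phi x); last first.
  by rewrite (supp_out nx) normr0 addr_ge0.
by apply: hM; [rewrite ltr_pwDr// ler_norm|exists x].
Qed.

Lemma testfun_measurable W phi : testfun W phi ->
  measurable_fun setT (phi : mR * mR * mR -> mR).
Proof. by move=> [Cphi _ _]; apply: continuous_measurable3; exact: Ck_continuous (Cphi 0%N). Qed.

End testfun_theory.

Section box_measure.
Variable R : realType.
Local Notation mR := (measurableTypeR R).
Variable B : box R.

Let i0 : 'I_3 := @Ordinal 3 0 isT.
Let i1 : 'I_3 := @Ordinal 3 1 isT.
Local Notation D j := (`]lo B j, hi B j[%classic : set mR).

Lemma ord3_cases (P : 'I_3 -> Prop) : P i0 -> P i1 -> P e3 -> forall i, P i.
Proof.
move=> p0 p1 p2 [[|[|[|//]]] h].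
- by rewrite (_ : Ordinal h = i0)//; exact: val_inj.
- by rewrite (_ : Ordinal h = i1)//; exact: val_inj.
- by rewrite (_ : Ordinal h = e3)//; exact: val_inj.
Qed.

Lemma face_domE : face_dom B e3 = D i0 `*` D i1.
Proof.
apply/seteqP; split=> [[y1 y2] h|[y1 y2] [/= h1 h2]].
  by split; rewrite /= in_itv /=; [exact: (h i0)|exact: (h i1)].
by apply: ord3_cases => //= _; move: h1 h2; rewrite !in_itv.
Qed.

Lemma insideE : inside B = face_dom B e3 `*` D e3.
Proof.
rewrite face_domE; apply/seteqP; split=> [[[y1 y2] y3] h|[[y1 y2] y3] [[/= h1 h2] h3]].
  by split; [split|]; rewrite /= in_itv /=; [exact: (h i0)|exact: (h i1)|exact: (h e3)].
by apply: ord3_cases; move: h1 h2 h3; rewrite /= !in_itv.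
Qed.

Lemma measurable_face_dom : measurable (face_dom B e3 : set (mR * mR)).
Proof. by rewrite face_domE; apply: measurableX; exact: measurable_itv. Qed.

Lemma measurable_inside : measurable (inside B : set (mR * mR * mR)).
Proof.
rewrite insideE; apply: measurableX; first exact: measurable_face_dom.
exact: measurable_itv.
Qed.

Lemma itv_fin j : (@lebesgue_measure R (D j) < +oo)%E.
Proof. by rewrite lebesgue_measure_itv /=; case: ifP => // _; rewrite -EFinD ltry. Qed.

Lemma face_fin : (leb2 R (face_dom B e3) < +oo)%E.
Proof.
rewrite face_domE.
have -> : leb2 R (D i0 `*` D i1) =
    (@lebesgue_measure R (D i0) * @lebesgue_measure R (D i1))%E.
  by apply: product_measure1E; exact: measurable_itv.
by rewrite lte_mul_pinfty ?itv_fin ?measure_ge0// ge0_fin_numE ?itv_fin ?measure_ge0.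
Qed.

Lemma inside_fin : (leb3 R (inside B) < +oo)%E.
Proof.
rewrite insideE.
have -> : leb3 R (face_dom B e3 `*` D e3) =
    (leb2 R (face_dom B e3) * @lebesgue_measure R (D e3))%E.
  by apply: product_measure1E; [exact: measurable_face_dom|exact: measurable_itv].
by rewrite lte_mul_pinfty ?itv_fin ?face_fin ?measure_ge0// ge0_fin_numE ?face_fin ?measure_ge0.
Qed.

Lemma testfun_L2box W phi : testfun W phi -> L2box B phi.
Proof.
move=> tphi; have [M M0 hM] := testfun_bounded tphi.
apply: (@L2_bounded _ _ _ _ _ _ _ M) => //.
- exact: measurable_inside.
- exact: inside_fin.
- by apply: measurable_funTS; exact: (testfun_measurable tphi).
Qed.

End box_measure.

(** * The fundamental lemma of the calculus of variations on a box and on its horizontal faces *)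

Section fundamental_lemma.
Variable R : realType.
Local Notation mR := (measurableTypeR R).
Local Notation R3 := (R * R * R)%type.
Variable B : box R.
Local Notation i0 := (@Ordinal 3 0 isT).
Local Notation i1 := (@Ordinal 3 1 isT).
Local Notation K1 := (rat * rat * nat)%type.
Local Notation D j := (`]lo B j, hi B j[%classic : set mR).

Definition fbump (k : K1 * K1) (y : R * R) : R :=
  rbump (lo B i0) (hi B i0) k.1 y.1 * rbump (lo B i1) (hi B i1) k.2 y.2.

Definition pbump (k : K1 * K1 * K1) (x : R3) : R :=
  fbump k.1 x.1 * rbump (lo B e3) (hi B e3) k.2 x.2.

Lemma determining_fbump : determining (leb2 R) (face_dom B e3) fbump.
Proof.
rewrite face_domE; apply: determining_prod; rewrite //=; try exact: measurable_itv.
  exact: determining_rbump.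
exact: determining_rbump.
Qed.

Lemma determining_pbump : determining (leb3 R) (inside B) pbump.
Proof.
rewrite insideE; apply: (determining_prod (m1 := leb2s R)).
- exact: measurable_face_dom.
- exact: measurable_itv.
- exact: determining_fbump.
- exact: determining_rbump.
Qed.

Lemma rbump_neq0 l h (k : K1) (t : R) : rbump l h k t != 0 ->
  [/\ l < ratr k.1.1, ratr k.1.1 <= t, t <= ratr k.1.2 & ratr k.1.2 < h].
Proof.
rewrite /rbump; case: ifP => [/andP[lk kh]|_]; last by rewrite eqxx.
move=> h0; have : (ratr k.1.1 < t < ratr k.1.2 :> bool).
  by apply: contraNT h0 => /cbump_out ->.
by move=> /andP[/ltW ? /ltW ?].
Qed.

Lemma compact_Kbox (a1 c1 a2 c2 a3 c3 : R) :
  compact ((`[a1, c1] `*` `[a2, c2]) `*` `[a3, c3] : set R3).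
Proof.
by apply: compact_setX; [apply: compact_setX|]; exact: segment_compact.
Qed.

Lemma Ck_fst k (a : R -> R) : smooth a -> Ck k (fun x : R3 => a x.1.1).
Proof. exact: (@Ck_coord R k a i0). Qed.

Lemma Ck_mid k (a : R -> R) : smooth a -> Ck k (fun x : R3 => a x.1.2).
Proof. exact: (@Ck_coord R k a i1). Qed.

Lemma Ck_last k (a : R -> R) : smooth a -> Ck k (fun x : R3 => a x.2).
Proof. exact: (@Ck_coord R k a e3). Qed.

Lemma Ck_fbump n k (a : R -> R) : smooth a -> Ck n (fun x : R3 => fbump k x.1 * a x.2).
Proof.
move=> sa; apply: CkM; last exact: Ck_last.
by apply: CkM; [apply: Ck_fst|apply: Ck_mid]; exact: smooth_rbump.
Qed.

Lemma testfun_fbump W k (a : R -> R) (l h : R) : smooth a ->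
  (forall t, a t != 0 -> l <= t <= h) ->
  (face_dom B e3 `*` `[l, h]%classic `<=` W) ->
  testfun W (fun x : R3 => fbump k x.1 * a x.2).
Proof.
move=> sa a0 sW.
pose K : set R3 := (`[ratr k.1.1.1, ratr k.1.1.2] `*` `[ratr k.2.1.1, ratr k.2.1.2])
   `*` `[l, h].
have nz x : fbump k x.1 * a x.2 != 0 ->
    [/\ lo B i0 < ratr k.1.1.1, ratr k.1.1.2 < hi B i0,
        lo B i1 < ratr k.2.1.1, ratr k.2.1.2 < hi B i1 & K x].
  rewrite /fbump !mulf_eq0 !negb_or => /andP[/andP[]].
  move=> /rbump_neq0[h1 h2 h3 h4] /rbump_neq0[h5 h6 h7 h8] /a0 h9.
  by split=> //; split; [split|]; rewrite /= in_itv /= ?h2 ?h3 ?h6 ?h7.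
(* The rational endpoints are known to lie inside the box only if the function is nonzero somewhere;
   otherwise its support is empty. *)
have [[x0 nz0]|none] := pselect (exists x, fbump k x.1 * a x.2 != 0).
  have [h1 h2 h3 h4 _] := nz _ nz0.
  apply: (@testfunI _ _ _ K).
  - by move=> n; exact: Ck_fbump.
  - exact: compact_Kbox.
  - move=> x [[/= x1 x2] x3]; apply: sW; split=> //; rewrite face_domE.
    move: x1 x2; rewrite /= !in_itv /= => /andP[x11 x12] /andP[x21 x22].
    split; rewrite /= ?in_itv /=.
      by rewrite (lt_le_trans h1)// (le_lt_trans x12).
    by rewrite (lt_le_trans h3)// (le_lt_trans x22).
  - by move=> x /nz[].
apply: (@testfunI _ _ _ set0) => //.
- by move=> n; exact: Ck_fbump.
- exact: compact0.
- by move=> x hx; apply: none; exists x.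
Qed.

Lemma testfun_pbump k : testfun (inside B) (pbump k).
Proof.
have [h|h] := boolP ((lo B e3 < ratr k.2.1.1) && (ratr k.2.1.2 < hi B e3)); last first.
  rewrite (_ : pbump k = fun x => fbump k.1 x.1 * cst 0 x.2); last first.
    by apply/funext => x; rewrite /pbump /rbump (negbTE h).
  (* The function is zero, and [1, 0] is an empty interval. *)
  apply: (@testfun_fbump _ _ _ 1 0); first exact: smooth_cst.
    by move=> t; rewrite eqxx.
  move=> x [_] /=; rewrite in_itv /= => /andP[h1 h2].
  by have := le_trans h1 h2; rewrite ler10.
case/andP: h => h1 h2.
apply: (@testfun_fbump _ _ _ (ratr k.2.1.1) (ratr k.2.1.2)); first exact: smooth_rbump.
  by move=> t /rbump_neq0[_ -> -> _].
rewrite insideE => x [x1 x2]; split=> //.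
move: x2; rewrite /= !in_itv /= => /andP[x21 x22].
by rewrite (lt_le_trans h1)// (le_lt_trans x22).
Qed.

Lemma L2box_eq0 f : L2box B f -> (forall k, ipbox B f (pbump k) = 0) ->
  ae_eq (leb3 R) (inside B) f (cst 0).
Proof.
move=> Lf f0; have [_ _ h] := determining_pbump; apply: h => //.
by apply: L2_intble => //; [exact: measurable_inside|exact: inside_fin].
Qed.

Lemma L2face_eq0 g : L2 (leb2 R) (face_dom B e3) g ->
  (forall k, ip (leb2 R) (face_dom B e3) g (fbump k) = 0) ->
  ae_eq (leb2 R) (face_dom B e3) g (cst 0).
Proof.
move=> Lg g0; have [_ _ h] := determining_fbump; apply: h => //.
by apply: L2_intble => //; [exact: measurable_face_dom|exact: face_fin].
Qed.

End fundamental_lemma.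

Section weak_partial.
Variable R : realType.
Local Notation R3 := (R * R * R)%type.
Variable B : box R.
Implicit Types f g : R3 -> R.

Lemma inner_box : inner_on (L2box B : set (R3 -> R)) (ipbox B).
Proof. exact: (inner_L2 (leb3 R) (measurable_inside B)). Qed.

Lemma subsp_L2box : subsp (L2box B : set (R3 -> R)).
Proof. exact: inner_subsp inner_box. Qed.

Lemma ipbox_linl h : L2box B h -> lin_on (L2box B) (fun f => ipbox B f h).
Proof. exact: (inner_bilin inner_box).1. Qed.

Lemma ipbox_linr h : L2box B h -> lin_on (L2box B) (ipbox B h).
Proof. exact: (inner_bilin inner_box).2. Qed.

Lemma ipbox_ael f f' h : L2box B f -> L2box B f' -> L2box B h ->
  ae_eq (leb3 R) (inside B) f f' -> ipbox B f h = ipbox B f' h.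
Proof. exact: (ip_ael (measurable_inside B)). Qed.

Lemma ipboxC f g : ipbox B f g = ipbox B g f.
Proof. by apply: intR_eq => x _; rewrite mulrC. Qed.

Lemma ae_eq_sub f g : ae_eq (leb3 R) (inside B) (f - g) (cst 0) ->
  ae_eq (leb3 R) (inside B) f g.
Proof. by apply: aeS => x h Dx; have /eqP := h Dx; rewrite !fctE subr_eq0 => /eqP. Qed.

Lemma L2box_ext f g : L2box B f -> L2box B g ->
  (forall phi, testfun (inside B) phi -> ipbox B f phi = ipbox B g phi) ->
  ae_eq (leb3 R) (inside B) f g.
Proof.
move=> Lf Lg fg; apply: ae_eq_sub; apply: L2box_eq0.
  exact: (subspB subsp_L2box).
move=> k; have tk := testfun_pbump B k.
by rewrite (linB (ipbox_linl (testfun_L2box B tk)))// fg// subrr.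
Qed.

Lemma partialP i f : H1 B f -> is_weak_partial B i f (partial B i f).
Proof. by move=> [_ /(_ i) [g hg]]; rewrite /partial; apply: (xgetPex _ (ex_intro _ g hg)). Qed.

Lemma L2box_partial i f : H1 B f -> L2box B (partial B i f).
Proof. by move=> /(partialP i)[]. Qed.

Lemma weak_partial_unique i f g g' : is_weak_partial B i f g ->
  is_weak_partial B i f g' -> ae_eq (leb3 R) (inside B) g g'.
Proof.
move=> [Lg hg] [Lg' hg']; apply: L2box_ext => // phi tphi.
by apply: oppr_inj; rewrite -hg// -hg'.
Qed.

Lemma is_weak_partial_lin i (a : R) f f' g g' : L2box B f -> L2box B f' ->
  is_weak_partial B i f g -> is_weak_partial B i f' g' ->
  is_weak_partial B i (a *: f + f') (a *: g + g').
Proof.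
move=> Lf Lf' [Lg hg] [Lg' hg']; split; first exact: (subsp_L2box).2.
move=> phi tphi; have Lp := testfun_L2box B tphi.
have LD := testfun_L2box B (testfun_derive i tphi).
by rewrite (ipbox_linl LD)// (ipbox_linl Lp)// hg// hg'//; ring.
Qed.

Lemma subsp_H1 : subsp (H1 B : set (R3 -> R)).
Proof.
split.
  split; first exact: (subsp0 subsp_L2box).
  move=> i; exists 0; split; first exact: (subsp0 subsp_L2box).
  move=> phi tphi; rewrite (lin0 subsp_L2box (ipbox_linl (testfun_L2box B tphi))).
  by rewrite (lin0 subsp_L2box (ipbox_linl (testfun_L2box B (testfun_derive i tphi)))) oppr0.
move=> a f f' [Lf hf] [Lf' hf']; split; first exact: (subsp_L2box).2.
move=> i; have [g hg] := hf i; have [g' hg'] := hf' i.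
by exists (a *: g + g'); exact: is_weak_partial_lin.
Qed.

Lemma partial_lin i (a : R) f f' : H1 B f -> H1 B f' ->
  ae_eq (leb3 R) (inside B) (partial B i (a *: f + f'))
    (a *: partial B i f + partial B i f').
Proof.
move=> Hf Hf'; apply: (@weak_partial_unique i (a *: f + f')).
  exact/partialP/(subsp_H1).2.
apply: is_weak_partial_lin; [by case: Hf|by case: Hf'|exact: partialP|exact: partialP].
Qed.

Lemma ip_partial_lin i h : L2box B h -> lin_on (H1 B) (fun f => ipbox B (partial B i f) h).
Proof.
move=> Lh a f f' Hf Hf'.
have HH := (subsp_H1).2 a _ _ Hf Hf'.
rewrite -(ipbox_linl Lh); [|exact: L2box_partial|exact: L2box_partial].
apply: ipbox_ael => //; last exact: partial_lin.
  exact: L2box_partial.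
by apply: (subsp_L2box).2; exact: L2box_partial.
Qed.

End weak_partial.

(** * Linearity and uniqueness of traces *)

Section trace_linear.
Variable R : realType.
Local Notation mR := (measurableTypeR R).
Local Notation R3 := (R * R * R)%type.
Variable B : box R.
Implicit Types f : R3 -> R.

Lemma face_dom_prod i : exists j k, face_dom B i =
  (`]lo B j, hi B j[ `*` `]lo B k, hi B k[)%classic.
Proof.
elim/ord3_cases: i.
- exists (@Ordinal 3 1 isT), e3; apply/seteqP; split=> [[y1 y2] h|[y1 y2] [/= h1 h2]].
    by split; rewrite /= in_itv /=; [exact: (h (@Ordinal 3 1 isT))|exact: (h e3)].
  by apply: ord3_cases => //= _; move: h1 h2; rewrite !in_itv.
- exists (@Ordinal 3 0 isT), e3; apply/seteqP; split=> [[y1 y2] h|[y1 y2] [/= h1 h2]].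
    by split; rewrite /= in_itv /=; [exact: (h (@Ordinal 3 0 isT))|exact: (h e3)].
  by apply: ord3_cases => //= _; move: h1 h2; rewrite !in_itv.
- by exists (@Ordinal 3 0 isT), (@Ordinal 3 1 isT); exact: face_domE.
Qed.

Lemma measurable_face i : measurable (face_dom B i : set (mR * mR)).
Proof.
have [j [k ->]] := face_dom_prod i; apply: measurableX; exact: measurable_itv.
Qed.

Lemma face_finite i : (leb2 R (face_dom B i) < +oo)%E.
Proof.
have [j [k ->]] := face_dom_prod i.
have -> : leb2 R (`]lo B j, hi B j[ `*` `]lo B k, hi B k[)%classic =
    (@lebesgue_measure R `]lo B j, hi B j[%classic *
     @lebesgue_measure R `]lo B k, hi B k[%classic)%E.
  by apply: product_measure1E; exact: measurable_itv.
by rewrite lte_mul_pinfty ?itv_fin ?measure_ge0// ge0_fin_numE ?itv_fin ?measure_ge0.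
Qed.

Lemma emb_continuous i (c : R) : continuous (emb i c).
Proof.
elim/ord3_cases: i => -[y1 y2] /=; rewrite /emb /=.
- have h1 : (fun y : R * R => (c, y.1)) @ nbhs (y1, y2) --> (nbhs c, nbhs y1).
    exact: (cvg_pair (cvg_cst c) cvg_fst).
  exact: (cvg_pair h1 cvg_snd).
- have h1 : (fun y : R * R => (y.1, c)) @ nbhs (y1, y2) --> (nbhs y1, nbhs c).
    exact: (cvg_pair cvg_fst (cvg_cst c)).
  exact: (cvg_pair h1 cvg_snd).
- have h1 : (fun y : R * R => (y.1, y.2)) @ nbhs (y1, y2) --> (nbhs y1, nbhs y2).
    exact: (cvg_pair cvg_fst cvg_snd).
  exact: (cvg_pair h1 (cvg_cst c)).
Qed.

Lemma L2face_testfun W i c phi : testfun W phi ->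
  L2 (leb2 R) (face_dom B i) (fun y => phi (emb i c y)).
Proof.
move=> tphi; have [M M0 hM] := testfun_bounded tphi.
apply: (@L2_bounded _ _ _ _ _ _ _ M) => //.
- exact: measurable_face.
- exact: face_finite.
- apply: measurable_funTS; apply: continuous_measurable2 => y.
  apply: (@continuous_comp _ _ _ (emb i c) phi); first exact: emb_continuous.
  by case: tphi => /(_ 0%N) /Ck_continuous cphi _ _; exact: cphi.
Qed.

Lemma inner_face i : inner_on (L2 (leb2 R) (face_dom B i) : set (R * R -> R))
  (ip (leb2 R) (face_dom B i)).
Proof. exact: (inner_L2 (leb2 R) (measurable_face i)). Qed.

Lemma lin_comb_eq (a x x' y y' c z z' : R) :
  x + y = c * z -> x' + y' = c * z' ->
  a * x + x' + (a * y + y') = c * (a * z + z').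
Proof. by rewrite mulrDr mulrCA => <- <-; ring. Qed.

Lemma is_trace_lin i s (a : R) f f' g g' : H1 B f -> H1 B f' ->
  is_trace B i s f g -> is_trace B i s f' g' ->
  is_trace B i s (a *: f + f') (a *: g + g').
Proof.
move=> Hf Hf' [Lg hg] [Lg' hg'].
split; first exact: (inner_subsp (inner_face i)).2.
move=> phi tphi; have LD := testfun_L2box B (testfun_derive i tphi).
have Lp := testfun_L2box B tphi.
have Lp' := L2face_testfun i (face_pos B i s) tphi.
rewrite (ipbox_linl LD a Hf.1 Hf'.1).
have -> : ipbox B (partial B i (a *: f + f')) phi =
    a * ipbox B (partial B i f) phi + ipbox B (partial B i f') phi.
  exact: (ip_partial_lin i Lp a Hf Hf').
rewrite ((inner_bilin (inner_face i)).1 _ Lp' a g g' Lg Lg').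
exact: lin_comb_eq (hg _ tphi) (hg' _ tphi).
Qed.

Lemma is_trace0 i s : is_trace B i s 0 0.
Proof.
split; first exact: (subsp0 (inner_subsp (inner_face i))).
move=> phi tphi; have LD := testfun_L2box B (testfun_derive i tphi).
have Lp := testfun_L2box B tphi.
have Lp' := L2face_testfun i (face_pos B i s) tphi.
rewrite (lin0 (subsp_L2box B) (ipbox_linl LD)).
rewrite (lin0 (subsp_H1 B) (ip_partial_lin i Lp)).
by rewrite (lin0 (inner_subsp (inner_face i)) ((inner_bilin (inner_face i)).1 _ Lp')) mulr0 addr0.
Qed.

Hypothesis lh : lo B e3 < hi B e3.

Lemma is_trace_unique s f g g' : is_trace B e3 s f g -> is_trace B e3 s f g' ->
  ae_eq (leb2 R) (face_dom B e3) g g'.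
Proof.
move=> [Lg hg] [Lg' hg'].
have sF := inner_subsp (inner_face e3).
have : ae_eq (leb2 R) (face_dom B e3) (g - g') (cst 0).
  apply: L2face_eq0; first exact: subspB.
  move=> k.
  (* With half the thickness of the box as its half-width, the bump centred at the face keeps away
     from the opposite face. On the face itself the test function is [fbump B k] times the nonzero
     constant a(p). *)
  pose w := (hi B e3 - lo B e3) / 2.
  have w0 : 0 < w by rewrite divr_gt0// subr_gt0.
  pose p := face_pos B e3 s.
  pose a := cbump (p - w) (p + w) 0.
  have ap : a p != 0.
    rewrite /a /cbump !mul1r /flat.
    have -> : p + - (p - w) = w by rewrite opprB addrC subrK.
    have -> : - 1 * p + (p + w) = w by rewrite mulN1r addKr.
    rewrite w0.
    by rewrite !hornerC !mul1r mulf_neq0 ?expR_eq0 ?gt_eqF ?expR_gt0.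
  have ta : testfun (half_slab B e3 s) (fun x => fbump B k x.1 * a x.2).
    apply: (@testfun_fbump _ _ _ _ _ (p - w) (p + w)); first exact: smooth_cbump.
      move=> t; apply: contraNT => ht; apply/eqP/cbump_out.
      by apply: contra ht => /andP[/ltW -> /ltW ->].
    move=> x [x1] /=; rewrite in_itv /= => /andP[x2 x3]; split.
      move=> j je; have := x1 j je; rewrite /emb /Defs.coord /=.
      by elim/ord3_cases: j je => //=.
    rewrite /Defs.coord /=; move: x2 x3 lh; rewrite /p /face_pos /w /e3 /=.
    by case: (s) => /= ? ? ?; lra.
  have := hg _ ta; rewrite (hg' _ ta) => /mulfI.
  have -> : (if s then 1 else -1 : R) != 0 by case: (s); rewrite ?oner_neq0 ?oppr_eq0 ?oner_neq0.
  move=> /(_ isT) E.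
  have Lk : L2 (leb2 R) (face_dom B e3) (fbump B k).
    have [mk k1 _] := determining_fbump B.
    apply: (@L2_bounded _ _ _ _ _ _ _ 1) => //; [exact: measurable_face|exact: face_finite|].
    by move=> x Dx; exact: k1.
  have E1 g1 : L2 (leb2 R) (face_dom B e3) g1 ->
    ip (leb2 R) (face_dom B e3) g1 (fun y => fbump B k (emb e3 p y).1 * a (emb e3 p y).2) =
    a p * ip (leb2 R) (face_dom B e3) g1 (fbump B k).
    move=> Lg1; rewrite /ip -RintegralZl; [|exact: measurable_face|].
      by apply: intR_eq => -[y1 y2] _; rewrite /emb /=; ring.
    by apply: (L2_intbleM _ Lg1 Lk); exact: measurable_face.
  rewrite (linB ((inner_bilin (inner_face e3)).1 _ Lk))//.
  move: E; rewrite !E1// => /(mulfI ap) ->; exact: subrr.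
by apply: aeS => x h Dx; have /eqP := h Dx; rewrite !fctE subr_eq0 => /eqP.
Qed.

End trace_linear.

Lemma sqr_add_le (R : realDomainType) (x y : R) : (x + y) ^+ 2 <= 2 * (x ^+ 2 + y ^+ 2).
Proof. by have := sqr_ge0 (x - y); nra. Qed.

(** The bound holds off a null set only, so integrability is read off the truncation min(f, k),
    which agrees with [f] almost everywhere. *)
Lemma intble_ae_le d (X : measurableType d) (R : realType)
    (mu : {measure set X -> \bar R}) (D : set X) (f k : X -> R) : measurable D ->
  measurable_fun D f -> (forall x, D x -> 0 <= f x) -> intble mu D k ->
  {ae mu, forall x, D x -> f x <= k x} -> intble mu D f.
Proof.
move=> mD mf f0 Ik fk.
pose f' x := Num.min (f x) (k x).
have mf' : measurable_fun D f' by apply: measurable_minr => //; exact: intble_meas Ik.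
have If' : intble mu D f'.
  apply: (@intble_le _ _ _ mu D _ (fun x => `|k x|) mD mf' _ (intble_norm mD Ik)).
  move=> x Dx; rewrite /f'; case: (leP (f x) (k x)) => // h.
  by rewrite ger0_norm ?f0// (le_trans h) ?ler_norm.
have ff' : ae_eq mu D f' f by apply: aeS fk => x h Dx; rewrite /f' min_l// h.
apply/integrableP; split; first exact/measurable_EFinP.
have /integrableP[_] := If'; apply: le_lt_trans.
rewrite le_eqVlt; apply/orP; left; apply/eqP; apply: ae_eq_integral => //.
- by do 2 apply: measurableT_comp => //.
- by do 2 apply: measurableT_comp => //.
- by apply: aeS ff' => x h Dx /=; rewrite h.
Qed.

Section flat_extra.
Variable R : realType.
Implicit Types P : {poly R}.

Lemma flat_bounded P : exists2 C, 0 <= C & forall x : R, `|flat P x| <= C.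
Proof.
have [C C0 hC] := horner_le_expR P.
exists C => // x; rewrite /flat; case: ifPn => x0; last by rewrite normr0.
have y0 : 0 <= x^-1 by rewrite invr_ge0 ltW.
rewrite normrM (gtr0_norm (expR_gt0 _)) expRN.
by rewrite ler_pdivrMr ?expR_gt0// hC.
Qed.

(** The argument tends to infinity, where exp(-1/x) tends to 1 and P(1/x) to P(0). The shift by 1
    makes the function vanish for x <= 1/(n+1), that is, near the face in the application to
    cut-offs. *)
Lemma flat_cvg P (x : R) : 0 < x ->
  flat P (n.+1%:R * x - 1) @[n --> \oo] --> P.[0].
Proof.
move=> x0; pose y n : R := n.+1%:R^-1 * (x - n.+1%:R^-1)^-1.
have y0 : y n @[n --> \oo] --> (0 : R).
  rewrite -[X in _ --> X](mul0r (x - 0)^-1); apply: cvgM; first exact: cvg_harmonic.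
  apply: cvgV; first by rewrite subr0 gt_eqF.
  by apply: cvgB; [exact: cvg_cst|exact: cvg_harmonic].
have c : P.[y n] * expR (- y n) @[n --> \oo] --> P.[0] * expR (- 0).
  apply: cvgM; first exact: (continuous_cvg _ (@continuous_horner R P 0) y0).
  by apply: (continuous_cvg _ (@continuous_expR R (- 0))); exact: cvgN.
rewrite oppr0 expR0 mulr1 in c; apply: cvg_trans c; apply: near_eq_cvg.
have /cvgrPdist_lt /(_ _ x0) := @cvg_harmonic R; apply: filterS => n /=.
rewrite sub0r normrN ger0_norm// => nx.
have n0 : 0 < n.+1%:R :> R by rewrite ltr0n.
have -> : n.+1%:R * x - 1 = n.+1%:R * (x - n.+1%:R^-1).
  by rewrite mulrBr divff// gt_eqF.
by rewrite /flat pmulr_rgt0// subr_gt0 nx invfM.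
Qed.

End flat_extra.

(** * Existence of traces on the two faces normal to e_3 *)

Section trace_exists.
Variable R : realType.
Local Notation mR := (measurableTypeR R).
Local Notation R3 := (R * R * R)%type.
Local Notation mu := (@lebesgue_measure R).
Variables (B : box R) (s : bool).
Hypothesis lh : lo B e3 < hi B e3.
Implicit Types (f phi : R3 -> R).
Local Notation l := (lo B e3).
Local Notation h := (hi B e3).
Local Notation p := (face_pos B e3 s).
Let sg : R := if s then 1 else -1.
Let m : R := (l + h) / 2.

(* eta is 1 on the face {x_3 = p} and vanishes on the other half of the box;
   theta n vanishes near {x_3 = p} and tends to 1 inside the box *)
Let eta (z : R) : R := flat 1 (sg * z + - (sg * m)) * (flat 1 ((h - l) / 2))^-1.
Let theta n (z : R) : R := flat 1 ((- (sg * n.+1%:R)) * z + (sg * n.+1%:R * p - 1)).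
(** For points of the box, this is the distance to the face {x_3 = p}. *)
Let delta (z : R) : R := sg * (p - z).

Let sg2 : sg * sg = 1. Proof. by rewrite /sg; case: s; rewrite ?mulr1 ?mulrNN ?mulr1. Qed.

Let sgsq : sg ^+ 2 = 1. Proof. by rewrite expr2 sg2. Qed.

Let delta_gt0 z : l < z < h -> 0 < delta z.
Proof. by rewrite /delta /sg /face_pos; case: s => /andP[? ?]; lra. Qed.

Let smooth_eta : smooth eta.
Proof. by apply: smoothM; [apply: smooth_affine; exact: smooth_flat|exact: smooth_cst]. Qed.

Let smooth_theta n : smooth (theta n).
Proof. by apply: smooth_affine; exact: smooth_flat. Qed.

Let eta_p : eta p = 1.
Proof.
rewrite /eta (_ : sg * p + _ = (h - l) / 2); last first.
  by rewrite /sg /m /face_pos; case: s; field.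
rewrite divff// /flat divr_gt0 ?subr_gt0// hornerC mul1r gt_eqF//; exact: expR_gt0.
Qed.

Let thetaE n z : theta n z = flat 1 (n.+1%:R * delta z - 1).
Proof. by rewrite /theta /delta; congr (flat 1 _); ring. Qed.

Let derive1_theta n z : derive1 (theta n) z =
  - (sg * n.+1%:R) * flat 'X^2 (n.+1%:R * delta z - 1).
Proof.
have d : is_derive z 1 (theta n) (flat 'X^2
    (- (sg * n.+1%:R) * z + (sg * n.+1%:R * p - 1)) * (- (sg * n.+1%:R))).
  apply: (@is_derive1_comp _ (flat 1)); last exact: is_derive_affine.
  by have := is_derive_flat (1 : {poly R})
    (- (sg * n.+1%:R) * z + (sg * n.+1%:R * p - 1)); rewrite derivC subr0 mulr1.
rewrite derive1E; have [_ ->] := d.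
by rewrite mulrC /delta; congr (_ * flat _ _); ring.
Qed.

(** The derivative of [theta n] is of size n, but after multiplication by the distance to the face
    it is, up to sign, a flat function again: w / (w - 1)^2 is X + X^2 at X = 1 / (w - 1). It is
    bounded uniformly in n, and it tends to 0 inside the box because X + X^2 vanishes at 0. *)
Let theta_weight n z : delta z * (n.+1%:R * flat 'X^2 (n.+1%:R * delta z - 1)) =
  flat ('X + 'X^2) (n.+1%:R * delta z - 1).
Proof.
rewrite mulrA (mulrC (delta z)); set w := _ * delta z; rewrite /flat.
case: ifPn => w1; last by rewrite mulr0.
have wn0 : w - 1 != 0 by rewrite gt_eqF.
by rewrite hornerD !hornerXn hornerX; field.
Qed.

Let eta_bounded : exists2 E, 0 <= E & forall z, `|eta z| <= E.
Proof.
have [C C0 hC] := flat_bounded (1 : {poly R}).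
exists (C * `|(flat 1 ((h - l) / 2))^-1|); first by rewrite mulr_ge0.
by move=> z; rewrite normrM ler_wpM2r.
Qed.

Let derive1_eta_bounded : exists2 E, 0 <= E & forall z, `|derive1 eta z| <= E.
Proof.
have [C C0 hC] := flat_bounded ('X^2 : {poly R}).
exists (C * `|sg * (flat 1 ((h - l) / 2))^-1|); first by rewrite mulr_ge0.
move=> z.
have d : is_derive z 1 (fun z => flat 1 (sg * z + - (sg * m)))
    (flat 'X^2 (sg * z + - (sg * m)) * sg).
  apply: (@is_derive1_comp _ (flat 1)); last exact: is_derive_affine.
  by have := is_derive_flat (1 : {poly R}) (sg * z + - (sg * m));
    rewrite derivC subr0 mulr1.
have [_ e2] := is_deriveM d (is_derive_cst (flat 1 ((h - l) / 2))^-1 z 1).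
rewrite derive1E (e2 : 'D_1 eta z = _) scaler0 add0r /GRing.scale /=.
by rewrite mulrC -mulrA normrM ler_wpM2r.
Qed.

Let intble_mul_bdd (a g : R3 -> R) (C : R) : L2box B a ->
  measurable_fun (inside B : set (mR * mR * mR)) g ->
  (forall x, inside B x -> `|g x| <= C) ->
  intble (leb3 R) (inside B) (fun x => a x * g x).
Proof.
move=> La mg gC; apply: (L2_intbleM (measurable_inside B) La).
exact: (L2_bounded (measurable_inside B) (inside_fin B) mg gC).
Qed.

Section with_phi.
Variable phi : R3 -> R.
Hypothesis tphi : testfun (half_slab B e3 s) phi.

Let phip (x : R3) := phi (x.1, p).
(** The face values of [phi], extended into the box with the cut-off [eta], are subtracted so that
    [psi] vanishes on the face; [Dpsi] is its normal derivative. *)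
Let psi (x : R3) := phi x + (-1) * (phip x * eta x.2).
Let Dpsi (x : R3) := 'D_(evec R e3) phi x - phip x * derive1 eta x.2.

Let Ck_phip k : Ck k phip.
Proof. by apply: Ck_slice; case: tphi. Qed.

Let Ck_psi k : Ck k psi.
Proof.
apply: CkD; first by case: tphi.
apply: (CkM (f := cst (-1))); first exact: Ck_cst.
by apply: CkM; [exact: Ck_phip|exact: Ck_last].
Qed.

Let is_derive_last (a : R -> R) x : smooth a ->
  is_derive x (evec R e3) (fun x : R3 => a x.2) (derive1 a x.2).
Proof.
by move=> sa; have := is_derive_coord e3 e3 x sa; rewrite eqxx mulr1.
Qed.

Let is_derive_phip x : is_derive x (evec R e3) phip 0.
Proof.
have [_ /(_ e3) [d _]] := Ck_phip 1%N.
by have := derivableP (d x); rewrite derive_slice_e3.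
Qed.

Let is_derive_psi x : is_derive x (evec R e3) psi (Dpsi x).
Proof.
have [/(_ 1%N) [_ /(_ e3) [d _]] _ _] := tphi.
have d1 := derivableP (d x).
have d2 := is_deriveM (is_derive_phip x) (is_derive_last x smooth_eta).
have d3 := is_deriveD d1 (is_deriveZ (-1) d2).
rewrite /Dpsi; have [e1 e2] := d3; apply: DeriveDef; first exact: e1.
apply: (etrans e2); rewrite /GRing.scale /=; ring.
Qed.

Let psi_bounded : exists2 C, 0 <= C & forall x,
  [/\ `|psi x| <= C, `|Dpsi x| <= C & `|phip x| <= C].
Proof.
have [M M0 hM] := testfun_bounded tphi.
have [M' M'0 hM'] := testfun_bounded (testfun_derive e3 tphi).
have [E E0 hE] := eta_bounded.
have [E' E'0 hE'] := derive1_eta_bounded.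
exists (M + M * E + (M' + M * E')); first by rewrite !addr_ge0// mulr_ge0.
move=> x; have h1 := mulr_ge0 M0 E0; have h2 := mulr_ge0 M0 E'0; split.
- rewrite /psi mulN1r; apply: le_trans (ler_normB _ _) _.
  apply: (@le_trans _ _ (M + M * E)); last by rewrite lerDl addr_ge0.
  by rewrite lerD ?hM// normrM ler_pM ?hE//; exact: hM.
- apply: le_trans (ler_normB _ _) _.
  apply: (@le_trans _ _ (M' + M * E')); last by rewrite lerDr addr_ge0.
  by rewrite lerD ?hM'// normrM ler_pM ?hE'//; exact: hM.
- by apply: le_trans (hM _) _; rewrite -!addrA lerDl !addr_ge0.
Qed.

(** Mean value theorem along the normal segment to the face, where [psi] vanishes. The factor gained
    here compensates the growth of the derivative of [theta n]. *)
Let psi_lip : exists2 C, 0 <= C & forall x, inside B x ->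
  `|psi x| <= C * delta x.2.
Proof.
have [C C0 hC] := psi_bounded; exists C => // x Bx.
have d (t : R) : is_derive t 1 (fun t => psi (x.1, t)) (Dpsi (x.1, t)).
  apply: (@is_derive_line R R); have [d1 d2] := is_derive_psi (x.1, t).
  have := is_derive_along d1; rewrite d2.
  rewrite (_ : (fun h => psi _) = fun h : R => psi (x.1, h *: 1 + t))//.
  by apply/funext => r; rewrite shift_e3E /GRing.scale /= mulr1.
have psip : psi (x.1, p) = 0 by rewrite /psi /phip /= eta_p; ring.
have c (a b : R) : {within `[a, b], continuous (fun t => psi (x.1, t))}.
  apply: continuous_subspaceT => t; apply/differentiable_continuous/derivable1_diffP.
  by have [] := d t.
have := Bx e3; rewrite /Defs.coord /= => x2; have dx := delta_gt0 x2.
have [xp|px] := leP x.2 p.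
  have [t _ E] := MVT_segment xp (fun t _ => d t) (c _ _).
  have xE : psi (x.1, x.2) = psi x by case: (x).
  rewrite psip xE sub0r in E; rewrite -normrN E normrM.
  have -> : `|p - x.2| = delta x.2.
    by rewrite -[RHS]gtr0_norm// /delta normrM /sg; case: s; rewrite ?normrN1 ?normr1 mul1r.
  by rewrite ler_wpM2r ?(ltW dx)//; have [] := hC (x.1, t).
have [t _ E] := MVT_segment (ltW px) (fun t _ => d t) (c _ _).
have xE : psi (x.1, x.2) = psi x by case: (x).
rewrite psip xE subr0 in E; rewrite E normrM.
have -> : `|x.2 - p| = delta x.2.
  rewrite distrC -[RHS]gtr0_norm// /delta normrM /sg.
  by case: s; rewrite ?normrN1 ?normr1 mul1r.
by rewrite ler_wpM2r ?(ltW dx)//; have [] := hC (x.1, t).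
Qed.

Let testfun_psi_theta n : testfun (inside B) (fun x => psi x * theta n x.2).
Proof.
have [Cphi cs sW] := tphi.
pose J : set R := if s then `[m, h - n.+1%:R^-1]%classic else `[l + n.+1%:R^-1, m]%classic.
(* [K1] contains the points where [phi] itself contributes. [K2] is for the extended face values:
   the projection of the support of [phi], times the heights where both [eta] and [theta n] may be
   nonzero. *)
pose K1 : set R3 := supp phi `&` [set x | n.+1%:R^-1 <= delta x.2].
pose K2 : set R3 := (fst @` supp phi) `*` J.
have n0 : 0 < n.+1%:R^-1 :> R by rewrite invr_gt0 ltr0n.
have cd : closed [set x : R3 | n.+1%:R^-1 <= delta x.2].
  rewrite (_ : mkset _ = (fun x : R3 => delta x.2) @^-1` [set t | n.+1%:R^-1 <= t])//.
  apply: preimage_closed; last exact: closed_ge.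
  have cd (t : R) : {for t, continuous delta}.
    apply/differentiable_continuous/derivable1_diffP.
    rewrite (_ : delta = fun z => (- sg) * z + sg * p).
      by have [] := is_derive_affine (- sg) (sg * p) t.
    by apply/funext => z; rewrite /delta; ring.
  move=> x _; apply: (@continuous_comp _ _ _ snd delta); last exact: cd.
  exact: cvg_snd.
have cK1 : compact K1.
  apply: (subclosed_compact _ cs); last by move=> x [].
  by apply: closedI => //; exact: closed_closure.
have cK2 : compact K2.
  apply: compact_setX.
    apply: continuous_compact => //; apply: continuous_subspaceT => x.
    exact: cvg_fst.
  by rewrite /J; case: s; exact: segment_compact.
have lhm : l < m < h by rewrite /m; have := lh => ?; apply/andP; split; lra.
apply: (testfunI _ (compactU cK1 cK2)).
- by move=> k; apply: CkM; [exact: Ck_psi|exact: Ck_last].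
- move=> x; rewrite insideE => -[[sx dx]|[[y sy yx] Jx]].
    have [h1 h2] := sW _ sx; split.
      by move=> j je; have := h1 j je; elim/ord3_cases: j je.
    move: dx h2; rewrite /delta /sg /face_pos /Defs.coord /=.
    by case: s => /= dx h2; move: dx n0; move: (n.+1%:R^-1) => q dx q0;
      rewrite in_itv /=; apply/andP; split; lra.
  have [h1 h2] := sW _ sy; split.
    by rewrite -yx => j je; have := h1 j je; elim/ord3_cases: j je.
  move: n0 Jx lhm; rewrite /J; move: (n.+1%:R^-1) => q q0.
  by case: s => /=; rewrite !in_itv /= => /andP[? ?] /andP[? ?];
    apply/andP; split; lra.
- move=> x; rewrite mulf_eq0 negb_or => /andP[px tx].
  have dx : n.+1%:R^-1 <= delta x.2.
    move: tx; rewrite thetaE /flat; case: ifP => //; rewrite ?eqxx//.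
    rewrite subr_gt0 => h1 _; apply: ltW.
    by rewrite -(ltr_pM2l (ltr0Sn R n)) divff.
  have [px0|pxn] := eqVneq (phi x) 0; last by left; split=> //; exact: subset_closure.
  right; have : phip x * eta x.2 != 0.
    by apply: contraNneq px => E; rewrite /psi px0 E mulr0 addr0.
  rewrite mulf_eq0 negb_or => /andP[ppx ex]; split.
    by exists (x.1, p) => //; exact: subset_closure.
  have mx : 0 < sg * x.2 + - (sg * m).
    by move: ex; rewrite /eta mulf_eq0 negb_or /flat => /andP[+ _]; case: ifP; rewrite ?eqxx.
  move: dx mx; rewrite /J /delta /sg /face_pos; move: (n.+1%:R^-1) => q.
  case: s => dx mx;
    by rewrite /= in_itv /=; apply/andP; split; lra.
Qed.

Let meas_Ck (g : R3 -> R) : continuous g ->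
  measurable_fun (inside B : set (mR * mR * mR)) g.
Proof. by move=> cg; apply: measurable_funTS; exact: continuous_measurable3. Qed.

Let Dpsi_continuous : continuous Dpsi.
Proof.
have [Cphi _ _] := tphi; have [_ /(_ e3) [_ [c1 _]]] := Cphi 1%N.
have c2 := Ck_continuous (Ck_phip 0).
have c3 := Ck_continuous (@Ck_last R 0 _ (smooth_derive1 smooth_eta)).
move=> x; apply: cvgB; first exact: c1.
by apply: cvgM; [exact: c2|exact: c3].
Qed.

Let cvg_flat_theta P x : inside B x ->
  flat P (n.+1%:R * delta x.2 - 1) @[n --> \oo] --> P.[0].
Proof. by move=> Bx; apply: flat_cvg; apply: delta_gt0; exact: (Bx e3). Qed.

(** The products of [psi] with the cut-offs [theta n] are supported inside the box, so the weak
    derivative can be tested with them. In the limit the term with the derivative of [theta n]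
    disappears by [psi_lip] and [theta_weight]. *)
Lemma ipbox_psi f : H1 B f ->
  ipbox B f Dpsi + ipbox B (partial B e3 f) psi = 0.
Proof.
move=> Hf; have [Lg hg] := partialP e3 Hf; have Lf := Hf.1.
set g := partial B e3 f in Lg hg *.
have mB := measurable_inside B.
have [C C0 hC] := psi_bounded; have [C' C'0 hC'] := psi_lip.
have [Q Q0 hQ] := flat_bounded ('X + 'X^2 : {poly R}).
have cpsi := Ck_continuous (Ck_psi 0).
have cth n := Ck_continuous (@Ck_last R 0 _ (smooth_theta n)).
have cth' n := Ck_continuous (@Ck_last R 0 _ (smooth_derive1 (smooth_theta n))).
have th1 n x : `|theta n x| <= 1.
  by rewrite thetaE ger0_norm ?flat1_ge0 ?flat1_le1.
have psith n x : inside B x ->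
    `|psi x * derive1 (theta n) x.2| <= C' * `|flat ('X + 'X^2) (n.+1%:R * delta x.2 - 1)|.
  move=> Bx; have dx : 0 < delta x.2 by apply: delta_gt0; exact: (Bx e3).
  rewrite -theta_weight derive1_theta; have hx := hC' _ Bx.
  move: (delta x.2) dx hx => dl dx hx.
  rewrite !normrM normrN normrM.
  have -> : `|sg| = 1 by rewrite /sg; case: s; rewrite ?normrN1 ?normr1.
  rewrite mul1r [leRHS]mulrA; apply: ler_wpM2r; first by rewrite mulr_ge0.
  by rewrite (gtr0_norm dx).
pose D n (x : R3) := Dpsi x * theta n x.2 + psi x * derive1 (theta n) x.2.
pose W n (x : R3) := psi x * theta n x.2.
have DW n x : 'D_(evec R e3) (W n) x = D n x.
  have [_ e2] := is_deriveM (is_derive_psi x) (is_derive_last x (smooth_theta n)).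
  by apply: (etrans e2); rewrite /D /GRing.scale /=; ring.
have E n : \int[leb3 R]_(x in inside B) (f x * D n x + g x * W n x) = 0.
  have mD : measurable_fun (inside B : set (mR * mR * mR)) (D n).
    apply: meas_Ck => x; apply: cvgD; apply: cvgM.
    - exact: Dpsi_continuous.
    - exact: cth.
    - exact: cpsi.
    - exact: cth'.
  have mW : measurable_fun (inside B : set (mR * mR * mR)) (W n).
    by apply: meas_Ck => x; apply: cvgM; [exact: cpsi|exact: cth].
  have I1 : intble (leb3 R) (inside B) (fun x => f x * D n x).
    apply: (@intble_mul_bdd _ _ (C * 1 + C' * Q)) => // x Bx.
    apply: le_trans (ler_normD _ _) _; apply: lerD.
      by rewrite normrM ler_pM//; have [] := hC x.
    by apply: le_trans (psith _ _ Bx) _; rewrite ler_wpM2l.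
  have I2 : intble (leb3 R) (inside B) (fun x => g x * W n x).
    apply: (@intble_mul_bdd _ _ (C * 1)) => // x Bx.
    by rewrite normrM ler_pM//; have [] := hC x.
  rewrite (RintegralD mB I1 I2).
  have := hg _ (testfun_psi_theta n).
  rewrite /ipbox /ip -/(W n) => E1; rewrite -[X in _ + X]opprK -E1.
  apply/eqP; rewrite subr_eq0; apply/eqP; apply: intR_eq => x _.
  by rewrite -DW.
have I1 : intble (leb3 R) (inside B) (fun x => f x * Dpsi x).
  apply: (@intble_mul_bdd _ _ C) => //; first exact: meas_Ck.
  by move=> x _; have [] := hC x.
have I2 : intble (leb3 R) (inside B) (fun x => g x * psi x).
  apply: (@intble_mul_bdd _ _ C) => //; first exact: meas_Ck.
  by move=> x _; have [] := hC x.
rewrite /ipbox /ip -(RintegralD mB I1 I2).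
have If := L2_intble mB (inside_fin B) Lf; have Ig := L2_intble mB (inside_fin B) Lg.
have c1 : \int[leb3 R]_(x in inside B) (f x * D n x + g x * W n x) @[n --> \oo] -->
    \int[leb3 R]_(x in inside B) (f x * Dpsi x + g x * psi x).
  apply: (@intR_cvg_lim _ _ _ (leb3 R) (inside B)
    (fun n x => f x * D n x + g x * W n x) (fun x => f x * Dpsi x + g x * psi x)
    (fun x => (C + C' * Q) * `|f x| + C * `|g x|) mB).
  - move=> n; apply: measurable_funD; apply: measurable_funM.
    + by case: Lf.
    + apply: meas_Ck => x; apply: cvgD; apply: cvgM.
      * exact: Dpsi_continuous.
      * exact: cth.
      * exact: cpsi.
      * exact: cth'.
    + by case: Lg.
    + by apply: meas_Ck => x; apply: cvgM; [exact: cpsi|exact: cth].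
  - move=> x Bx.
    have t1 : theta n x.2 @[n --> \oo] --> (1 : R).
      under eq_fun do rewrite thetaE.
      by have := cvg_flat_theta (P := 1) Bx; rewrite hornerC.
    have t2 : psi x * derive1 (theta n) x.2 @[n --> \oo] --> (0 : R).
      have c0 : `|flat ('X + 'X^2) (n.+1%:R * delta x.2 - 1)| @[n --> \oo] --> (0 : R).
        have c := cvg_flat_theta (P := 'X + 'X^2) Bx.
        rewrite hornerD hornerX hornerXn expr0n addr0 in c.
        by rewrite -[X in _ --> X](@normr0 R R); exact: cvg_norm.
      have c2 : C' * `|flat ('X + 'X^2) (n.+1%:R * delta x.2 - 1)| @[n --> \oo] --> (0 : R).
        by rewrite -[X in _ --> X](mulr0 C'); apply: cvgMr.
      by apply: cvg0_le c2 => n; exact: psith.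
    apply: cvgD; apply: cvgMr.
      rewrite -[X in _ --> X]addr0; apply: cvgD => //.
      by rewrite -[X in _ --> X]mulr1; apply: cvgMr.
    by rewrite -[X in _ --> X]mulr1; apply: cvgMr.
  - by apply: intbleD => //; apply: intbleZ => //; exact: intble_norm.
  - move=> n x Bx; apply: le_trans (ler_normD _ _) _; apply: lerD.
      rewrite normrM mulrC ler_wpM2r//; apply: le_trans (ler_normD _ _) _; apply: lerD.
        by rewrite normrM -[leRHS]mulr1 ler_pM//; have [] := hC x.
      by apply: le_trans (psith _ _ Bx) _; rewrite ler_wpM2l.
    by rewrite normrM mulrC ler_wpM2r// normrM -[leRHS]mulr1 ler_pM//; have [] := hC x.
have c2 : \int[leb3 R]_(x in inside B) (f x * D n x + g x * W n x) @[n --> \oo] --> (0 : R).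
  by under eq_fun do rewrite E; exact: cvg_cst.
exact: (cvg_unique (@Rhausdorff R) c1 c2).
Qed.

Let F f (x : R3) := f x * derive1 eta x.2 + partial B e3 f x * eta x.2.

(** [phi] is [psi] plus the extension of its face values, and [psi] contributes nothing by
    [ipbox_psi]. What remains depends on [phi] through its values on the face only. *)
Lemma green_phi f : H1 B f ->
  ipbox B f (fun x => 'D_(evec R e3) phi x) + ipbox B (partial B e3 f) phi =
  \int[leb3 R]_(x in inside B) (F f x * phip x).
Proof.
move=> Hf; have [Lg hg] := partialP e3 Hf; have Lf := Hf.1.
have mB := measurable_inside B.
have [C C0 hC] := psi_bounded; have [E E0 hE] := eta_bounded.
have [E' E'0 hE'] := derive1_eta_bounded.
have cphip := Ck_continuous (Ck_phip 0).
have ceta := Ck_continuous (@Ck_last R 0 _ smooth_eta).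
have ceta' := Ck_continuous (@Ck_last R 0 _ (smooth_derive1 smooth_eta)).
have := ipbox_psi Hf; set g := partial B e3 f in Lg hg *; rewrite /ipbox /ip.
have LD := testfun_L2box B (testfun_derive e3 tphi).
have Lphi := testfun_L2box B tphi.
have I1 : intble (leb3 R) (inside B) (fun x => f x * Dpsi x).
  apply: (@intble_mul_bdd _ _ C) => //; first exact: meas_Ck.
  by move=> x _; have [] := hC x.
have I2 : intble (leb3 R) (inside B) (fun x => g x * psi x).
  apply: (@intble_mul_bdd _ _ C) => //; first exact: meas_Ck (Ck_continuous (Ck_psi 0)).
  by move=> x _; have [] := hC x.
have J1 : intble (leb3 R) (inside B) (fun x => f x * 'D_(evec R e3) phi x).
  exact: (L2_intbleM mB Lf LD).
have J2 : intble (leb3 R) (inside B) (fun x => g x * phi x).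
  exact: (L2_intbleM mB Lg Lphi).
rewrite -(RintegralD mB I1 I2) -(RintegralD mB J1 J2) => E1.
rewrite -[RHS]addr0 -E1 -RintegralD//; last 2 first.
- have K1 : intble (leb3 R) (inside B) (fun x => f x * (derive1 eta x.2 * phip x)).
    apply: (@intble_mul_bdd _ _ (E' * C)) => //.
      by apply: meas_Ck => x; apply: cvgM; [exact: ceta'|exact: cphip].
    by move=> x _; rewrite normrM ler_pM//; have [] := hC x.
  have K2 : intble (leb3 R) (inside B) (fun x => g x * (eta x.2 * phip x)).
    apply: (@intble_mul_bdd _ _ (E * C)) => //.
      by apply: meas_Ck => x; apply: cvgM; [exact: ceta|exact: cphip].
    by move=> x _; rewrite normrM ler_pM//; have [] := hC x.
  apply: (intble_eq mB _ (intbleD mB K1 K2)) => x _; rewrite /F -/g; ring.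
- exact: (intbleD mB I1 I2).
apply: intR_eq => x _; rewrite /F -/g /Dpsi /psi; ring.
Qed.

End with_phi.

Let F f (x : R3) := f x * derive1 eta x.2 + partial B e3 f x * eta x.2.
(** Formally [F f] is the normal derivative of f times [eta], and [eta] is 1 on the face and 0 on
    the opposite one: integrating over the segment above y leaves the boundary value of f, with the
    sign of the outward normal. *)
Let g f (y : R * R) : R := sg * \int[mu]_(z in `]l, h[) F f (y, z).

Let L2_F : exists2 C, 0 <= C & forall f, H1 B f -> L2box B (F f) /\
  \int[leb3 R]_(x in inside B) (F f x ^+ 2) <=
  C * (ipbox B f f + ipbox B (partial B e3 f) (partial B e3 f)).
Proof.
have mB := measurable_inside B.
have [E E0 hE] := eta_bounded; have [E' E'0 hE'] := derive1_eta_bounded.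
have ceta := Ck_continuous (@Ck_last R 0 _ smooth_eta).
have ceta' := Ck_continuous (@Ck_last R 0 _ (smooth_derive1 smooth_eta)).
exists (2 * (E ^+ 2 + E' ^+ 2)); first by rewrite mulr_ge0// addr_ge0 ?sqr_ge0.
move=> f Hf; have Lf := Hf.1; have Lg := L2box_partial e3 Hf.
have mF : measurable_fun (inside B : set (mR * mR * mR)) (F f).
  apply: measurable_funD; apply: measurable_funM; [by case: Lf| |by case: Lg|];
  by apply: measurable_funTS; exact: continuous_measurable3.
have If := L2_sqr Lf; have Ig := L2_sqr Lg.
pose C := 2 * (E ^+ 2 + E' ^+ 2).
have IS : intble (leb3 R) (inside B) (fun x => C * (f x ^+ 2 + partial B e3 f x ^+ 2)).
  by apply: intbleZ => //; exact: intbleD.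
have FS x : F f x ^+ 2 <= C * (f x ^+ 2 + partial B e3 f x ^+ 2).
  rewrite /F; set a := f x; set b := partial B e3 f x.
  have h1 : (derive1 eta x.2) ^+ 2 <= E' ^+ 2.
    by rewrite -[leLHS]real_normK ?num_real// ler_pXn2r ?nnegrE.
  have h2 : (eta x.2) ^+ 2 <= E ^+ 2.
    by rewrite -[leLHS]real_normK ?num_real// ler_pXn2r ?nnegrE.
  move: (derive1 eta x.2) (eta x.2) h1 h2 => w v h1 h2.
  apply: le_trans (sqr_add_le _ _) _; rewrite /C -mulrA ler_wpM2l//.
  rewrite !exprMn [leRHS]mulrDr; apply: lerD.
    by rewrite mulrC ler_wpM2r ?sqr_ge0// (le_trans h1)// lerDr sqr_ge0.
  by rewrite mulrC ler_wpM2r ?sqr_ge0// (le_trans h2)// lerDl sqr_ge0.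
have I2 : intble (leb3 R) (inside B) (fun x => F f x ^+ 2).
  apply: (@intble_le _ _ _ (leb3 R) (inside B) _
    (fun x => C * (f x ^+ 2 + partial B e3 f x ^+ 2)) mB) => //.
    exact: measurable_funX.
  by move=> x _; rewrite ger0_norm ?sqr_ge0.
split; first exact: (L2P mF I2).
have -> : ipbox B f f + ipbox B (partial B e3 f) (partial B e3 f) =
    \int[leb3 R]_(x in inside B) (f x ^+ 2 + partial B e3 f x ^+ 2).
  by rewrite (RintegralD mB If Ig); congr (_ + _); apply: intR_eq => x _.
rewrite -(RintegralZl _ mB (intbleD mB If Ig)).
by apply: intR_le.
Qed.

Let mI : measurable (`]l, h[%classic : set mR). Proof. exact: measurable_itv. Qed.
Let mFace := measurable_face_dom B.

Let fubini_box (a : R3 -> R) : intble (leb3 R) (inside B) a ->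
  [/\ intble (leb2 R) (face_dom B e3) (fun y => \int[mu]_(z in `]l, h[) a (y, z)),
      \int[leb2 R]_(y in face_dom B e3) \int[mu]_(z in `]l, h[) a (y, z) =
        \int[leb3 R]_(x in inside B) a x &
      {ae (leb2 R), forall y, face_dom B e3 y ->
        intble mu (`]l, h[%classic : set mR) (fun z => a (y, z))}].
Proof.
rewrite insideE => Ia; split.
- exact: (intble_fubini1 (m1 := leb2s R) mFace mI Ia).
- exact: (intR_fubini1 (m1 := leb2s R) mFace mI Ia).
- exact: (ae_intble_fubini1 (m1 := leb2s R) mFace mI Ia).
Qed.

(** Cauchy-Schwarz on each normal segment bounds the square of [g f] by w times the integral of the
    square of [F f], where w is the length of the segment; integrating over the face gives the L^2
    bound. *)
Lemma trace_exists : exists2 C, 0 <= C & forall f, H1 B f ->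
  exists2 g, is_trace B e3 s f g & ip (leb2 R) (face_dom B e3) g g <=
    C * (ipbox B f f + ipbox B (partial B e3 f) (partial B e3 f)).
Proof.
have [C C0 hC] := L2_F; have mB := measurable_inside B.
have mIfin : (mu (`]l, h[%classic : set mR) < +oo)%E by exact: itv_fin.
pose w := ip mu (`]l, h[%classic : set mR) (cst 1) (cst 1).
have w0 : 0 <= w by apply: Rintegral_ge0 => z _; rewrite mulr1.
exists (w * C); first by rewrite mulr_ge0.
move=> f Hf; have [LF FC] := hC f Hf.
have IF := L2_intble mB (inside_fin B) LF.
have IF2 := L2_sqr LF.
have [IG EG aeG] := fubini_box IF; have [IG2 EG2 aeG2] := fubini_box IF2.
have Ig : intble (leb2 R) (face_dom B e3) (g f) by exact: intbleZ.
have mg := intble_meas Ig.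
have CS : {ae (leb2 R), forall y, face_dom B e3 y ->
    g f y ^+ 2 <= w * \int[mu]_(z in `]l, h[) (F f (y, z) ^+ 2)}.
  apply: aeS (aeI aeG aeG2) => y [a1 a2] Dy.
  have Lk : L2 mu (`]l, h[%classic : set mR) (fun z => F f (y, z)).
    by apply: L2P; [exact: intble_meas (a1 Dy)|exact: a2].
  have L1 : L2 mu (`]l, h[%classic : set mR) (cst 1).
    apply: (@L2_bounded _ _ _ _ _ mI _ 1) => //.
    by move=> z _; rewrite normr1.
  have := inner_CS_sqr (inner_L2 mu mI) Lk L1.
  have -> : g f y ^+ 2 = (ip mu (`]l, h[%classic : set mR) (fun z => F f (y, z)) (cst 1)) ^+ 2.
    rewrite /g exprMn sgsq mul1r; congr (_ ^+ 2).
    by apply: intR_eq => z _; rewrite mulr1.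
  by rewrite mulrC.
have Iw : intble (leb2 R) (face_dom B e3)
    (fun y => w * \int[mu]_(z in `]l, h[) (F f (y, z) ^+ 2)) by exact: intbleZ.
have Ig2 : intble (leb2 R) (face_dom B e3) (fun y => g f y ^+ 2).
  apply: (intble_ae_le mFace _ _ Iw CS); first exact: measurable_funX.
  by move=> y _; exact: sqr_ge0.
exists (g f).
  split; first exact: (L2P mg Ig2).
  move=> phi tphi; rewrite (green_phi tphi Hf).
  have [M M0 hM] := testfun_bounded tphi.
  have cphip := Ck_continuous (Ck_slice p (let: And3 h _ _ := tphi in h 0%N)).
  have Iphi : intble (leb3 R) (inside B) (fun x => F f x * phi (x.1, p)).
    apply: (@intble_mul_bdd _ _ M LF) => //.
    by apply: measurable_funTS; exact: continuous_measurable3.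
  have [I1 E1 ae1] := fubini_box Iphi.
  rewrite -E1 -/sg /ip -RintegralZl//; last first.
    have Lphi := L2face_testfun B e3 p tphi.
    by apply: (L2_intbleM mFace (L2P mg Ig2)); exact: Lphi.
  apply: intR_ae_eq => //.
    apply: measurable_funM; first exact: measurable_cst.
    apply: measurable_funM => //.
    by have [] := L2face_testfun B e3 p tphi.
  apply: aeS aeG => y aey Dy; rewrite /= /g mulrA mulrA sg2 mul1r.
  rewrite RintegralZr//; last exact: aey.
  by case: (y).
apply: le_trans (_ : \int[leb2 R]_(y in face_dom B e3)
    (w * \int[mu]_(z in `]l, h[) (F f (y, z) ^+ 2)) <= _).
  rewrite -subr_le0 /ip.
  have Igg : intble (leb2 R) (face_dom B e3) (fun y => g f y * g f y) by exact: Ig2.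
  rewrite -RintegralB//; apply: intR_ae_le0 => //; first exact: intbleB.
  by apply: aeS CS => y h Dy; rewrite subr_le0 -expr2 h.
by rewrite RintegralZl// EG2 -mulrA ler_wpM2l.
Qed.

End trace_exists.

(** * Linear maps defined up to null elements *)

Section weak_maps.
Variable R : realType.

(* F need only be linear up to a null element of the target, as is the case of
   a chosen representative of a weak derivative or of a trace *)
Definition wlin (V W : lmodType R) (D : set V) (E : set W) (c : W -> W -> R)
    (F : V -> W) :=
  (forall x, D x -> E (F x)) /\
  forall w, E w -> lin_on D (fun x => c (F x) w).

Definition bdd_map (V W : lmodType R) (D : set V) (b : V -> V -> R)
    (E : set W) (c : W -> W -> R) (F : V -> W) :=
  wlin D E c F /\
  exists2 C, 0 <= C & forall x, D x -> c (F x) (F x) <= C * b x x.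

Section one_target.
Variables (V W : lmodType R) (D : set V) (b : V -> V -> R).
Variables (E : set W) (c : W -> W -> R).
Hypothesis ic : inner_on E c.
Implicit Types F G : V -> W.

Lemma inner_pull F : subsp D -> wlin D E c F -> inner_on D (fun x y => c (F x) (F y)).
Proof.
move=> sD [DE lF]; split=> //.
- by split=> [y Dy|x Dx]; [exact: lF (DE _ Dy)|move=> a y z Dy Dz];
    rewrite !(inner_sym ic (DE _ Dx))//; [exact: lF (DE _ Dx) a y z Dy Dz|exact: DE..|];
    apply: DE; exact: sD.2.
- by move=> x y Dx Dy; apply: (inner_sym ic); exact: DE.
- by move=> x Dx; apply: (inner_ge0 ic); exact: DE.
Qed.

Lemma inner_add (b1 b2 : V -> V -> R) : inner_on D b1 -> inner_on D b2 ->
  inner_on D (fun x y => b1 x y + b2 x y).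
Proof.
move=> i1 i2; split; first exact: inner_subsp i1.
- have [l1 r1] := inner_bilin i1; have [l2 r2] := inner_bilin i2.
  split=> [y Dy|x Dx] a z w Dz Dw; first by rewrite l1// l2//; ring.
  by rewrite (r1 _ Dx)// (r2 _ Dx)//; ring.
- by move=> x y Dx Dy; rewrite (inner_sym i1)// (inner_sym i2).
- by move=> x Dx; rewrite addr_ge0// ?(inner_ge0 i1)// (inner_ge0 i2).
Qed.

Lemma inner_sum n (bs : 'I_n -> V -> V -> R) : subsp D ->
  (forall i, inner_on D (bs i)) -> inner_on D (fun x y => \sum_(i < n) bs i x y).
Proof.
move=> sD ib; elim: (index_enum _) => [|i s IH].
  under eq_fun do under eq_fun do rewrite big_nil.
  by split=> //; split=> *; move=> *; rewrite mulr0 addr0.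
by under eq_fun do under eq_fun do rewrite big_cons; exact: inner_add.
Qed.

Lemma bdd_mapS D' F : D' `<=` D -> bdd_map D b E c F -> bdd_map D' b E c F.
Proof.
move=> S [[DE lF] [C C0 hC]]; split; first split.
- by move=> x /S; exact: DE.
- by move=> w Ew a x y /S Dx /S Dy; exact: lF.
- by exists C => // x /S; exact: hC.
Qed.

Lemma bdd_mapD F G : inner_on D b -> bdd_map D b E c F -> bdd_map D b E c G ->
  bdd_map D b E c (fun x => F x + G x).
Proof.
move=> ib [[F1 lF] [C C0 hC]] [[G1 lG] [C' C'0 hC']].
have sE := inner_subsp ic; have [l1 r1] := inner_bilin ic.
have sF x : D x -> E (F x + G x) by move=> Dx; apply: subspD => //; [exact: F1|exact: G1].
split; first split=> //.
- move=> w Ew a x y Dx Dy; have sD := inner_subsp ib.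
  have Dxy : D (a *: x + y) by apply: sD.2.
  rewrite !(linD (l1 w Ew)).
  all: try by first [exact: F1|exact: G1].
  by rewrite lF// lG//; ring.
- exists (2 * (C + C')); first by rewrite mulr_ge0// addr_ge0.
  move=> x Dx; have EF := F1 _ Dx; have EG := G1 _ Dx.
  have := inner_expand ic 1 EF EG; rewrite scale1r => ->.
  have := inner_expand ic (-1) EF EG.
  have := inner_ge0 ic (subspD sE EF (subspZ sE (-1) EG)).
  have := hC _ Dx; have := hC' _ Dx.
  move: (c _ _) (c _ _) (c _ _) (c _ _) (b _ _) => *; lra.
Qed.

Lemma bdd_mapZ (a : R) F : subsp D -> bdd_map D b E c F ->
  bdd_map D b E c (fun x => a *: F x).
Proof.
move=> sD [[F1 lF] [C C0 hC]].
have sE := inner_subsp ic; have [l1 r1] := inner_bilin ic.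
split; first split.
- by move=> x Dx; apply: subspZ => //; exact: F1.
- move=> w Ew k x y Dx Dy; have Dxy : D (k *: x + y) by apply: sD.2.
  rewrite !(linZ sE (l1 w Ew)) ?lF; try exact: F1; [ring|by []..].
- exists (a ^+ 2 * C); first by rewrite mulr_ge0// sqr_ge0.
  move=> x Dx; have EF := F1 _ Dx; have EaF := subspZ sE a EF.
  rewrite (linZ sE (l1 _ EaF) _ EF) (linZ sE (r1 _ EF) _ EF).
  by rewrite mulrA -expr2 -[leRHS]mulrA ler_wpM2l ?sqr_ge0// hC.
Qed.

Lemma bdd_map_sum n (F : 'I_n -> V -> W) : inner_on D b ->
  (forall i, bdd_map D b E c (F i)) -> bdd_map D b E c (fun x => \sum_(i < n) F i x).
Proof.
move=> ib hF; elim: (index_enum _) => [|i s IH].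
  under eq_fun do rewrite big_nil.
  have sE := inner_subsp ic; have [l1 r1] := inner_bilin ic.
  split; first split.
  + by move=> x _; exact: subsp0.
  + by move=> w Ew a x y _ _; rewrite !(lin0 sE (l1 w Ew)) mulr0 addr0.
  + by exists 0 => // x _; rewrite mul0r (lin0 sE (l1 _ (subsp0 sE))).
by under eq_fun do rewrite big_cons; exact: bdd_mapD.
Qed.

End one_target.

Section bdd_map_form.
Variables (V V' W : lmodType R) (D : set V) (b : V -> V -> R).
Variables (D' : set V') (b' : V' -> V' -> R) (E : set W) (c : W -> W -> R).
Hypothesis ic : inner_on E c.

Lemma bdd_map_form F G : subsp D' -> bdd_map D b E c F -> bdd_map D' b' E c G ->
  bdd_form D b D' b' (fun x y => c (F x) (G y)).
Proof.
move=> sD' [[F1 lF] [C C0 hC]] [[G1 lG] [C' C'0 hC']]; split; first split.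
- by move=> y Dy; apply: lF; exact: G1.
- move=> x Dx a y z Dy Dz; rewrite !(inner_sym ic (F1 _ Dx)); try exact: G1.
    by apply: lG => //; exact: F1.
  by apply: G1; exact: sD'.2.
exists (Num.sqrt C * Num.sqrt C'); first by rewrite mulr_ge0 ?sqrtr_ge0.
move=> x y Dx Dy; apply: le_trans (inner_CS ic (F1 _ Dx) (G1 _ Dy)) _.
rewrite mulrACA; apply: ler_pM; rewrite ?hnorm_ge0// /hnorm -sqrtrM//.
- by apply: ler_wsqrtr; exact: hC.
- by apply: ler_wsqrtr; exact: hC'.
Qed.

Lemma bdd_map_comp (P : V' -> V) F : bdd_map D b E c F ->
  (forall a x y, P (a *: x + y) = a *: P x + P y) ->
  (forall x, D' x -> D (P x)) -> (forall x, D' x -> b (P x) (P x) <= b' x x) ->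
  bdd_map D' b' E c (F \o P).
Proof.
move=> [[F1 lF] [C C0 hC]] lP DP bP; split; first split.
- by move=> x /DP; exact: F1.
- by move=> w Ew a x y Dx Dy /=; rewrite lP; apply: lF => //; exact: DP.
- by exists C => // x Dx; apply: le_trans (hC _ (DP _ Dx)) _; rewrite ler_wpM2l// bP.
Qed.

End bdd_map_form.

Lemma inner_prod (V V' : lmodType R) (D : set V) b (D' : set V') b' :
  inner_on D b -> inner_on D' b' ->
  inner_on (D `*` D') (fun x y => b x.1 y.1 + b' x.2 y.2).
Proof.
move=> ib ib'; have [l r] := inner_bilin ib; have [l' r'] := inner_bilin ib'.
split.
- have sD := inner_subsp ib; have sD' := inner_subsp ib'.
  split; first by split; [exact: (subsp0 sD)|exact: (subsp0 sD')].
  by move=> a x y [Dx Dx'] [Dy Dy']; split; [exact: sD.2|exact: sD'.2].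
- split=> [y [Dy Dy']|x [Dx Dx']] a z w [Dz Dz'] [Dw Dw'] /=.
    by rewrite l// l'//; ring.
  by rewrite (r _ Dx)// (r' _ Dx')//; ring.
- by move=> x y [Dx Dx'] [Dy Dy']; rewrite (inner_sym ib)// (inner_sym ib').
- by move=> x [Dx Dx']; rewrite addr_ge0 ?(inner_ge0 ib)// (inner_ge0 ib').
Qed.

Lemma inner_onS (V : lmodType R) (D D' : set V) b : subsp D' -> D' `<=` D ->
  inner_on D b -> inner_on D' b.
Proof.
move=> sD' S ib; have [l r] := inner_bilin ib; split=> //.
- by split=> [y /S Dy|x /S Dx] a z w /S Dz /S Dw; [exact: l|exact: r].
- by move=> x y /S Dx /S Dy; exact: (inner_sym ib).
- by move=> x /S; exact: (inner_ge0 ib).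
Qed.

End weak_maps.

(** * Semi-inner products and bounded maps on the Sobolev spaces *)

Section sobolev_inner.
Variable R : realType.
Local Notation R3 := (R * R * R)%type.
Local Notation sfield := (R3 -> R).
Local Notation vfield := ('I_3 -> R3 -> R).
Implicit Types (B : box R) (D : set sfield) (b : sfield -> sfield -> R).

Lemma wlin_id B : wlin (H1 B : set sfield) (L2box B) (ipbox B) id.
Proof.
split=> [f []//|h Lh a f g [Lf _] [Lg _]]; exact: ipbox_linl.
Qed.

Lemma wlin_partial B i : wlin (H1 B : set sfield) (L2box B) (ipbox B) (partial B i).
Proof.
split=> [f Hf|h Lh]; [exact: L2box_partial|exact: ip_partial_lin].
Qed.

Lemma inner_H1 B : inner_on (H1 B : set sfield) (ipH1 B).
Proof.
apply: inner_add; first exact: (inner_pull (inner_box B) (subsp_H1 B) (wlin_id B)).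
apply: inner_sum; first exact: subsp_H1.
by move=> i; exact: (inner_pull (inner_box B) (subsp_H1 B) (wlin_partial B i)).
Qed.

Lemma ipbox_ge0 B f : L2box B f -> 0 <= ipbox B f f.
Proof. exact: (inner_ge0 (inner_box B)). Qed.

Lemma ipbox_partial_ge0 B i f : H1 B f -> 0 <= ipbox B (partial B i f) (partial B i f).
Proof. by move=> Hf; apply: ipbox_ge0; exact: L2box_partial. Qed.

Lemma ipbox_partial_le_ipH1 B i f : H1 B f ->
  ipbox B f f + ipbox B (partial B i f) (partial B i f) <= ipH1 B f f.
Proof.
move=> Hf; rewrite lerD2l (bigD1 i)//= lerDl.
by apply: sumr_ge0 => j _; exact: ipbox_partial_ge0.
Qed.

Lemma bdd_id B : bdd_map (H1 B : set sfield) (ipH1 B) (L2box B) (ipbox B) id.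
Proof.
split; first exact: wlin_id.
exists 1 => // f Hf; rewrite mul1r; apply: le_trans (ipbox_partial_le_ipH1 e3 Hf).
by rewrite lerDl ipbox_partial_ge0.
Qed.

Lemma bdd_partial B i :
  bdd_map (H1 B : set sfield) (ipH1 B) (L2box B) (ipbox B) (partial B i).
Proof.
split; first exact: wlin_partial.
exists 1 => // f Hf; rewrite mul1r; apply: le_trans (ipbox_partial_le_ipH1 i Hf).
by rewrite lerDr; apply: ipbox_ge0; exact: Hf.1.
Qed.

Section trace_map.
Variables (B : box R) (s : bool).
Hypothesis lh : lo B e3 < hi B e3.
Local Notation L2f := (L2 (leb2 R) (face_dom B e3) : set (R * R -> R)).
Local Notation ipf := (ip (leb2 R) (face_dom B e3)).

Lemma traceP f : H1 B f -> is_trace B e3 s f (trace B e3 s f).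
Proof.
move=> Hf; have [C _ hC] := @trace_exists R B s lh; have [g tg _] := hC f Hf.
by apply: (@xgetPex _ (fun=> 0) [set g | is_trace B e3 s f g]); exists g.
Qed.

Lemma trace_eq f g : H1 B f -> is_trace B e3 s f g ->
  ae_eq (leb2 R) (face_dom B e3) (trace B e3 s f) g.
Proof. by move=> Hf; exact: (is_trace_unique lh (traceP Hf)). Qed.

(** The estimate is known for the trace built in [trace_exists]; the trace selected by [trace]
    agrees with it almost everywhere by uniqueness. *)
Lemma bdd_trace :
  bdd_map (H1 B : set sfield) (ipH1 B) L2f ipf (trace B e3 s).
Proof.
have mF := measurable_face_dom B.
have [C C0 hC] := @trace_exists R B s lh.
split; first split.
- by move=> f Hf; have [] := traceP Hf.
- move=> w Lw a f g Hf Hg; have sH := subsp_H1 B.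
  have Hfg : H1 B (a *: f + g) by apply: sH.2.
  have t1 := is_trace_lin a Hf Hg (traceP Hf) (traceP Hg).
  apply: (etrans (ip_ael mF (traceP Hfg).1 t1.1 Lw (trace_eq Hfg t1))).
  have [l _] := inner_bilin (inner_L2 (leb2 R) mF).
  by apply: (l _ Lw); [exact: (traceP Hf).1|exact: (traceP Hg).1].
- exists C => // f Hf; have [g tg gC] := hC f Hf.
  have Lt := (traceP Hf).1.
  rewrite (ip_ael mF Lt tg.1 Lt (trace_eq Hf tg)).
  have -> : ip (leb2 R) (face_dom B e3) g (trace B e3 s f) =
            ip (leb2 R) (face_dom B e3) (trace B e3 s f) g.
    exact: (inner_sym (inner_L2 (leb2 R) mF) tg.1 Lt).
  rewrite (ip_ael mF Lt tg.1 tg.1 (trace_eq Hf tg)).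
  by apply: le_trans gC _; rewrite ler_wpM2l// ipbox_partial_le_ipH1.
Qed.

End trace_map.

Lemma subsp_H1per B : subsp (H1per B : set sfield).
Proof.
have sH := subsp_H1 B; split.
  split; first exact: (subsp0 sH).
  by move=> i _; exists 0; split; exact: is_trace0.
move=> a f g [Hf hf] [Hg hg]; split; first exact: sH.2.
move=> i ie; have [gf [f1 f2]] := hf i ie; have [gg [g1 g2]] := hg i ie.
by exists (a *: gf + gg); split; exact: is_trace_lin.
Qed.

Lemma subsp_H1per_trace0 B i s :
  subsp ([set f | H1per B f /\ is_trace B i s f (fun=> 0)] : set sfield).
Proof.
have sH := subsp_H1per B; split.
  by split; [exact: (subsp0 sH)|exact: is_trace0].
move=> a f g [Hf tf] [Hg tg]; split; first exact: sH.2.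
have := is_trace_lin a Hf.1 Hg.1 tf tg.
rewrite (_ : a *: (fun=> 0) + (fun=> 0) = (fun=> 0))//.
by apply/funext => y; exact: (etrans (addr0 (a * 0)) (mulr0 a)).
Qed.

Lemma subsp_H1star_b : subsp (@H1star_b R : set sfield).
Proof. exact: subsp_H1per_trace0. Qed.

Lemma subsp_H1star_f : subsp (@H1star_f R : set sfield).
Proof. exact: subsp_H1per_trace0. Qed.

Lemma subsp_vec D : subsp D -> subsp (vec D : set vfield).
Proof.
move=> sD; split=> [i|a u v Du Dv i]; first exact: (subsp0 sD).
exact: (sD.2 a _ _ (Du i) (Dv i)).
Qed.

Lemma subspI (V : lmodType R) (D D' : set V) : subsp D -> subsp D' -> subsp (D `&` D').
Proof.
move=> sD sD'; split; first by split; exact: subsp0.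
by move=> a x y [? ?] [? ?]; split; [exact: sD.2|exact: sD'.2].
Qed.

Lemma ntrace_lin B (a : R) (u v : vfield) W phi : vec (L2box B) u -> vec (L2box B) v ->
  testfun W phi -> ntrace B (a *: u + v) phi = a * ntrace B u phi + ntrace B v phi.
Proof.
move=> Lu Lv tphi; rewrite /ntrace mulr_sumr -big_split /=; apply: eq_bigr => j _.
exact: (ipbox_linl (testfun_L2box B (testfun_derive j tphi)) a (Lu j) (Lv j)).
Qed.

Lemma ntrace0 B phi : ntrace B (0 : vfield) phi = 0.
Proof.
rewrite /ntrace big1// => j _; rewrite /ipbox /ip.
by rewrite -[RHS](intR0 (leb3 R) (inside B)); apply: intR_eq => x _; rewrite mul0r.
Qed.

Lemma subsp_Vset : subsp (@Vset R : set vfield).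
Proof.
have sL := subsp_vec (subsp_L2box (@Omega_f R)).
split; first by split; [exact: (subsp0 sL)|move=> *; exact: ntrace0..].
move=> a u v [Lu u1 u2 u3] [Lv v1 v2 v3]; split; first exact: sL.2.
- by move=> phi tp; rewrite (ntrace_lin a Lu Lv tp) u1// v1// mulr0 addr0.
- by move=> phi tp; rewrite (ntrace_lin a Lu Lv tp) u2// v2// mulr0 addr0.
- by move=> i phi ie tp pp; rewrite (ntrace_lin a Lu Lv tp) (u3 i)// (v3 i)// mulr0 addr0.
Qed.

Lemma inner_vec D b : inner_on D b ->
  inner_on (vec D : set vfield) (fun u v => \sum_(i < 3) b (u i) (v i)).
Proof.
move=> ib; apply: inner_sum; first exact: subsp_vec (inner_subsp ib).
move=> i; have [l r] := inner_bilin ib; split.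
- exact: subsp_vec (inner_subsp ib).
- by split=> [w Dw|w Dw] a u v Du Dv; [exact: (l _ (Dw i) a)|exact: (r _ (Dw i) a)].
- by move=> u v Du Dv; exact: (inner_sym ib).
- by move=> u Du; exact: (inner_ge0 ib).
Qed.

Lemma vec_coord_le D b (u : vfield) i : inner_on D b -> vec D u ->
  b (u i) (u i) <= \sum_(i < 3) b (u i) (u i).
Proof.
move=> ib Du; rewrite (bigD1 i)//= lerDl; apply: sumr_ge0 => j _.
exact: (inner_ge0 ib (Du j)).
Qed.

Lemma bdd_map_vec (W : lmodType R) (E : set W) c D b F i : inner_on D b ->
  bdd_map D b E c F ->
  bdd_map (vec D : set vfield) (fun u v => \sum_(i < 3) b (u i) (v i)) E c (fun u => F (u i)).
Proof.
move=> ib hF; apply: (bdd_map_comp (P := fun u : vfield => u i) hF) => //.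
by move=> u Du; apply: vec_coord_le Du.
Qed.

End sobolev_inner.

(** * Test functions in time *)

Section time_bumps.
Variable R : realType.
Local Notation mu := (@lebesgue_measure R).
Local Notation mR := (measurableTypeR R).
Variable T : R.
Implicit Types (psi a m g h : R -> R).

(** The support keeps away from both ends: from 0 so that the primitive vanishes near 0, from T so
    that int_t^T psi vanishes near T. *)
Definition time_bump psi := smooth psi /\
  exists s t, [/\ 0 < s, s <= t, t < T & forall x, psi x != 0 -> s <= x <= t].

(** For x <= 0 the interval is empty and the value is 0. *)
Definition prim psi x := \int[mu]_(t in itv0 x) psi t.

Lemma time_bump_rbump k : 0 < T -> time_bump (rbump 0 T k).
Proof.
move=> T0; split; first exact: smooth_rbump.
have [[x /rbump_neq0[h1 h2 h3 h4]]|h] := pselect (exists x, rbump 0 T k x != 0).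
  exists (ratr k.1.1), (ratr k.1.2); split; [exact: h1|exact: le_trans h2 h3|exact: h4|].
  by move=> y /rbump_neq0[_ -> -> _].
exists (T / 2), (T / 2); split; [by rewrite divr_gt0|by []|by lra|].
by move=> y hy; exfalso; apply: h; exists y.
Qed.

Lemma time_bumpB psi psi' c : time_bump psi -> time_bump psi' ->
  time_bump (fun x => psi x + c * psi' x).
Proof.
move=> [s1 [a [b [a0 ab bT h]]]] [s2 [a' [b' [a'0 ab' b'T h']]]]; split.
  by apply: smoothD => //; apply: (smoothM (f := cst c)) => //; exact: smooth_cst.
exists (Num.min a a'), (Num.max b b'); split.
- by rewrite lt_min a0.
- by rewrite ge_min le_max ab.
- by rewrite gt_max bT.
- move=> x; have [p0|p0] := eqVneq (psi x) 0.
    rewrite p0 add0r mulf_eq0 negb_or => /andP[_ /h' /andP[h1 h2]].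
    by rewrite ge_min le_max h1 h2 !orbT.
  by move=> _; have /andP[h1 h2] := h _ p0; rewrite ge_min le_max h1 h2.
Qed.

Lemma intble_continuous psi (x : R) : continuous psi -> intble mu (itv0 x) psi.
Proof.
move=> cpsi; apply: (@intbleS _ _ _ mu _ (`[0, x]%classic : set mR)).
- exact: measurable_itv0.
- exact: measurable_itv.
- by move=> t; rewrite itv0E /= in_itv /= => /andP[/ltW -> /ltW ->].
- apply: continuous_compact_integrable; first exact: segment_compact.
  exact: continuous_subspaceT.
Qed.

Section with_psi.
Variable psi : R -> R.
Hypothesis tpsi : time_bump psi.
Let cpsi : continuous psi. Proof. exact: smooth_continuous tpsi.1. Qed.

Lemma is_derive_prim (x : R) : is_derive x 1 (prim psi : R -> R) (psi x).
Proof.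
have [_ [s [t [s0 st tT h]]]] := tpsi.
(* Around x <= 0 the primitive is identically zero, since [psi] vanishes up to s > 0. The
   fundamental theorem of calculus is used for x > 0. *)
have [x0|x0] := leP x 0.
  have psi0 y : y < s -> psi y = 0.
    by move=> ys; apply: contraTeq ys => /h /andP[sy _]; rewrite -leNgt.
  rewrite psi0; last exact: le_lt_trans s0.
  have := is_derive_cst (0 : R) x (1 : R); apply: near_eq_is_derive.
  near=> y; apply: esym; rewrite /prim -[RHS](intR0 mu (itv0 y)).
  apply: intR_eq => z; rewrite itv0E => /andP[_ zy]; apply: psi0; apply: lt_trans zy _.
  by near: y; apply: lt_nbhsl; exact: le_lt_trans s0.
have I : mu.-integrable [set` Interval (BRight (0 : R)) (BRight (x + 1))] (EFin \o psi).
  apply: (@intbleS _ _ _ mu _ (`[0, x + 1]%classic : set mR)).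
  - exact: measurable_itv.
  - exact: measurable_itv.
  - by move=> r; rewrite /= !in_itv /= => /andP[/ltW -> ->].
  - apply: continuous_compact_integrable; first exact: segment_compact.
    exact: continuous_subspaceT.
have xx1 : x < x + 1 by lra.
have := @continuous_FTC1 R psi (BRight 0) x (x + 1) xx1 I.
have -> : (fun y => \int[mu]_(r in [set` Interval (BRight 0) (BRight y)]) psi r) = prim psi.
  apply/funext => y; rewrite /prim -Rintegral_itv_bndo_bndc//.
  exact: (intble_continuous y cpsi).
move=> /(_ x0) h1; have [d e] := h1 (@cpsi x).
by apply: DeriveDef; [exact: d|rewrite -derive1E; exact: e].
Unshelve. all: by end_near. Qed.

Lemma smooth_prim : smooth (prim psi).
Proof. exact: smooth_primitive tpsi.1 is_derive_prim. Qed.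

Lemma prim_high : exists2 t, t < T & forall x, t <= x -> prim psi x = prim psi T.
Proof.
have [_ [s [t [s0 st tT h]]]] := tpsi; exists ((t + T) / 2); first by lra.
have psi0 r : t < r -> psi r = 0.
  by move=> tr; apply: contraTeq tr => /h /andP[_ rt]; rewrite -leNgt.
move=> x xt; rewrite /prim Rintegral_mkcond [RHS]Rintegral_mkcond.
apply: intR_eq => r _; rewrite !patchE; have [/psi0 ->|rt] := ltP t r.
  by rewrite !if_same.
have -> // : (r \in itv0 x) = (r \in itv0 T).
apply/idP/idP => /set_mem; rewrite itv0E => /andP[r0 _]; apply/mem_set; rewrite itv0E r0 /=.
  by lra.
by lra.
Qed.

Lemma prim_low : exists2 s, 0 < s & forall x, x <= s -> prim psi x = 0.
Proof.
have [_ [s [t [s0 st tT h]]]] := tpsi; exists s => // x xs.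
rewrite /prim -[RHS](intR0 mu (itv0 x)); apply: intR_eq => r.
rewrite itv0E => /andP[_ rx]; have rs := lt_le_trans rx xs.
by apply: contraTeq rs => /h /andP[+ _]; rewrite -leNgt.
Qed.

End with_psi.

Let mT := measurable_itv0 T.
Let mTT : measurable ((itv0 T : set mR) `*` (itv0 T : set mR)).
Proof. exact: measurableX. Qed.

Lemma prim_triangle psi a : intble mu (itv0 T) psi -> intble mu (itv0 T) a ->
  intble mu (itv0 T) (fun t => prim psi t * a t).
Proof.
move=> Ip Ia.
have It : intble (leb2 R) (itv0 T `*` itv0 T) (fun z : mR * mR => psi z.1 * a z.2).
  exact: (intble_tensor mT mT Ip Ia).
have Is t : itv0 T t -> intble mu (itv0 T) (fun s => psi s * a t).
  by move=> _; apply: (intble_eq mT _ (intbleZ (a t) mT Ip)) => s _; rewrite mulrC.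
apply: (intble_eq mT _ (intble_triangle (k := fun r s => psi r * a s) It (lexx T))) => t Tt.
rewrite RintegralZr//; first exact: measurable_itv0.
apply: (intbleS (measurable_itv0 t) mT _ Ip).
by apply: itv0S; move: Tt; rewrite itv0E => /andP[_ /ltW].
Qed.

(* Fubini on the triangle *)
Lemma prim_by_parts psi a : intble mu (itv0 T) psi -> intble mu (itv0 T) a ->
  \int[mu]_(t in itv0 T) (prim psi t * a t) +
  \int[mu]_(t in itv0 T) (psi t * prim a t) =
  prim psi T * \int[mu]_(t in itv0 T) a t.
Proof.
move=> Ip Ia.
(* Symmetrized, so that the triangle carries half of the integral over the square, and the latter
   factorizes. *)
pose k r s := psi r * a s + psi s * a r.
have I1 : intble (leb2 R) (itv0 T `*` itv0 T) (fun z : mR * mR => psi z.1 * a z.2).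
  exact: (intble_tensor mT mT Ip Ia).
have I2 : intble (leb2 R) (itv0 T `*` itv0 T) (fun z : mR * mR => psi z.2 * a z.1).
  apply: (intble_eq mTT _ (intble_tensor mT mT Ia Ip)) => z _; exact: mulrC.
have Ik2 : intble (leb2 R) (itv0 T `*` itv0 T) (fun z : mR * mR => k z.1 z.2).
  exact: intbleD.
have Is (f : R -> R) t : intble mu (itv0 T) f -> itv0 T t -> intble mu (itv0 t) f.
  move=> If; rewrite itv0E => /andP[_ /ltW tT].
  exact: (intbleS (measurable_itv0 t) mT (itv0S tT) If).
have Ir (f : R -> R) (c : R) E : measurable (E : set mR) -> intble mu E f ->
    intble mu E (fun s => f s * c).
  by move=> mE If; apply: (intble_eq mE _ (intbleZ c mE If)) => s _; exact: mulrC.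
have Ik t : itv0 T t -> intble mu (itv0 T) (k ^~ t).
  by move=> _; apply: intbleD => //; [exact: Ir|exact: intbleZ].
have := intR_triangle Ik2 Ik (lexx T) (fun r s => addrC _ _).
have -> : \int[mu]_(s in itv0 T) \int[mu]_(r in itv0 s) k r s =
    \int[mu]_(t in itv0 T) (prim psi t * a t + psi t * prim a t).
  apply: intR_eq => t Tt; rewrite RintegralD; last 3 first.
  - exact: measurable_itv0.
  - by apply: Ir; [exact: measurable_itv0|exact: Is].
  - by apply: intbleZ; [exact: measurable_itv0|exact: Is].
  rewrite RintegralZr; [|exact: measurable_itv0|exact: Is].
  by rewrite RintegralZl; [|exact: measurable_itv0|exact: Is].
have J2 : intble mu (itv0 T) (fun t => psi t * prim a t).
  by apply: (intble_eq mT _ (prim_triangle Ia Ip)) => t _; exact: mulrC.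
rewrite RintegralD//; last exact: prim_triangle.
move=> ->; set A := \int[mu]_(t in itv0 T) a t; set P := prim psi T.
transitivity (2^-1 * \int[mu]_(s in itv0 T) (A * psi s + P * a s)).
  congr (_ * _); apply: intR_eq => s Ts; rewrite /k.
  rewrite (RintegralD mT (Ir _ (a s) _ mT Ip : intble mu (itv0 T) (fun r => psi r * a s)) (intbleZ (psi s) mT Ia)) /=.
  rewrite (RintegralZl _ mT Ia) (RintegralZr _ mT Ip) -/(prim psi T) -/A -/P.
  by ring.
rewrite (RintegralD mT (intbleZ A mT Ip) (intbleZ P mT Ia)).
by rewrite (RintegralZl _ mT Ip) (RintegralZl _ mT Ia) -/A -/(prim psi T) -/P; field.
Qed.

Lemma intble_prim_cst a : intble mu (itv0 T) a -> intble mu (itv0 T) (prim a).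
Proof.
move=> Ia; have I1 : intble mu (itv0 T) (cst (1 : R)).
  by apply: intble_cst => //; exact: itv0_fin.
by apply: (intble_eq mT _ (prim_triangle Ia I1)) => t _; rewrite mulr1.
Qed.

Let ae_eq0_rbump f : intble mu (itv0 T) f ->
  (forall k, \int[mu]_(x in itv0 T) (f x * rbump 0 T k x) = 0) ->
  ae_eq mu (itv0 T) f (cst 0).
Proof. by move=> If fk; have [_ _ h] := @determining_rbump R 0 T; exact: h. Qed.

Lemma intble_continuousM psi f : continuous psi -> intble mu (itv0 T) f ->
  intble mu (itv0 T) (fun t => psi t * f t).
Proof.
move=> cp If.
have [M hM] : exists M, forall t, itv0 T t -> `|psi t| <= M.
  have [T0|T0] := leP T 0.
    by exists 0 => t; rewrite itv0E => /andP[t0 tT]; lra.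
  have cn : {within `[0, T], continuous (fun t => `|psi t|)}.
    by apply: continuous_subspaceT => t; apply: cvg_norm; exact: cp.
  have [c _ hc] := EVT_max (ltW T0) cn; exists `|psi c| => t.
  by rewrite itv0E => /andP[t0 tT]; apply: hc; rewrite in_itv /= !ltW.
apply: (@intble_le _ _ _ mu _ _ (fun t => M * `|f t|)) => //.
- apply: measurable_funM; last exact: intble_meas If.
  by apply: measurable_funTS; exact: continuous_measurable_fun.
- by move=> t Tt; rewrite normrM ler_wpM2r// hM.
- by apply: intbleZ => //; exact: intble_norm.
Qed.

Lemma intble_time_bump psi f : time_bump psi -> intble mu (itv0 T) f ->
  intble mu (itv0 T) (fun t => psi t * f t).
Proof. by move=> [sp _]; apply: intble_continuousM; exact: smooth_continuous. Qed.

(* phi(t) = int_t^T psi, for which phi' = - psi *)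
Lemma ae_eq0_of_weak_eq m a : intble mu (itv0 T) m -> intble mu (itv0 T) a ->
  (forall psi, time_bump psi ->
    \int[mu]_(t in itv0 T) (psi t * m t + (prim psi T - prim psi t) * a t) = 0) ->
  {ae mu, forall t, itv0 T t -> m t + \int[mu]_(s in itv0 t) a s = 0}.
Proof.
move=> Im Ia h; have [T0|T0] := leP T 0.
  by apply: aeW => t; rewrite itv0E => /andP[t0 tT]; lra.
have Ip := intble_prim_cst Ia.
have := @ae_eq0_rbump (fun t => m t + prim a t) (intbleD mT Im Ip).
apply => k; have tb := time_bump_rbump k T0; have := h _ tb.
move: (rbump 0 T k) tb => psi tb.
have Ipsi : intble mu (itv0 T) psi by apply: intble_continuous; exact: smooth_continuous tb.1.
have I1 := intble_time_bump tb Im; have I2 := intble_time_bump tb Ip; have I3 := prim_triangle Ipsi Ia.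
rewrite RintegralD//; last first.
  apply: (intble_eq mT _ (intbleB mT (intbleZ (prim psi T) mT Ia) I3)) => t _.
  by rewrite mulrBl.
rewrite (_ : \int[mu]_(t in itv0 T) ((prim psi T - prim psi t) * a t) =
    \int[mu]_(t in itv0 T) (psi t * prim a t)); last first.
  have <- := addKr (\int[mu]_(t in itv0 T) (prim psi t * a t))
    (\int[mu]_(t in itv0 T) (psi t * prim a t)).
  rewrite (prim_by_parts Ipsi Ia) -(RintegralZl _ mT Ia) addrC.
  rewrite -RintegralB//; last exact: intbleZ.
  by apply: intR_eq => t _; rewrite mulrBl.
rewrite -RintegralD// => E; rewrite -[RHS]E; apply: intR_eq => t _; ring.
Qed.

Lemma testfun1_prim psi : time_bump psi -> prim psi T = 0 -> testfun1 (itv0 T) (prim psi).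
Proof.
move=> tb p0; have sp := smooth_prim tb.
have [s s0 hs] := prim_low tb; have [t tT ht] := prim_high tb.
have S : supp (prim psi) `<=` `[s, t]%classic.
  rewrite [X in _ `<=` X]((closure_id _).1 (@itv_closed _ _ s t)); apply: closureS.
  move=> x /= x0; rewrite in_itv /=; apply/andP; split.
    by apply: contraR x0; rewrite -ltNge => /ltW /hs ->.
  by apply: contraR x0; rewrite -ltNge => /ltW /ht ->; rewrite p0.
split.
- by move=> n x; exact: smooth_derive1n.
- apply: (subclosed_compact _ (@segment_compact R s t) S); exact: closed_closure.
- move=> x /S; rewrite /= in_itv itv0E /= => /andP[sx xt].
  by rewrite (lt_le_trans s0)// (le_lt_trans xt).
Qed.

(** The du Bois-Reymond argument. The primitive of a bump of mass zero is a test function;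
    subtracting from an arbitrary bump a multiple of one fixed bump [psi0] of nonzero mass reaches
    mass zero. The fixed bump determines the constant, and the bumps determine the function. *)
Lemma weak_derivative_primitive g h : 0 < T -> intble mu (itv0 T) g -> intble mu (itv0 T) h ->
  (forall phi, testfun1 (itv0 T) phi ->
    \int[mu]_(t in itv0 T) (derive1 phi t * g t) = - \int[mu]_(t in itv0 T) (phi t * h t)) ->
  exists C, {ae mu, forall t, itv0 T t -> g t - \int[mu]_(s in itv0 t) h s = C}.
Proof.
move=> T0 Ig Ih H; have Ip := intble_prim_cst Ih.
pose J psi f := \int[mu]_(t in itv0 T) (psi t * f t).
pose f t := g t - prim h t; have If : intble mu (itv0 T) f by exact: intbleB.
have I1 : intble mu (itv0 T) (cst (1 : R)).
  by apply: intble_cst => //; exact: itv0_fin.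
have Ib psi : time_bump psi -> intble mu (itv0 T) psi.
  by move=> tb; apply: intble_continuous; exact: smooth_continuous tb.1.
have J1 psi : J psi (cst 1) = prim psi T by apply: intR_eq => t _; rewrite mulr1.
have J0 psi : time_bump psi -> prim psi T = 0 -> J psi f = 0.
  move=> tb p0; have := H _ (testfun1_prim tb p0).
  have -> : \int[mu]_(t in itv0 T) (derive1 (prim psi) t * g t) = J psi g.
    apply: intR_eq => t _; rewrite derive1E.
    by have [_ ->] := is_derive_prim tb t.
  have := prim_by_parts (Ib _ tb) Ih; rewrite p0 mul0r => /eqP.
  rewrite addr_eq0 => /eqP -> E; rewrite opprK in E.
  have -> : J psi f = J psi g - J psi (prim h).
    rewrite /J -RintegralB//; try exact: intble_time_bump.
    by apply: intR_eq => t _; rewrite mulrBr.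
  by rewrite E /J subrr.
have [k0 hk0] : exists k, prim (rbump 0 T k) T != 0.
  apply: contrapT => no.
  have : ae_eq mu (itv0 T) (cst (1 : R)) (cst 0).
    apply: ae_eq0_rbump => // k; apply: contrapT => hk; apply: no; exists k.
    by apply/eqP => E; apply: hk; rewrite -[RHS]E; apply: intR_eq => t _; rewrite mul1r.
  move=> /(ae_itv_exists T0) [x x0T] /(_ _)/=.
  rewrite itv0E => /(_ x0T) /eqP; by rewrite oner_eq0.
have tb0 := time_bump_rbump k0 T0; move: (rbump 0 T k0) hk0 tb0 => psi0 c0 tb0.
exists (J psi0 f / prim psi0 T); set C := _ / _.
have : ae_eq mu (itv0 T) (fun t => f t - C) (cst 0).
  apply: ae_eq0_rbump.
    by apply: intbleB => //; apply: intble_cst => //; exact: itv0_fin.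
  move=> k; have tb := time_bump_rbump k T0; move: (rbump 0 T k) tb => psi tb.
  pose c := - (prim psi T / prim psi0 T).
  have tbc := time_bumpB c tb tb0.
  have Jc w : intble mu (itv0 T) w ->
      J (fun x => psi x + c * psi0 x) w = J psi w + c * J psi0 w.
    move=> Iw; rewrite /J -RintegralZl//; last exact: intble_time_bump.
    rewrite -RintegralD//; [|exact: intble_time_bump|by apply: intbleZ => //; exact: intble_time_bump].
    by apply: intR_eq => t _; ring.
  have pc : prim (fun x => psi x + c * psi0 x) T = 0.
    by rewrite -J1 Jc// !J1 /c; field.
  have := J0 _ tbc pc; rewrite Jc// => E.
  transitivity (J psi f - C * J psi (cst 1)).
    rewrite /J -RintegralZl//; last exact: intble_time_bump.
    rewrite -RintegralB//; [|exact: intble_time_bump|by apply: intbleZ => //; exact: intble_time_bump].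
    by apply: intR_eq => t _; rewrite /=; ring.
  by rewrite J1 -[RHS]E /c /C; field.
by apply: aeS => t h0 /h0 /eqP; rewrite subr_eq0 => /eqP.
Qed.

End time_bumps.

(** * Vector-valued test functions in time and initial values *)

Section time_tests.
Variable R : realType.
Local Notation mu := (@lebesgue_measure R).
Local Notation mR := (measurableTypeR R).
Variable T : R.
Variables (V : lmodType R) (D : set V) (b : V -> V -> R).
Hypothesis ib : inner_on D b.
Local Notation X := (NSpace D (hnorm b)).
Let sD := inner_subsp ib.

Lemma is_derive_cvg_dnbhs (phi : R -> R) (t l : R) : is_derive t 1 phi l ->
  (s - t)^-1 * (phi s - phi t) @[s --> t^'] --> l.
Proof.
move=> [d e]; have c : h^-1 *: (phi (h *: 1 + t) - phi t) @[h --> (0 : R)^'] --> l.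
  by rewrite -e; exact: d.
have sh : (s - t) @[s --> t^'] --> (0 : R)^'.
  move=> P [eps /= eps0 hP]; exists eps => // s /= ts st; apply: hP => /=.
    by rewrite sub0r normrN distrC.
  by rewrite subr_eq0.
have := cvg_comp _ _ sh c; apply: cvg_trans; apply: near_eq_cvg; near=> s.
by rewrite /comp /GRing.scale /= mulr1 subrK.
Unshelve. all: by end_near. Qed.

Lemma C1_0_scale (phi phi' : R -> R) e tau : D e ->
  (forall t : R, is_derive t 1 phi (phi' t)) -> continuous phi' ->
  tau < T -> (forall t, tau <= t -> phi t = 0) ->
  C1_0 T X (fun t => phi t *: e) (fun t => phi' t *: e).
Proof.
move=> De dphi cphi tauT phi0.
have c0 (F : set_system R) (f : R -> R) : Filter F -> f s @[s --> F] --> (0 : R) ->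
    `|f s| * hnorm b e @[s --> F] --> (0 : R).
  move=> FF c; rewrite -[X in _ --> X](mul0r (hnorm b e)) -[X in X * _](@normr0 R R).
  by apply: cvgM; [exact: cvg_norm|exact: cvg_cst].
split.
- by move=> t _; split; exact: subspZ.
- move=> t _; apply: cvg_within_filter.
  rewrite (_ : (fun s => _) = fun s =>
      `|(s - t)^-1 * (phi s - phi t) - phi' t| * hnorm b e); last first.
    by apply/funext => s; rewrite /= -scalerBl scalerA -scalerBl (hnormZ ib).
  apply: c0; rewrite -[X in _ --> X](subrr (phi' t)); apply: cvgB; last exact: cvg_cst.
  exact: is_derive_cvg_dnbhs.
- move=> t _; apply: cvg_within_filter.
  rewrite (_ : (fun s => _) = fun s => `|phi' s - phi' t| * hnorm b e); last first.
    by apply/funext => s; rewrite /= -scalerBl (hnormZ ib).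
  apply: c0; rewrite -[X in _ --> X](subrr (phi' t)); apply: cvgB; last exact: cvg_cst.
  exact: cphi.
- exists tau => // t _ tt; rewrite /= phi0// scale0r.
  exact: (hnorm0 ib).
Qed.

(** This scalar factor vanishes near T but in general not at t = 0, as the class of test functions
    permits. The resulting terms with initial data are the same for both solutions. *)
Lemma C1_0_prim psi e : time_bump T psi -> D e ->
  C1_0 T X (fun t => (prim psi T - prim psi t) *: e) (fun t => - psi t *: e).
Proof.
move=> tb De; have cp := smooth_continuous tb.1; have [tau tauT htau] := prim_high tb.
apply: (@C1_0_scale (fun t => prim psi T - prim psi t) _ _ tau) => //.
- move=> t; have [d1 d2] := is_deriveB (is_derive_cst (prim psi T) t 1) (is_derive_prim tb t).
  by apply: DeriveDef; [exact: d1|apply: (etrans d2); rewrite sub0r].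
- by move=> t; apply: cvgN; exact: cp.
- by move=> t /htau ->; rewrite subrr.
Qed.

Lemma intR_itv0_cvg0 (h : R -> R) (s : nat -> R) : intble mu (itv0 T) h ->
  (forall n, 0 < s n < T) -> s n @[n --> \oo] --> (0 : R) ->
  \int[mu]_(x in itv0 (s n)) h x @[n --> \oo] --> (0 : R).
Proof.
move=> Ih hs s0; have mT := measurable_itv0 T.
have sS n : itv0 T `&` itv0 (s n) = itv0 (s n).
  by apply: setIidr; apply: itv0S; case/andP: (hs n) => _ /ltW.
rewrite (_ : (fun n => _) = fun n => \int[mu]_(x in itv0 T) (h \_ (itv0 (s n))) x).
  rewrite -[X in _ --> X](intR0 mu (itv0 T)).
  apply: (@intR_cvg_lim _ _ _ mu (itv0 T) _ _ (fun x => `|h x|)) => //.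
  - move=> n; apply/(measurable_restrict _ (measurable_itv0 _) (measurable_itv0 _)).
    by rewrite sS; apply: measurable_funS (intble_meas Ih) => //; rewrite -(sS n); exact: subIsetl.
  - move=> x; rewrite itv0E => /andP[x0 xt]; apply: cvg_near_cst; near=> n.
    rewrite patchE memNset// itv0E x0/= ltNge => /negP; apply; apply: ltW.
    by near: n; apply: (cvgr_lt (0 : R)).
  - exact: intble_norm.
  - by move=> n x _; rewrite patchE; case: ifP => _; rewrite ?normr0.
by apply/funext => n; rewrite -Rintegral_mkcondr sS.
Unshelve. all: by end_near. Qed.

(** Times tending to 0 are picked where the two functions agree with their continuous
    representatives and the identity holds. Along them the difference tends to x - x and the
    integral of [h] tends to 0, hence so does the constant. *)
Lemma initial_value_cst (u u' : R -> V) x e (h : R -> R) (C : R) : 0 < T -> D x -> D e ->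
  (forall t, itv0 T t -> D (u t)) -> (forall t, itv0 T t -> D (u' t)) ->
  initial_value T X u x -> initial_value T X u' x -> intble mu (itv0 T) h ->
  {ae mu, forall t, itv0 T t -> b (u t - u' t) e - \int[mu]_(s in itv0 t) h s = C} ->
  C = 0.
Proof.
move=> T0 Dx De Du Du' [g [Dg cg gu g0]] [g' [Dg' cg' gu' g'0]] Ih hC.
have ae := aeI (aeI gu gu') hC.
have ex n : exists t, 0 < t < Num.min T n.+1%:R^-1 /\
    (((0 < t < T -> nrm X (g t - u t) = 0) /\ (0 < t < T -> nrm X (g' t - u' t) = 0)) /\
    (itv0 T t -> b (u t - u' t) e - \int[mu]_(s in itv0 t) h s = C)).
  have m0 : 0 < Num.min T n.+1%:R^-1 by rewrite lt_min T0 invr_gt0 ltr0n.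
  by have [t t0 ht] := ae_itv_exists m0 ae; exists t.
have [s hs] := choice ex.
have sT n : 0 < s n < T by have [/andP[-> +] _] := hs n; rewrite lt_min => /andP[->].
have s0 : s n @[n --> \oo] --> (0 : R).
  apply: (@squeeze_cvgr _ _ _ _ (cst 0) (fun n => n.+1%:R^-1)).
  - apply: nearW => n; have [/andP[a +] _] := hs n; rewrite lt_min => /andP[_ c].
    by rewrite !ltW.
  - exact: cvg_cst.
  - exact: cvg_harmonic.
have cw : s n @[n --> \oo] --> within `[0, T]%classic (nbhs (0 : R)).
  move=> P /s0 hP; have {}hP : \forall n \near \oo, `[0, T]%classic (s n) -> P (s n) by exact: hP.
  suff : \forall n \near \oo, P (s n) by [].
  apply: filterS hP => n /=; apply.
  by have /andP[a c] := sT n; rewrite in_itv /= !ltW.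
have T00 : (0 : R) <= 0 <= T by rewrite lexx ltW.
have c1 := cvg_comp _ _ cw (cg 0 T00); have c2 := cvg_comp _ _ cw (cg' 0 T00).
have c3 := intR_itv0_cvg0 Ih sT s0.
have c4 : (hnorm b (g (s n) - g 0) + hnorm b (g' (s n) - g' 0)) * hnorm b e +
    `|\int[mu]_(x in itv0 (s n)) h x| @[n --> \oo] --> (0 : R).
  rewrite -[X in _ --> X]addr0 -[X in _ --> X + _](mul0r (hnorm b e)).
  apply: cvgD; last by rewrite -[X in _ --> X](@normr0 R R); exact: cvg_norm.
  apply: cvgM; last exact: cvg_cst.
  by rewrite -[X in _ --> X]addr0; apply: cvgD; [exact: c1|exact: c2].
suff : (fun=> C : R) n @[n --> \oo] --> (0 : R).
  by move=> c5; apply: (cvg_unique (@Rhausdorff R) (cvg_cst C) c5).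
apply: cvg0_le c4 => n /=.
have [_ [[h1 h2] h3]] := hs n; have tT := sT n; have {}h1 := h1 tT; have {}h2 := h2 tT.
rewrite -(h3 tT); apply: le_trans (ler_normB _ _) _; rewrite lerD2r.
move/andP: (tT) => [t0 tT']; have tTT : 0 <= s n <= T by rewrite !ltW.
have Dut := Du _ tT; have Du't := Du' _ tT; have Dgt := Dg _ tTT; have Dg't := Dg' _ tTT.
have Dg0 := Dg _ T00; have Dg'0 := Dg' _ T00.
move: (s n) h1 h2 tT tTT Dut Du't Dgt Dg't {h3 t0 tT'} => t h1 h2 _ _ Dut Du't Dgt Dg't.
apply: le_trans (inner_CS ib (subspB sD Dut Du't) De) _.
apply: ler_wpM2r; first exact: hnorm_ge0.
(* Triangle inequality along u(t), g(t), g(0), x, g'(0), g'(t), u'(t), with t one of the picked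
   times: only the second and the fifth step can have nonzero length, and both tend to 0. *)
have tri a c d : D a -> D c -> D d -> hnorm b (a - d) <= hnorm b (a - c) + hnorm b (c - d).
  move=> Da Dc Dd; have -> : a - d = (a - c) + (c - d) by rewrite addrA subrK.
  by apply: (hnorm_triangle ib); exact: subspB.
have sym a c : D a -> D c -> hnorm b (a - c) = hnorm b (c - a) by exact: (hnormB_sym ib).
rewrite /= in h1 h2 g0 g'0.
have t1 := tri _ _ _ Dut Dgt Du't; have t2 := tri _ _ _ Dgt Dg0 Du't.
have t3 := tri _ _ _ Dg0 Dx Du't; have t4 := tri _ _ _ Dx Dg'0 Du't.
have t5 := tri _ _ _ Dg'0 Dg't Du't.
rewrite (sym _ _ Dut Dgt) h1 in t1; rewrite g0 in t3; rewrite (sym _ _ Dx Dg'0) g'0 in t4.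
rewrite h2 (sym _ _ Dg'0 Dg't) in t5.
move: t1 t2 t3 t4 t5; do !(move: (hnorm b _) => ?); lra.
Qed.

End time_tests.

(** * A function with zero trace at x_3 = 1 and null derivative in x_3 *)

Section vanishing_pressure.
Variable R : realType.
Local Notation mu := (@lebesgue_measure R).
Local Notation mR := (measurableTypeR R).
Local Notation R3 := (R * R * R)%type.
Local Notation Ob := (@Omega_b R).

Lemma time_bump_shift (l h T : R) k : 0 < l -> l < h -> h < T -> time_bump T (rbump l h k).
Proof.
move=> l0 lh hT; split; first exact: smooth_rbump.
have [[x /rbump_neq0[h1 h2 h3 h4]]|n] := pselect (exists x, rbump l h k x != 0).
  exists (ratr k.1.1), (ratr k.1.2); split.
  - exact: lt_trans h1.
  - exact: le_trans h2 h3.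
  - exact: lt_trans hT.
  - by move=> y /rbump_neq0[_ -> -> _].
exists l, l; split=> //; first exact: lt_trans hT.
by move=> y hy; exfalso; apply: n; exists y.
Qed.

Lemma rbump_mass_neq0 (l h T : R) : 0 < l -> l < h -> h < T ->
  exists k, prim (rbump l h k) T != 0.
Proof.
move=> l0 lh hT; apply: contrapT => no.
have mD := measurable_itv `]l, h[ : measurable (`]l, h[%classic : set mR).
have D_T : itv0 T `&` `]l, h[%classic = `]l, h[%classic.
  apply: setIidr => x; rewrite /= in_itv itv0E /= => /andP[lx xh].
  by rewrite (lt_trans l0 lx) (lt_trans xh hT).
have : ae_eq mu (`]l, h[%classic : set mR) (cst (1 : R)) (cst 0).
  have [_ _ det] := @determining_rbump R l h; apply: det.
    apply: intble_cst => //; exact: (itv_fin (Box (fun=> l) (fun=> h)) e3).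
  move=> k; apply: contrapT => hk; apply: no; exists k; apply/eqP => E; apply: hk.
  rewrite -[RHS]E /prim -[in LHS]D_T Rintegral_mkcondr; apply: intR_eq => x _.
  rewrite patchE mul1r; case: ifPn => // /negP xn; apply: esym; apply: contrapT => /eqP.
  move=> /rbump_neq0[h1 h2 h3 h4]; apply: xn; apply/mem_set => /=.
  by rewrite in_itv /= (lt_le_trans h1)// (le_lt_trans h3).
move=> /(ae_itv_exists lh)[x xlh] /(_ _) /=; rewrite in_itv /= => /(_ xlh) /eqP.
by rewrite oner_eq0.
Qed.

(* phi vanishes near x_3 = 0 but not near x_3 = 1 *)
Lemma pbump_primitive k : exists2 phi : R3 -> R, testfun (half_slab Ob e3 true) phi &
  forall x, inside Ob x -> 'D_(evec R e3) phi x = pbump Ob k x.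
Proof.
have l12 : (1 : R) < 2 by lra.
have l23 : (2 : R) < 3 by lra.
(* The primitive in x_3 of a bump inside (0, 1) keeps the mass of the bump beyond its support. A
   second bump on (1, 2), outside [Omega_b], is scaled by [lam] to cancel this mass: the primitive
   has compact support in (0, 3), and its derivative is unchanged in the box. *)
have [k' m0] := rbump_mass_neq0 ltr01 l12 l23.
pose c := rbump 0 (1 : R) k.2; pose c' := rbump (1 : R) 2 k'.
have tc : time_bump 3 c.
  have [sc [s [t [s0 st t1 h]]]] := time_bump_rbump k.2 (@ltr01 R).
  split=> //; exists s, t; split=> //; lra.
have tc' : time_bump 3 c' by exact: time_bump_shift.
pose lam := - (prim c 3 / prim c' 3).
have tb := time_bumpB lam tc tc'; pose psi x := c x + lam * c' x.
have p3 : prim psi 3 = 0.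
  have I1 := intble_continuous 3 (smooth_continuous tc.1).
  have I2 := intble_continuous 3 (smooth_continuous tc'.1).
  rewrite /prim (RintegralD (measurable_itv0 _) I1 (intbleZ lam (measurable_itv0 _) I2)).
  rewrite (RintegralZl _ (measurable_itv0 _) I2) -/(prim c 3) -/(prim c' 3) /lam.
  by field.
have sC := smooth_prim tb.
have [s s0 hs] := prim_low tb; have [t t3 ht] := prim_high tb.
exists (fun x : R3 => fbump Ob k.1 x.1 * prim psi x.2).
  apply: (@testfun_fbump R Ob _ k.1 _ s t) => //.
    move=> z z0; apply/andP; split.
      by apply: contraR z0; rewrite -ltNge => /ltW /hs ->.
    by apply: contraR z0; rewrite -ltNge => /ltW /ht ->; rewrite p3.
  rewrite face_domE => x [[x0 x1]] /=; rewrite in_itv /= => /andP[sx _].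
  move: x0 x1; rewrite /= !in_itv /= => x0 x1; split.
    by move=> j; elim/ord3_cases: j.
  by rewrite /Defs.coord /=; exact: lt_le_trans sx.
move=> x Bx.
have d1 : is_derive x (evec R e3) (fun x : R3 => fbump Ob k.1 x.1) 0.
  have cf := Ck_fbump Ob 1 k.1 (smooth_cst (1 : R)).
  have [_ /(_ e3) [d _]] := cf.
  rewrite (_ : (fun x : R3 => fbump Ob k.1 x.1) = fun x : R3 => fbump Ob k.1 x.1 * cst 1 x.2); last first.
    by apply/funext => y; rewrite mulr1.
  have := derivableP (d x).
  by rewrite (derive_slice_e3 (fun y : R3 => fbump Ob k.1 y.1 * cst 1 y.2) 0 x).
have d2 := is_derive_coord e3 e3 x sC.
have [_ e] := is_deriveM d1 d2; apply: (etrans e).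
rewrite eqxx mulr1 scaler0 addr0 derive1E; have [_ ->] := is_derive_prim tb (Defs.coord x e3).
rewrite /psi (_ : c' _ = 0) ?mulr0 ?addr0//.
apply: contrapT => /eqP /rbump_neq0[h1 h2 _ _].
have := Bx e3 => /andP[_ h3]; move: (lt_le_trans h1 h2); rewrite ltNge => /negP; apply.
exact: ltW.
Qed.

(** In Green's formula the boundary term and the term with the derivative of f vanish, so f is
    orthogonal to all x_3-derivatives of test functions that are free at the upper face. By
    [pbump_primitive] these derivatives include the determining family. *)
Lemma trace0_partial0_eq0 (f : R3 -> R) : H1 Ob f -> is_trace Ob e3 true f (fun=> 0) ->
  ipbox Ob (partial Ob e3 f) (partial Ob e3 f) = 0 -> ipbox Ob f f = 0.
Proof.
move=> Hf [_ tf] d0; have Lf := Hf.1; have Lp := L2box_partial e3 Hf.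
have mB := measurable_inside Ob.
have p0 : ae_eq (leb3 R) (inside Ob) (partial Ob e3 f) 0 by exact: (ip_eq0 mB Lp d0).
have sL := subsp_L2box Ob; have L0 := subsp0 sL.
have f0 : ae_eq (leb3 R) (inside Ob) f 0.
  apply: L2box_eq0 => // k; have [phi tphi dphi] := pbump_primitive k.
  have := tf phi tphi; have Lphi := testfun_L2box Ob tphi.
  rewrite (ipbox_ael Lp L0 Lphi p0) (lin0 sL (ipbox_linl Lphi)) addr0 mul1r.
  rewrite (_ : ip _ _ _ _ = 0); last first.
    rewrite /ip -[RHS](intR0 (leb2 R) (face_dom Ob e3)); apply: intR_eq => y _.
    by rewrite mul0r.
  move=> E; rewrite -[RHS]E; apply: intR_eq => x Bx; by rewrite dphi.
rewrite (ipbox_ael Lf L0 Lf f0); exact: (lin0 sL (ipbox_linl Lf)).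
Qed.

End vanishing_pressure.

(* Otherwise a failing unification of two such terms unfolds xget and the
   integrals. *)
Opaque partial trace.

(** * Interface traces, symmetric gradients and divergence as bounded maps *)

Section concrete_maps.
Variable R : realType.
Local Notation R3 := (R * R * R)%type.
Local Notation sfield := (R3 -> R).
Local Notation vfield := ('I_3 -> R3 -> R).
Local Notation Ob := (@Omega_b R).
Local Notation Of := (@Omega_f R).

Lemma Gamma_IE_b : @Gamma_I R = face_dom Ob e3.
Proof.
apply/seteqP; split=> [y [y1 y2] j|y h].
  by elim/ord3_cases: j => // _; rewrite /Defs.coord /emb /=.
by split; [exact: (h (@Ordinal 3 0 isT) isT)|exact: (h (@Ordinal 3 1 isT) isT)].
Qed.

Lemma Gamma_IE_f : @Gamma_I R = face_dom Of e3.
Proof.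
apply/seteqP; split=> [y [y1 y2] j|y h].
  by elim/ord3_cases: j => // _; rewrite /Defs.coord /emb /=.
by split; [exact: (h (@Ordinal 3 0 isT) isT)|exact: (h (@Ordinal 3 1 isT) isT)].
Qed.

Lemma inner_I : inner_on (L2 (leb2 R) Gamma_I : set (R * R -> R)) (@ipI R).
Proof. by rewrite /ipI Gamma_IE_b; exact: (inner_L2 (leb2 R) (measurable_face_dom Ob)). Qed.

Lemma bdd_trb : bdd_map (H1 Ob : set sfield) (ipH1 Ob)
  (L2 (leb2 R) Gamma_I : set (R * R -> R)) (@ipI R) (@trb R).
Proof. by rewrite /ipI Gamma_IE_b; apply: bdd_trace; exact: ltr01. Qed.

Lemma bdd_trf : bdd_map (H1 Of : set sfield) (ipH1 Of)
  (L2 (leb2 R) Gamma_I : set (R * R -> R)) (@ipI R) (@trf R).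
Proof. by rewrite /ipI Gamma_IE_f; apply: bdd_trace; exact: ltrN10. Qed.

Section one_box.
Variables (B : box R) (D : set sfield).
Hypotheses (sD : subsp D) (DH : D `<=` H1 B).

Lemma inner_H1S : inner_on D (ipH1 B).
Proof. exact: (inner_onS sD DH (inner_H1 B)). Qed.

Lemma inner_vecH1S : inner_on (vec D : set vfield) (ipvH1 B).
Proof. exact: (inner_vec inner_H1S). Qed.

Lemma bdd_vec_id i : bdd_map (vec D : set vfield) (ipvH1 B) (L2box B) (ipbox B) (fun u => u i).
Proof. exact: (bdd_map_vec i inner_H1S (bdd_mapS DH (bdd_id B))). Qed.

Lemma bdd_vec_partial i j :
  bdd_map (vec D : set vfield) (ipvH1 B) (L2box B) (ipbox B) (fun u => partial B j (u i)).
Proof. exact: (bdd_map_vec i inner_H1S (bdd_mapS DH (bdd_partial B j))). Qed.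

Lemma DsymE (u : vfield) i j :
  Dsym B u i j = 2^-1 *: (partial B j (u i) + partial B i (u j)).
Proof. by apply/funext => x; rewrite /Dsym mulrC. Qed.

Lemma divgE (u : vfield) : divg B u = \sum_(i < 3) partial B i (u i).
Proof. by apply/funext => x; rewrite /divg fct_sumE. Qed.

Lemma bdd_Dsym i j :
  bdd_map (vec D : set vfield) (ipvH1 B) (L2box B) (ipbox B) (fun u => Dsym B u i j).
Proof.
under eq_fun do rewrite DsymE.
apply: (bdd_mapZ (inner_box B)); first exact: (subsp_vec sD).
by apply: (bdd_mapD (inner_box B) inner_vecH1S); exact: bdd_vec_partial.
Qed.

Lemma bdd_divg :
  bdd_map (vec D : set vfield) (ipvH1 B) (L2box B) (ipbox B) (fun u => divg B u).
Proof.
under eq_fun do rewrite divgE.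
by apply: (bdd_map_sum (inner_box B) inner_vecH1S) => i; exact: bdd_vec_partial.
Qed.

End one_box.

Lemma Dsym_sym B (u : vfield) i j : Dsym B u i j = Dsym B u j i.
Proof.
apply/funext => x; rewrite /Dsym.
by move: (partial B j (u i) x) (partial B i (u j) x) => a b; rewrite (addrC a).
Qed.

Lemma L2box_Dsym B (u : vfield) i j : vec (H1 B) u -> L2box B (Dsym B u i j).
Proof.
move=> Hu; have sL := subsp_L2box B; rewrite DsymE; apply: (subspZ sL).
by apply: (subspD sL); exact: L2box_partial.
Qed.

Lemma L2box_divg B (u : vfield) : vec (H1 B) u -> L2box B (divg B u).
Proof.
move=> Hu; rewrite divgE; apply: (subsp_sum (subsp_L2box B)) => i.
exact: L2box_partial.
Qed.

(** Exchanging the two summation indices shows that a symmetric matrix pairs alike with a gradient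
    and with its transpose. *)
Lemma ip_Dsym_partial B (u v : vfield) : vec (H1 B) u -> vec (H1 B) v ->
  \sum_(i < 3) \sum_(j < 3) ipbox B (Dsym B u i j) (partial B j (v i)) =
  \sum_(i < 3) \sum_(j < 3) ipbox B (Dsym B u i j) (Dsym B v i j).
Proof.
move=> Hu Hv; have sH := subsp_H1 B.
have LD i j : L2box B (Dsym B u i j) by exact: L2box_Dsym.
have Lp i j : L2box B (partial B j (v i)) by exact: L2box_partial.
have sL := subsp_L2box B.
have E i j : ipbox B (Dsym B u i j) (Dsym B v i j) =
    2^-1 * (ipbox B (Dsym B u i j) (partial B j (v i)) +
            ipbox B (Dsym B u i j) (partial B i (v j))).
  have l := ipbox_linr (LD i j).
  rewrite (DsymE B v) (linZ sL l) ?(linD l)//.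
  exact: subspD.
transitivity (2^-1 * (\sum_(i < 3) \sum_(j < 3) ipbox B (Dsym B u i j) (partial B j (v i)) +
   \sum_(i < 3) \sum_(j < 3) ipbox B (Dsym B u i j) (partial B i (v j)))).
  rewrite [X in _ = 2^-1 * (_ + X)]exchange_big /=.
  rewrite [X in _ = 2^-1 * (_ + X)](_ : _ =
    \sum_(i < 3) \sum_(j < 3) ipbox B (Dsym B u i j) (partial B j (v i))); first by field.
  by apply: eq_bigr => i _; apply: eq_bigr => j _; rewrite Dsym_sym.
rewrite -big_split mulr_sumr; apply: eq_bigr => i _ /=.
by rewrite -big_split mulr_sumr; apply: eq_bigr => j _ /=; rewrite E.
Qed.

Lemma ip_divg B (f : sfield) (v : vfield) : L2box B f -> vec (H1 B) v ->
  ipbox B f (divg B v) = \sum_(i < 3) ipbox B f (partial B i (v i)).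
Proof.
move=> Lf Hv; rewrite divgE (lin_sum (subsp_L2box B) (ipbox_linr Lf))// => i.
exact: L2box_partial.
Qed.

Lemma stress_work c (u xi : vfield) (p : sfield) :
  vec (H1 Ob) u -> L2box Ob p -> vec (H1 Ob) xi ->
  \sum_(i < 3) \sum_(j < 3) ipbox Ob (sigma_b c u p i j) (partial Ob j (xi i)) =
  2 * mu c * (\sum_(i < 3) \sum_(j < 3) ipbox Ob (Dsym Ob u i j) (Dsym Ob xi i j)) +
  lambda c * ipbox Ob (divg Ob u) (divg Ob xi) - alpha c * ipbox Ob p (divg Ob xi).
Proof.
move=> Hu Lp Hxi; have sH := subsp_H1 Ob; have sL := subsp_L2box Ob.
have LD i j : L2box Ob (Dsym Ob u i j) by exact: L2box_Dsym.
have Ld : L2box Ob (divg Ob u) by exact: L2box_divg.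
have Lx i j : L2box Ob (partial Ob j (xi i)) by exact: L2box_partial.
rewrite (ip_divg Ld Hxi) (ip_divg Lp Hxi) -ip_Dsym_partial// !mulr_sumr.
rewrite -big_split -sumrB /=; apply: eq_bigr => i _.
have -> : lambda c * ipbox Ob (divg Ob u) (partial Ob i (xi i)) =
    \sum_(j < 3) (i == j)%:R * (lambda c * ipbox Ob (divg Ob u) (partial Ob j (xi i))).
  rewrite (bigD1 i)//= eqxx mul1r big1 ?addr0// => j ji.
  by rewrite eq_sym (negbTE ji) mul0r.
have -> : alpha c * ipbox Ob p (partial Ob i (xi i)) =
    \sum_(j < 3) (i == j)%:R * (alpha c * ipbox Ob p (partial Ob j (xi i))).
  rewrite (bigD1 i)//= eqxx mul1r big1 ?addr0// => j ji.
  by rewrite eq_sym (negbTE ji) mul0r.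
rewrite mulr_sumr -big_split -sumrB /=; apply: eq_bigr => j _.
have -> : sigma_b c u p i j = (2 * mu c) *: Dsym Ob u i j +
    (i == j)%:R *: (lambda c *: divg Ob u + (- alpha c) *: p).
  by apply/funext => x; rewrite /sigma_b -[alpha c * p x]opprK -mulNr opprK.
have l := ipbox_linl (Lx i j).
have L1 := subspZ sL (lambda c) Ld; have L2p := subspZ sL (- alpha c) Lp.
have L3 := subspD sL L1 L2p; have LDij := LD i j.
have L4 := subspZ sL (2 * mu c) LDij; have L5 := subspZ sL (i == j)%:R L3.
rewrite (linD l L4 L5) (linZ sL l _ LDij) (linZ sL l _ L3) (linD l L1 L2p).
rewrite (linZ sL l _ Ld) (linZ sL l _ Lp).
by move: (ipbox _ _ _) (ipbox _ _ _) (ipbox _ _ _) => *; ring.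
Qed.

End concrete_maps.

(** * The forms of the Biot-Stokes system *)

Opaque ipbox ipI trb trf Omega_b Omega_f Dsym divg.

Lemma fst_lin (R : nzRingType) (V V' : lmodType R) (a : R) (x y : V * V') :
  (a *: x + y).1 = a *: x.1 + y.1.
Proof. by []. Qed.

Lemma snd_lin (R : nzRingType) (V V' : lmodType R) (a : R) (x y : V * V') :
  (a *: x + y).2 = a *: x.2 + y.2.
Proof. by []. Qed.

Lemma sum_ipboxC (R : realType) (B : box R) n (F G : 'I_n -> R * R * R -> R) :
  \sum_(i < n) ipbox B (F i) (G i) = \sum_(i < n) ipbox B (G i) (F i).
Proof. by apply: eq_bigr => i _; exact: ipboxC. Qed.

(* The energy balance is stated for atoms: rewriting inside the concrete forms
   makes unification unfold the integrals. *)
Lemma dissipation_balance (R : realType) (al be x x' p p' q q' s1 s2 s3 s4 k n : R) :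
  x' = x -> p' = p -> q' = q -> s3 = s2 -> 0 <= n ->
  0 <= be * (s1 + 2 * (-1) * s2 + (-1) ^+ 2 * s4) ->
  k <= be * s1 + (al * x + p + - be * s2) + (- al * x' + -1 * p' + - be * s3) +
    (k + n + (q + -1 * q') + be * s4).
Proof. by move=> -> -> -> -> ? ?; lra. Qed.

Lemma mass_balance (R : realDomainType) (al be r k a x y s t s4 s5 s' : R) :
  a = k * x + al * y -> s' = s4 - s5 ->
  a + r * s + t - be * s' =
  be * s5 + (al * y + t + - be * s4) + (k * x + r * s).
Proof. by move=> -> ->; ring. Qed.

Lemma work_balance (R : realDomainType) (al be a f f' n t w s p4 p5 s9 s10 x x6 x7 : R) :
  a = x6 + x7 - al * x -> f = f' -> t = p4 - p5 -> s = s9 - s10 ->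
  a + f + n + t - w + be * s =
  (x6 + x7) + (- al * x + -1 * p5 + - be * s10) + (f' + n + (p4 + -1 * w) + be * s9).
Proof. by move=> -> -> -> ->; ring. Qed.

Section concrete_forms.
Variable R : realType.
Local Notation R3 := (R * R * R)%type.
Local Notation sfield := (R3 -> R).
Local Notation vfield := ('I_3 -> R3 -> R).
Local Notation Ob := (@Omega_b R).
Local Notation Of := (@Omega_f R).
Local Notation L2I := (L2 (leb2 R) Gamma_I : set (R * R -> R)).
Variable c : coeffs R.
Hypotheses (nu_gt0 : 0 < nu c) (mu_gt0 : 0 < mu c) (k_gt0 : 0 < kperm c).
Hypotheses (beta_gt0 : 0 < beta c) (lambda_ge0 : 0 <= lambda c).
Hypotheses (rho_f_gt0 : 0 < rho_f c) (c0_ge0 : 0 <= c0 c).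

Local Notation D1 := (vec (@H1star_b R) : set vfield).
Local Notation b1 := (ipvH1 Ob).
Local Notation Dp := (@H1star_b R : set sfield).
Local Notation Dv := (vec (@H1star_f R) `&` @Vset R : set vfield).
Local Notation D2 := (Dp `*` Dv : set (sfield * vfield)).

Definition ip_pv (x y : sfield * vfield) : R := ipH1 Ob x.1 y.1 + ipvH1 Of x.2 y.2.

Definition form_el (u xi : vfield) : R :=
  2 * mu c * (\sum_(i < 3) \sum_(j < 3) ipbox Ob (Dsym Ob u i j) (Dsym Ob xi i j)) +
  lambda c * ipbox Ob (divg Ob u) (divg Ob xi).

(** [form_uu], [form_uy] and [form_mass] gather, with reversed sign, the terms of the weak
    formulation in which the test function carries a time derivative, apart from the term in u_t. *)
Definition form_uu (u xi : vfield) : R :=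
  beta c * \sum_(i < 3 | i != e3) ipI (trb (u i)) (trb (xi i)).

Definition form_uy (u : vfield) (w : sfield * vfield) : R :=
  alpha c * ipbox Ob (divg Ob u) w.1 + ipI (trb (u e3)) (trb w.1) +
  - beta c * \sum_(i < 3 | i != e3) ipI (trb (u i)) (trf (w.2 i)).

(** With equal arguments, the couplings of the pressure with the divergence and with the normal
    trace of u cancel against those of [form_uy], while the two slip sums add up to the cross term
    of |u - v|^2. *)
Definition form_yu (y : sfield * vfield) (xi : vfield) : R :=
  - alpha c * ipbox Ob y.1 (divg Ob xi) + -1 * ipI (trb y.1) (trb (xi e3)) +
  - beta c * \sum_(i < 3 | i != e3) ipI (trf (y.2 i)) (trb (xi i)).

Definition form_mass (y w : sfield * vfield) : R :=
  c0 c * ipbox Ob y.1 w.1 + rho_f c * \sum_(i < 3) ipbox Of (y.2 i) (w.2 i).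

(** Named separately because it is both a summand of [form_yy] and the dissipation kept in the
    abstract theorem, where it controls the pressure; the fluid velocity is controlled by
    [form_mass]. *)
Definition form_flux (y w : sfield * vfield) : R :=
  kperm c * \sum_(i < 3) ipbox Ob (partial Ob i y.1) (partial Ob i w.1).

Definition form_yy (y w : sfield * vfield) : R :=
  form_flux y w +
  2 * nu c * (\sum_(i < 3) \sum_(j < 3) ipbox Of (Dsym Of (y.2) i j) (Dsym Of (w.2) i j)) +
  (ipI (trb y.1) (trf (w.2 e3)) + -1 * ipI (trf (y.2 e3)) (trb w.1)) +
  beta c * \sum_(i < 3 | i != e3) ipI (trf (y.2 i)) (trf (w.2 i)).

Let DpH : Dp `<=` H1 Ob. Proof. by move=> f [[]]. Qed.
Let DvH : vec (@H1star_f R) `<=` (vec (H1 Of) : set vfield).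
Proof. by move=> v h i; have [[]] := h i. Qed.

Lemma subsp_HV : subsp Dv.
Proof. exact: subspI (subsp_vec (@subsp_H1star_f R)) (@subsp_Vset R). Qed.

Lemma inner_u : inner_on D1 b1.
Proof. exact: inner_vecH1S (@subsp_H1star_b R) DpH. Qed.

Lemma inner_p : inner_on Dp (ipH1 Ob).
Proof. exact: inner_H1S (@subsp_H1star_b R) DpH. Qed.

Lemma inner_v : inner_on Dv (ipvH1 Of).
Proof.
apply: (inner_onS subsp_HV _ (inner_vecH1S (subsp_H1 Of) (fun f h => h))).
by move=> v [/DvH].
Qed.

Lemma inner_y : inner_on D2 ip_pv.
Proof. exact: inner_prod inner_p inner_v. Qed.

Let sD1 := inner_subsp inner_u.
Let sD2 := inner_subsp inner_y.

Section lift.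
Variables (W : lmodType R) (E : set W) (e : W -> W -> R).

Lemma bdd_map_p F : bdd_map (H1 Ob : set sfield) (ipH1 Ob) E e F ->
  bdd_map D2 ip_pv E e (fun y => F y.1).
Proof.
move=> hF; apply: (bdd_map_comp (P := fst) (bdd_mapS DpH hF)).
- exact: fst_lin.

- by move=> x [].
- by move=> x [_ h]; rewrite lerDl; exact: (inner_ge0 inner_v).
Qed.

Lemma bdd_map_v F : bdd_map (vec (H1 Of) : set vfield) (ipvH1 Of) E e F ->
  bdd_map D2 ip_pv E e (fun y => F y.2).
Proof.
move=> hF; apply: (bdd_map_comp (P := snd) hF).
- exact: snd_lin.
- by move=> x [_ [/DvH]].
- by move=> x [h _]; rewrite lerDr; exact: (inner_ge0 inner_p).
Qed.

Lemma bdd_map_u F : bdd_map (H1 Ob : set sfield) (ipH1 Ob) E e F ->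
  forall i, bdd_map D1 b1 E e (fun u => F (u i)).
Proof.
by move=> hF i; exact: (bdd_map_vec i inner_p (bdd_mapS DpH hF)).
Qed.

Lemma bdd_map_vi F : bdd_map (H1 Of : set sfield) (ipH1 Of) E e F ->
  forall i, bdd_map D2 ip_pv E e (fun y => F (y.2 i)).
Proof.
by move=> hF i; apply: (bdd_map_v (F := fun v : vfield => F (v i)));
  exact: (bdd_map_vec i (inner_H1 Of) hF).
Qed.

End lift.

Let Tu i := bdd_map_u (@bdd_trb R) i.
Let Tp := bdd_map_p (@bdd_trb R).
Let Tv i := bdd_map_vi (@bdd_trf R) i.
Let Dvsym i j := bdd_map_v (bdd_Dsym (subsp_H1 Of) (fun f h => h) i j).
Let Dusym i j := bdd_Dsym (@subsp_H1star_b R) DpH i j.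
Let Ddiv := bdd_divg (@subsp_H1star_b R) DpH.

Lemma bdd_form_el : bdd_form D1 b1 D1 b1 form_el.
Proof.
apply: bdd_formD; apply: bdd_formZ.
  apply: bdd_form_sum => i; apply: bdd_form_sum => j.
  exact: (bdd_map_form (inner_box Ob) sD1 (Dusym i j) (Dusym i j)).
exact: (bdd_map_form (inner_box Ob) sD1 Ddiv Ddiv).
Qed.

Lemma bdd_form_uu : bdd_form D1 b1 D1 b1 form_uu.
Proof.
apply: bdd_formZ; apply: bdd_form_sum => i.
exact: (bdd_map_form (@inner_I R) sD1 (Tu i) (Tu i)).
Qed.

Lemma bdd_form_uy : bdd_form D1 b1 D2 ip_pv form_uy.
Proof.
apply: bdd_formD; first apply: bdd_formD.
- apply: bdd_formZ.
  exact: (bdd_map_form (inner_box Ob) sD2 Ddiv (bdd_map_p (bdd_id Ob))).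
- exact: (bdd_map_form (@inner_I R) sD2 (Tu e3) Tp).
- apply: bdd_formZ; apply: bdd_form_sum => i.
  exact: (bdd_map_form (@inner_I R) sD2 (Tu i) (Tv i)).
Qed.

Lemma bdd_form_yu : bdd_form D2 ip_pv D1 b1 form_yu.
Proof.
apply: bdd_formD; first apply: bdd_formD.
- apply: bdd_formZ.
  exact: (bdd_map_form (inner_box Ob) sD1 (bdd_map_p (bdd_id Ob)) Ddiv).
- apply: bdd_formZ; exact: (bdd_map_form (@inner_I R) sD1 Tp (Tu e3)).
- apply: bdd_formZ; apply: bdd_form_sum => i.
  exact: (bdd_map_form (@inner_I R) sD1 (Tv i) (Tu i)).
Qed.

Lemma bdd_form_mass : bdd_form D2 ip_pv D2 ip_pv form_mass.
Proof.
apply: bdd_formD; apply: bdd_formZ.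
  exact: (bdd_map_form (inner_box Ob) sD2 (bdd_map_p (bdd_id Ob)) (bdd_map_p (bdd_id Ob))).
apply: bdd_form_sum => i.
exact: (bdd_map_form (inner_box Of) sD2 (bdd_map_vi (bdd_id Of) i) (bdd_map_vi (bdd_id Of) i)).
Qed.

Lemma bdd_form_flux : bdd_form D2 ip_pv D2 ip_pv form_flux.
Proof.
apply: bdd_formZ; apply: bdd_form_sum => i.
have h := bdd_map_p (bdd_partial Ob i).
exact: (bdd_map_form (inner_box Ob) sD2 h h).
Qed.

Lemma bdd_form_yy : bdd_form D2 ip_pv D2 ip_pv form_yy.
Proof.
apply: bdd_formD; first (apply: bdd_formD; first apply: bdd_formD).
- exact: bdd_form_flux.
- apply: bdd_formZ; apply: bdd_form_sum => i.
  apply: bdd_form_sum => j.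
  exact: (bdd_map_form (inner_box Of) sD2 (Dvsym i j) (Dvsym i j)).
- apply: bdd_formD; first exact: (bdd_map_form (@inner_I R) sD2 Tp (Tv e3)).
  apply: bdd_formZ; exact: (bdd_map_form (@inner_I R) sD2 (Tv e3) Tp).
- apply: bdd_formZ; apply: bdd_form_sum => i.
  exact: (bdd_map_form (@inner_I R) sD2 (Tv i) (Tv i)).
Qed.

Lemma form_el_sym u xi : form_el u xi = form_el xi u.
Proof.
rewrite /form_el; move: (Dsym Ob u) (Dsym Ob xi) (divg Ob u) (divg Ob xi) => A B d e.
rewrite (ipboxC Ob d); congr (_ * _ + _); apply: eq_bigr => i _; exact: sum_ipboxC.
Qed.

Lemma form_mass_sym y w : form_mass y w = form_mass w y.
Proof. by rewrite /form_mass (ipboxC Ob y.1) (sum_ipboxC Of y.2). Qed.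

Lemma form_flux_sym y w : form_flux y w = form_flux w y.
Proof.
exact: (f_equal ( *%R (kperm c))
  (sum_ipboxC Ob (fun i => partial Ob i y.1) (fun i => partial Ob i w.1))).
Qed.

Let HD1 u : D1 u -> vec (H1 Ob) u. Proof. by move=> h i; exact: DpH (h i). Qed.

Lemma form_el_ge0 u : D1 u -> 0 <= form_el u u.
Proof.
move=> /HD1 Hu; apply: addr_ge0; apply: mulr_ge0 => //.
- by rewrite mulr_ge0// ltW.
- apply: sumr_ge0 => i _; apply: sumr_ge0 => j _; apply: ipbox_ge0.
  exact: L2box_Dsym.
- by apply: ipbox_ge0; exact: L2box_divg.
Qed.

Lemma form_mass_ge0 y : D2 y -> 0 <= form_mass y y.
Proof.
move=> [/DpH [Lp _] [/DvH Hv _]]; apply: addr_ge0; apply: mulr_ge0 => //.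
- exact: ipbox_ge0.
- exact: ltW.
- by apply: sumr_ge0 => i _; apply: ipbox_ge0; exact: (Hv i).1.
Qed.

Lemma form_flux_ge0 y : D2 y -> 0 <= form_flux y y.
Proof.
move=> [/DpH Hp _]; apply: mulr_ge0; first exact: ltW.
by apply: sumr_ge0 => i _; exact: ipbox_partial_ge0.
Qed.

Let L2trb f : H1 Ob f -> L2I (trb f). Proof. by have [[h _] _] := @bdd_trb R; exact: h. Qed.
Let L2trf f : H1 Of f -> L2I (trf f). Proof. by have [[h _] _] := @bdd_trf R; exact: h. Qed.
Let ipIC g h : L2I g -> L2I h -> ipI g h = ipI h g.
Proof. exact: (inner_sym (@inner_I R)). Qed.

Lemma form_dissipation u y : D1 u -> D2 y ->
  form_flux y y <= form_uu u u + form_uy u y + form_yu y u + form_yy y y.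
Proof.
move=> /HD1 Hu [/DpH Hp [/DvH Hv _]].
have Tui i := L2trb (Hu i); have Tvi i := L2trf (Hv i); have Tp1 := L2trb Hp.
have N : 0 <= 2 * nu c * (\sum_(i < 3) \sum_(j < 3)
    ipbox Of (Dsym Of (y.2) i j) (Dsym Of (y.2) i j)).
  apply: mulr_ge0; first by rewrite mulr_ge0// ltW.
  apply: sumr_ge0 => i _; apply: sumr_ge0 => j _; apply: ipbox_ge0.
  exact: L2box_Dsym.
(* The squared norm of the tangential slip u - v on the interface, expanded by bilinearity. *)
have S : 0 <= beta c * \sum_(i < 3 | i != e3) (ipI (trb (u i)) (trb (u i)) +
    2 * (-1) * ipI (trb (u i)) (trf (y.2 i)) + (-1) ^+ 2 * ipI (trf (y.2 i)) (trf (y.2 i))).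
  apply: mulr_ge0; first exact: ltW.
  apply: sumr_ge0 => i _; rewrite -(inner_expand (@inner_I R) (-1) (Tui i) (Tvi i)).
  have sI := inner_subsp (@inner_I R).
  apply: (inner_ge0 (@inner_I R)); apply: (subspD sI (Tui i)).
  exact: (subspZ sI).
rewrite !big_split /= -!mulr_sumr in S.
apply: dissipation_balance N S.
- exact: ipboxC.
- exact: (ipIC Tp1 (Tui e3)).
- exact: (ipIC (Tvi e3) Tp1).
- by apply: eq_bigr => i _; exact: (ipIC (Tvi i) (Tui i)).
Qed.

Lemma ipI_subr g h k : L2I g -> L2I h -> L2I k ->
  ipI g (fun y => h y - k y) = ipI g h - ipI g k.
Proof.
move=> Lg Lh Lk; have [_ l] := inner_bilin (@inner_I R).
exact: (linB (l _ Lg) Lh Lk).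
Qed.

(** These terms contain no pairing of (p, v) with [xi], so only three of the four possible blocks
    occur. *)
Lemma weak_mass_split u p v xi q zeta : D1 u -> D2 (p, v) -> D1 xi -> D2 (q, zeta) ->
  ipbox Ob (fluid_content c u p) q + rho_f c * ipv Of v zeta +
  ipI (trb (u e3)) (trb q) -
  beta c * (\sum_(i < 3 | i != e3)
    ipI (trb (u i)) (fun y => trf (zeta i) y - trb (xi i) y)) =
  form_uu u xi + form_uy u (q, zeta) + form_mass (p, v) (q, zeta).
Proof.
move=> /HD1 Hu [/DpH Hp [/DvH Hv _]] /HD1 Hxi [/DpH Hq [/DvH Hz _]].
have Tui i := L2trb (Hu i); have Txi i := L2trb (Hxi i); have Tzi i := L2trf (Hz i).
have sL := subsp_L2box Ob; have l := ipbox_linl Hq.1.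
have Ld := L2box_divg Hu; have Lp := Hp.1.
rewrite /form_uu /form_uy /form_mass; apply: mass_balance.
- have -> : fluid_content c u p = c0 c *: p + alpha c *: divg Ob u by [].
  rewrite (linD l (subspZ sL (c0 c) Lp) (subspZ sL (alpha c) Ld)).
  by rewrite (linZ sL l _ Lp) (linZ sL l _ Ld).
- rewrite -sumrB; apply: eq_bigr => i _.
  exact: (ipI_subr (Tui i) (Tzi i) (Txi i)).
Qed.

(** Here it is the pairing of u with (q, zeta) that does not occur. Together with [weak_mass_split]
    this gives the block structure of the abstract system. *)
Lemma weak_work_split u p v xi q zeta : D1 u -> D2 (p, v) -> D1 xi -> D2 (q, zeta) ->
  \sum_(i < 3) \sum_(j < 3) ipbox Ob (sigma_b c u p i j) (partial Ob j (xi i)) +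
  \sum_(i < 3) ipbox Ob (fun x => kperm c * partial Ob i p x) (partial Ob i q) +
  2 * nu c * (\sum_(i < 3) \sum_(j < 3) ipbox Of (Dsym Of v i j) (Dsym Of zeta i j)) +
  ipI (trb p) (fun y => trf (zeta e3) y - trb (xi e3) y) -
  ipI (trf (v e3)) (trb q) +
  beta c * (\sum_(i < 3 | i != e3)
    ipI (trf (v i)) (fun y => trf (zeta i) y - trb (xi i) y)) =
  form_el u xi + form_yu (p, v) xi + form_yy (p, v) (q, zeta).
Proof.
move=> /HD1 Hu [/DpH Hp [/DvH Hv _]] /HD1 Hxi [/DpH Hq [/DvH Hz _]].
have Tvi i := L2trf (Hv i); have Txi i := L2trb (Hxi i); have Tzi i := L2trf (Hz i).
rewrite /form_el /form_yu /form_yy; apply: work_balance.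
- exact: (stress_work c Hu Hp.1 Hxi).
- rewrite /form_flux mulr_sumr; apply: eq_bigr => i _.
  exact: (linZ (subsp_L2box Ob) (ipbox_linl (L2box_partial i Hq)) (kperm c) (L2box_partial i Hp)).
- exact: (ipI_subr (L2trb Hp) (Tzi e3) (Txi e3)).
- rewrite -sumrB; apply: eq_bigr => i _.
  exact: (ipI_subr (Tvi i) (Tzi i) (Txi i)).
Qed.

End concrete_forms.

Lemma scale_prodE (R : nzRingType) (V V' : lmodType R) (a : R) (x : V) (y : V') :
  a *: (x, y) = (a *: x, a *: y).
Proof. by []. Qed.

Lemma bdd_map_pair1 (R : realType) (V V' W : lmodType R) (D : set V) b (D' : set V') b'
    (E : set W) e (F : V -> W) : inner_on D' b' -> bdd_map D b E e F ->
  bdd_map (D `*` D') (fun x y => b x.1 y.1 + b' x.2 y.2) E e (fun x => F x.1).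
Proof.
move=> ib' hF; apply: (bdd_map_comp (P := fst) hF).
- exact: fst_lin.
- by move=> x [].
- by move=> x [_ h]; rewrite lerDl (inner_ge0 ib').
Qed.

Lemma bdd_map_pair2 (R : realType) (V V' W : lmodType R) (D : set V) b (D' : set V') b'
    (E : set W) e (F : V' -> W) : inner_on D b -> bdd_map D' b' E e F ->
  bdd_map (D `*` D') (fun x y => b x.1 y.1 + b' x.2 y.2) E e (fun x => F x.2).
Proof.
move=> ib hF; apply: (bdd_map_comp (P := snd) hF).
- exact: snd_lin.
- by move=> x [].
- by move=> x [h _]; rewrite lerDr (inner_ge0 ib).
Qed.

(** * The terms of the weak formulation as bounded forms on triples *)

Section weak_terms.
Variable R : realType.
Local Notation R3 := (R * R * R)%type.
Local Notation sfield := (R3 -> R).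
Local Notation vfield := ('I_3 -> R3 -> R).
Local Notation Ob := (@Omega_b R).
Local Notation Of := (@Omega_f R).
Variable c : coeffs R.

Local Notation D1 := (vec (@H1star_b R) : set vfield).
Local Notation b1 := (ipvH1 Ob).
Local Notation Dp := (@H1star_b R : set sfield).
Local Notation Dv := (vec (@H1star_f R) `&` @Vset R : set vfield).
Local Notation D2 := (Dp `*` Dv : set (sfield * vfield)).
Local Notation state := (vfield * (sfield * vfield))%type.
Local Notation DY := (D1 `*` D2 : set state).

Definition ip_state (x y : state) : R := b1 x.1 y.1 + ip_pv x.2 y.2.

Lemma inner_state : inner_on DY ip_state.
Proof. exact: inner_prod (@inner_u R) (@inner_y R). Qed.

Let sY := inner_subsp inner_state.

Let Mu (W : lmodType R) E (e : W -> W -> R) F (h : bdd_map D1 b1 E e F) :=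
  bdd_map_pair1 (@inner_y R) h : bdd_map DY ip_state E e (fun x => F x.1).
Let My (W : lmodType R) E (e : W -> W -> R) F (h : bdd_map D2 (@ip_pv R) E e F) :=
  bdd_map_pair2 (@inner_u R) h : bdd_map DY ip_state E e (fun x => F x.2).

Let DpH : Dp `<=` H1 Ob. Proof. by move=> f [[]]. Qed.

Let Tu i := Mu (bdd_map_u (@bdd_trb R) i).
Let Tp := My (bdd_map_p (@bdd_trb R)).
Let Tv i := My (bdd_map_vi (@bdd_trf R) i).
Let Vi i := My (bdd_map_vi (bdd_id Of) i).
Let P0 := My (bdd_map_p (bdd_id Ob)).
Let Pi i := My (bdd_map_p (bdd_partial Ob i)).
Let Vsym i j := My (bdd_map_v (bdd_Dsym (subsp_H1 Of) (fun f h => h) i j)).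
Let Usym i j := Mu (bdd_Dsym (@subsp_H1star_b R) DpH i j).
Let Udiv := Mu (bdd_divg (@subsp_H1star_b R) DpH).
Let Ud i j := Mu (bdd_map_u (bdd_partial Ob j) i).

Let bdd_sigma i j : bdd_map DY ip_state (L2box Ob : set sfield) (ipbox Ob)
  (fun x => sigma_b c x.1 x.2.1 i j).
Proof.
have -> : (fun x : state => sigma_b c x.1 x.2.1 i j) =
    (fun x => (2 * mu c) *: Dsym Ob x.1 i j +
      (i == j)%:R *: (lambda c *: divg Ob x.1 + (- alpha c) *: x.2.1)).
  apply/funext => x; apply/funext => z.
  by rewrite /sigma_b -[alpha c * x.2.1 z]opprK -mulNr opprK.
have i2 := inner_box Ob.
apply: (bdd_mapD i2 inner_state); first exact: (bdd_mapZ i2 _ sY (Usym i j)).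
apply: (bdd_mapZ i2 _ sY).
by apply: (bdd_mapD i2 inner_state); [exact: (bdd_mapZ i2 _ sY Udiv)|exact: (bdd_mapZ i2 _ sY P0)].
Qed.

Let bdd_content : bdd_map DY ip_state (L2box Ob : set sfield) (ipbox Ob)
  (fun x => fluid_content c x.1 x.2.1).
Proof.
have i2 := inner_box Ob.
exact: (bdd_mapD i2 inner_state (bdd_mapZ i2 (c0 c) sY P0) (bdd_mapZ i2 (alpha c) sY Udiv)).
Qed.

Let bdd_slip i : bdd_map DY ip_state (L2 (leb2 R) Gamma_I : set (R * R -> R)) (@ipI R)
  (fun x => (fun y => trf (x.2.2 i) y - trb (x.1 i) y)).
Proof.
have -> : (fun x : state => (fun y => trf (x.2.2 i) y - trb (x.1 i) y)) =
   (fun x => trf (x.2.2 i) + (-1) *: trb (x.1 i)).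
  apply/funext => x; apply/funext => y.
  exact: (f_equal (+%R (trf (x.2.2 i) y)) (esym (mulN1r (trb (x.1 i) y)))).
have i2 := @inner_I R.
exact: (bdd_mapD i2 inner_state (Tv i) (bdd_mapZ i2 (-1) sY (Tu i))).
Qed.

(** Each integrand of [weak_lhs] other than the one in u_t is regarded as a form in the triple of
    unknowns and the triple of test functions, or of their time derivatives. A common scalar factor
    in time can then be extracted by linearity in [w]. *)
Definition term_stress (x w : state) : R :=
  \sum_(i < 3) \sum_(j < 3) ipbox Ob (sigma_b c x.1 x.2.1 i j) (partial Ob j (w.1 i)).
Definition term_content (x w : state) : R := ipbox Ob (fluid_content c x.1 x.2.1) w.2.1.
Definition term_darcy (x w : state) : R :=
  \sum_(i < 3) ipbox Ob (fun z => kperm c * partial Ob i x.2.1 z) (partial Ob i w.2.1).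
Definition term_momentum (x w : state) : R := ipv Of x.2.2 w.2.2.
Definition term_viscous (x w : state) : R :=
  \sum_(i < 3) \sum_(j < 3) ipbox Of (Dsym Of x.2.2 i j) (Dsym Of w.2.2 i j).
Definition term_pressure (x w : state) : R :=
  ipI (trb x.2.1) (fun y => trf (w.2.2 e3) y - trb (w.1 e3) y).
Definition term_outflow (x w : state) : R := ipI (trf (x.2.2 e3)) (trb w.2.1).
Definition term_normal (x w : state) : R := ipI (trb (x.1 e3)) (trb w.2.1).
Definition term_slip_v (i : 'I_3) (x w : state) : R :=
  ipI (trf (x.2.2 i)) (fun y => trf (w.2.2 i) y - trb (w.1 i) y).
Definition term_slip_u (i : 'I_3) (x w : state) : R :=
  ipI (trb (x.1 i)) (fun y => trf (w.2.2 i) y - trb (w.1 i) y).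

Local Notation bounded B := (bdd_form DY ip_state DY ip_state B).

Lemma bdd_term_stress : bounded term_stress.
Proof.
apply: bdd_form_sum => i; apply: bdd_form_sum => j.
exact: (bdd_map_form (inner_box Ob) sY (bdd_sigma i j) (Ud i j)).
Qed.

Lemma bdd_term_content : bounded term_content.
Proof. exact: (bdd_map_form (inner_box Ob) sY bdd_content P0). Qed.

Lemma bdd_term_darcy : bounded term_darcy.
Proof.
apply: bdd_form_sum => i.
exact: (bdd_map_form (inner_box Ob) sY (bdd_mapZ (inner_box Ob) (kperm c) sY (Pi i)) (Pi i)).
Qed.

Lemma bdd_term_momentum : bounded term_momentum.
Proof.
by apply: bdd_form_sum => i; exact: (bdd_map_form (inner_box Of) sY (Vi i) (Vi i)).
Qed.

Lemma bdd_term_viscous : bounded term_viscous.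
Proof.
apply: bdd_form_sum => i; apply: bdd_form_sum => j.
exact: (bdd_map_form (inner_box Of) sY (Vsym i j) (Vsym i j)).
Qed.

Lemma bdd_term_pressure : bounded term_pressure.
Proof. exact: (bdd_map_form (@inner_I R) sY Tp (bdd_slip e3)). Qed.

Lemma bdd_term_outflow : bounded term_outflow.
Proof. exact: (bdd_map_form (@inner_I R) sY (Tv e3) Tp). Qed.

Lemma bdd_term_normal : bounded term_normal.
Proof. exact: (bdd_map_form (@inner_I R) sY (Tu e3) Tp). Qed.

Lemma bdd_term_slip_v i : bounded (term_slip_v i).
Proof. exact: (bdd_map_form (@inner_I R) sY (Tv i) (bdd_slip i)). Qed.

Lemma bdd_term_slip_u i : bounded (term_slip_u i).
Proof. exact: (bdd_map_form (@inner_I R) sY (Tu i) (bdd_slip i)). Qed.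

End weak_terms.

Section weighted.
Variable R : realType.
Local Notation mu := (@lebesgue_measure R).
Variables (T : R) (g : R -> R).
Hypothesis hg : forall h, intble mu (itv0 T) h -> intble mu (itv0 T) (fun t => g t * h t).
Let W h := tint T (fun t => g t * h t).
Let mT := measurable_itv0 T.

(** The weight [g] will be psi for the terms with a differentiated test function, and int_t^T psi
    for the others. *)
Lemma wintD h k : intble mu (itv0 T) h -> intble mu (itv0 T) k ->
  W (fun t => h t + k t) = W h + W k.
Proof.
move=> Ih Ik; rewrite /W /tint -(RintegralD mT (hg Ih) (hg Ik)).
by apply: intR_eq => t _; rewrite mulrDr.
Qed.

Lemma wintZ a h : intble mu (itv0 T) h -> W (fun t => a * h t) = a * W h.
Proof.
move=> Ih; rewrite /W /tint -(RintegralZl _ mT (hg Ih)).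
by apply: intR_eq => t _; rewrite mulrCA.
Qed.

Lemma wint_sum n (P : pred 'I_n) (h : 'I_n -> R -> R) :
  (forall i, intble mu (itv0 T) (h i)) ->
  intble mu (itv0 T) (fun t => \sum_(i < n | P i) h i t) /\
  W (fun t => \sum_(i < n | P i) h i t) = \sum_(i < n | P i) W (h i).
Proof.
move=> Ih; elim: (index_enum _) => [|i s [I1 IH]].
  rewrite big_nil; under eq_fun do rewrite big_nil.
  split; first exact: intble_itv0_cst.
  by rewrite /W /tint -[RHS](intR0 mu (itv0 T)); apply: intR_eq => t _; rewrite mulr0.
rewrite big_cons; under eq_fun do rewrite big_cons.
case: (P i) => //; split; first exact: intbleD.
by rewrite wintD// IH.
Qed.

Lemma wint_mass (rho rf be : R) (q : pred 'I_3) n1 n3 n5 n9 n11 :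
  intble mu (itv0 T) n1 -> intble mu (itv0 T) n3 -> intble mu (itv0 T) n5 ->
  intble mu (itv0 T) n9 -> (forall i, intble mu (itv0 T) (n11 i)) ->
  intble mu (itv0 T) (fun t => rho * n1 t + (n3 t + rf * n5 t + n9 t -
    be * \sum_(i < 3 | q i) n11 i t)) /\
  W (fun t => rho * n1 t + (n3 t + rf * n5 t + n9 t -
    be * \sum_(i < 3 | q i) n11 i t)) =
  rho * W n1 + W n3 + rf * W n5 + W n9 - be * \sum_(i < 3 | q i) W (n11 i).
Proof.
move=> I1 I3 I5 I9 I11; have [Is Ws] := wint_sum q I11.
have J1 := intbleZ rho mT I1; have J5 := intbleZ rf mT I5; have Js := intbleZ (- be) mT Is.
have K := intbleD mT (intbleD mT I3 J5) I9.
have -> : (fun t => rho * n1 t + (n3 t + rf * n5 t + n9 t - be * \sum_(i < 3 | q i) n11 i t)) =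
    (fun t => rho * n1 t + (n3 t + rf * n5 t + n9 t + - be * \sum_(i < 3 | q i) n11 i t)).
  by apply/funext => t; rewrite mulNr.
split; first exact: (intbleD mT J1 (intbleD mT K Js)).
rewrite (wintD J1 (intbleD mT K Js)) (wintZ rho I1) (wintD K Js) (wintZ (- be) Is) Ws.
rewrite (wintD (intbleD mT I3 J5) I9) (wintD I3 J5) (wintZ rf I5).
ring.
Qed.

Lemma wint_work (nn be : R) (q : pred 'I_3) n2 n4 n6 n7 n8 n10 :
  intble mu (itv0 T) n2 -> intble mu (itv0 T) n4 -> intble mu (itv0 T) n6 ->
  intble mu (itv0 T) n7 -> intble mu (itv0 T) n8 ->
  (forall i, intble mu (itv0 T) (n10 i)) ->
  intble mu (itv0 T) (fun t => n2 t + n4 t + nn * n6 t + n7 t - n8 t +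
    be * \sum_(i < 3 | q i) n10 i t) /\
  W (fun t => n2 t + n4 t + nn * n6 t + n7 t - n8 t +
    be * \sum_(i < 3 | q i) n10 i t) =
  W n2 + W n4 + nn * W n6 + W n7 - W n8 + be * \sum_(i < 3 | q i) W (n10 i).
Proof.
move=> I2 I4 I6 I7 I8 I10; have [Is Ws] := wint_sum q I10.
have J6 := intbleZ nn mT I6; have J8 := intbleZ (-1) mT I8; have Js := intbleZ be mT Is.
have K1 := intbleD mT (intbleD mT I2 I4) J6; have K2 := intbleD mT K1 I7.
have K3 := intbleD mT K2 J8.
have -> : (fun t => n2 t + n4 t + nn * n6 t + n7 t - n8 t + be * \sum_(i < 3 | q i) n10 i t) =
    (fun t => n2 t + n4 t + nn * n6 t + n7 t + -1 * n8 t + be * \sum_(i < 3 | q i) n10 i t).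
  by apply/funext => t; rewrite mulN1r.
split; first exact: (intbleD mT K3 Js).
rewrite (wintD K3 Js) (wintZ be Is) Ws (wintD K2 J8) (wintZ (-1) I8) (wintD K1 I7).
rewrite (wintD (intbleD mT I2 I4) J6) (wintD I2 I4) (wintZ nn I6).
by rewrite mulN1r.
Qed.

End weighted.

(** The [t] atoms stand for the integrals in [weak_lhs], the [n] atoms for the weighted integrals.
    The minus signs are those of the derivative - psi of int_t^T psi, and they occur exactly where
    the test function is differentiated. *)
Lemma lhs_atoms (R : realDomainType) (r rf nn be : R) (q : pred 'I_3)
    t1 t2 t3 t4 t5 t6 t7 t8 t9 t10 t11 n1 n2 n3 n4 n5 n6 n7 n8 n9 n10 n11 :
  t1 = - n1 -> t2 = n2 -> t3 = - n3 -> t4 = n4 -> t5 = - n5 -> t6 = n6 ->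
  t7 = n7 -> t8 = n8 -> t9 = - n9 ->
  (forall i, t10 i = n10 i) -> (forall i, t11 i = - n11 i) ->
  - r * t1 + t2 - t3 + t4 - rf * t5 + nn * t6 + t7 - t8 - t9 +
    be * (\sum_(i < 3 | q i) (t10 i + t11 i)) =
  (r * n1 + n3 + rf * n5 + n9 - be * \sum_(i < 3 | q i) n11 i) +
  (n2 + n4 + nn * n6 + n7 - n8 + be * \sum_(i < 3 | q i) n10 i).
Proof.
move=> -> -> -> -> -> -> -> -> -> h10 h11.
rewrite (eq_bigr (fun i => n10 i - n11 i)); last by move=> i _; rewrite h10 h11.
by rewrite sumrB; ring.
Qed.

(** * The weak formulation tested with products of a function of time and a fixed element *)

Section weak_time.
Variable R : realType.
Local Notation mu := (@lebesgue_measure R).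
Local Notation R3 := (R * R * R)%type.
Local Notation sfield := (R3 -> R).
Local Notation vfield := ('I_3 -> R3 -> R).
Local Notation Ob := (@Omega_b R).
Local Notation Of := (@Omega_f R).
Local Notation D1 := (vec (@H1star_b R) : set vfield).
Local Notation D2 := (@H1star_b R `*` (vec (@H1star_f R) `&` @Vset R) : set (sfield * vfield)).
Local Notation DY := (D1 `*` D2).
Local Notation X := (NSpace DY (hnorm (@ip_state R))).
Variables (T : R) (c : coeffs R).
Variables (u ut : R -> vfield) (p : R -> sfield) (v : R -> vfield).
Hypothesis bx : bochner_L2 T X (fun t => (u t, (p t, v t))).
Hypothesis but : bochner_L2 T (bL2_b R) ut.
Variables (e : vfield) (r : sfield) (z : vfield).
Hypotheses (De : D1 e) (Dw : D2 (r, z)).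

Definition mass_at t : R := rho_b c * ipv Ob (ut t) e +
  (form_uu c (u t) e + form_uy c (u t) (r, z) + form_mass c (p t, v t) (r, z)).
Definition work_at t : R :=
  form_el c (u t) e + form_yu c (p t, v t) e + form_yy c (p t, v t) (r, z).

Let ib0 : inner_on (vec (L2box Ob) : set vfield) (ipv Ob).
Proof. exact: (inner_vec (inner_box Ob)). Qed.
Let sY := inner_subsp (@inner_state R).
Let DYw : DY (e, (r, z)). Proof. by []. Qed.
Let mT := measurable_itv0 T.
Let x t : vfield * (sfield * vfield) := (u t, (p t, v t)).
Let w : vfield * (sfield * vfield) := (e, (r, z)).
Let Dx t : itv0 T t -> DY (x t). Proof. exact: (sm_dom bx.1). Qed.
Let D1L f : D1 f -> vec (L2box Ob) f. Proof. by move=> h i; have [[[]]] := h i. Qed.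

Let term_intble B : bdd_form DY (@ip_state R) DY (@ip_state R) B ->
  intble mu (itv0 T) (fun t => B (x t) w).
Proof. by move=> hB; exact: (intble_form_linl (@inner_state R) (@inner_state R) hB bx DYw). Qed.

Let term_scale B (g : R -> R) : bdd_form DY (@ip_state R) DY (@ip_state R) B ->
  tint T (fun t => B (x t) (g t *: e, (g t *: r, g t *: z))) =
  tint T (fun t => g t * B (x t) w).
Proof.
move=> [[_ hB] _]; apply: intR_eq => t Tt.
by rewrite -scale_prodE -scale_prodE (linZ sY (hB _ (Dx Tt)) (g t) DYw).
Qed.

Let tintN h : intble mu (itv0 T) h -> tint T (fun t => - h t) = - tint T h.
Proof.
move=> Ih; rewrite -[RHS]mulN1r /tint -(RintegralZl _ mT Ih).
by apply: intR_eq => t _; rewrite mulN1r.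
Qed.

Let term_scaleN B (g : R -> R) : bdd_form DY (@ip_state R) DY (@ip_state R) B ->
  (forall h, intble mu (itv0 T) h -> intble mu (itv0 T) (fun t => g t * h t)) ->
  tint T (fun t => B (x t) (- g t *: e, (- g t *: r, - g t *: z))) =
  - tint T (fun t => g t * B (x t) w).
Proof.
move=> hB hg; rewrite (term_scale (fun t => - g t) hB) -(tintN (hg _ (term_intble hB))).
by apply: intR_eq => t _; rewrite mulNr.
Qed.

(** The scalars int_t^T psi and - psi(t) come out of every term by linearity in the test triple. The
    two weights separate the terms with a differentiated test function, gathered in [mass_at], from
    the rest, gathered in [work_at]. *)
Lemma weak_lhs_prim psi : time_bump T psi ->
  intble mu (itv0 T) mass_at /\ intble mu (itv0 T) work_at /\
  weak_lhs T c u ut p v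
    (fun t => (prim psi T - prim psi t) *: e) (fun t => - psi t *: e)
    (fun t => (prim psi T - prim psi t) *: r) (fun t => - psi t *: r)
    (fun t => (prim psi T - prim psi t) *: z) (fun t => - psi t *: z) =
  tint T (fun t => psi t * mass_at t + (prim psi T - prim psi t) * work_at t).
Proof.
move=> tb; pose phi t := prim psi T - prim psi t.
have Ipsi : intble mu (itv0 T) psi by apply: intble_continuous; exact: (smooth_continuous tb.1).
have h1 h : intble mu (itv0 T) h -> intble mu (itv0 T) (fun t => psi t * h t).
  exact: intble_time_bump.
have h2 h : intble mu (itv0 T) h -> intble mu (itv0 T) (fun t => phi t * h t).
  move=> Ih; apply: (intble_eq mT _ (intbleB mT (intbleZ (prim psi T) mT Ih) (prim_triangle Ipsi Ih))) => t _.
  by rewrite mulrBl.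
have I0 : intble mu (itv0 T) (fun t => ipv Ob (ut t) e).
  exact: (intble_form_linl ib0 ib0 (bdd_form_inner ib0) but (D1L De)).
have [Im Wm] := wint_mass h1 (rho_b c) (rho_f c) (beta c) (fun i => i != e3) I0
  (term_intble (bdd_term_content c)) (term_intble (@bdd_term_momentum R))
  (term_intble (@bdd_term_normal R)) (fun i => term_intble (@bdd_term_slip_u R i)).
have [Iw Ww] := wint_work h2 (2 * nu c) (beta c) (fun i => i != e3)
  (term_intble (bdd_term_stress c)) (term_intble (bdd_term_darcy c))
  (term_intble (@bdd_term_viscous R)) (term_intble (@bdd_term_pressure R))
  (term_intble (@bdd_term_outflow R)) (fun i => term_intble (@bdd_term_slip_v R i)).
have Em t : itv0 T t -> rho_b c * ipv Ob (ut t) e + (term_content c (x t) w +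
    rho_f c * term_momentum (x t) w + term_normal (x t) w -
    beta c * \sum_(i < 3 | i != e3) term_slip_u i (x t) w) = mass_at t.
  move=> Tt; have [Du Dpv] := Dx Tt.
  exact: (f_equal (+%R (rho_b c * ipv Ob (ut t) e)) (weak_mass_split c Du Dpv De Dw)).
have Ew t : itv0 T t -> term_stress c (x t) w + term_darcy c (x t) w +
    2 * nu c * term_viscous (x t) w + term_pressure (x t) w - term_outflow (x t) w +
    beta c * \sum_(i < 3 | i != e3) term_slip_v i (x t) w = work_at t.
  by move=> Tt; have [Du Dpv] := Dx Tt; exact: (weak_work_split c Du Dpv De Dw).
have IM := intble_eq mT Em Im; have IW := intble_eq mT Ew Iw.
split=> //; split=> //.
rewrite /tint (RintegralD mT (h1 _ IM) (h2 _ IW)).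
have -> : \int[mu]_(t in itv0 T) (psi t * mass_at t) = tint T (fun t => psi t *
  (rho_b c * ipv Ob (ut t) e + (term_content c (x t) w +
    rho_f c * term_momentum (x t) w + term_normal (x t) w -
    beta c * \sum_(i < 3 | i != e3) term_slip_u i (x t) w))).
  by apply: intR_eq => t Tt; rewrite Em.
have -> : \int[mu]_(t in itv0 T) (phi t * work_at t) = tint T (fun t => phi t *
  (term_stress c (x t) w + term_darcy c (x t) w +
    2 * nu c * term_viscous (x t) w + term_pressure (x t) w - term_outflow (x t) w +
    beta c * \sum_(i < 3 | i != e3) term_slip_v i (x t) w)).
  by apply: intR_eq => t Tt; rewrite Ew.
rewrite Wm Ww; apply: lhs_atoms.
- rewrite -(tintN (h1 _ I0)); apply: intR_eq => t Tt; rewrite -mulNr.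
  have [_ l] := inner_bilin ib0.
  exact: (linZ (inner_subsp ib0) (l _ (sm_dom but.1 Tt)) (- psi t) (D1L De)).
- exact: (term_scale phi (bdd_term_stress c)).
- exact: (term_scaleN (bdd_term_content c) h1).
- exact: (term_scale phi (bdd_term_darcy c)).
- exact: (term_scaleN (@bdd_term_momentum R) h1).
- exact: (term_scale phi (@bdd_term_viscous R)).
- exact: (term_scale phi (@bdd_term_pressure R)).
- exact: (term_scale phi (@bdd_term_outflow R)).
- exact: (term_scaleN (@bdd_term_normal R) h1).
- by move=> i; exact: (term_scale phi (@bdd_term_slip_v R i)).
- by move=> i; exact: (term_scaleN (@bdd_term_slip_u R i) h1).
Qed.

End weak_time.

Section bochner_pair.
Variables (R : realType) (T : R).
Local Notation mu := (@lebesgue_measure R).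

Lemma bochner_L2_linear (V V' : lmodType R) (D : set V) b (D' : set V') b' (P : V -> V') f :
  (forall a x y, P (a *: x + y) = a *: P x + P y) ->
  (forall x, D x -> D' (P x)) -> (forall x, b' (P x) (P x) = b x x) ->
  bochner_L2 T (NSpace D (hnorm b)) f ->
  bochner_L2 T (NSpace D' (hnorm b')) (fun t => P (f t)).
Proof.
move=> lP DP bP [[Df [s [ss sf]]] If].
have P0 : P 0 = 0.
  by have := lP 1 0 0; rewrite !scale1r addr0 => /eqP; rewrite -subr_eq0 opprD addNKr oppr_eq0 => /eqP.
have hP x : hnorm b' (P x) = hnorm b x by rewrite /hnorm bP.
have PZ a x : P (a *: x) = a *: P x by rewrite -[a *: x]addr0 lP P0 addr0.
have PB x y : P x - P y = P (x - y).
  by rewrite (_ : x - y = -1 *: y + x) ?lP scaleN1r addrC.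
split; last first.
  by rewrite (_ : (fun t => _) = fun t => (hnorm b (f t) ^+ 2)%:E)//; apply/funext => t; rewrite /= hP.
split; first by move=> t tT; apply: DP; exact: Df.
exists (fun n t => P (s n t)); split.
  move=> n; have [m [A [d [mA Dd ->]]]] := ss n.
  exists m, A, (fun i => P (d i)); split=> //; first by move=> i; exact: (DP _ (Dd i)).
  apply/funext => t; elim: (index_enum _) => [|i q IH]; first by rewrite !big_nil P0.
  by rewrite !big_cons lP IH.
move=> t tT; rewrite (_ : (fun n => _) = fun n => hnorm b (s n t - f t)); first exact: sf.
by apply/funext => n; rewrite /= PB hP.
Qed.

(** The pair is written as (f, 0) - (0, 0 - g), a difference of images under isometric embeddings,
    so that the result for differences applies. *)
Lemma bochner_L2_pair (V V' : lmodType R) (D : set V) b (D' : set V') b' f g :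
  inner_on D b -> inner_on D' b' ->
  bochner_L2 T (NSpace D (hnorm b)) f -> bochner_L2 T (NSpace D' (hnorm b')) g ->
  bochner_L2 T (NSpace (D `*` D') (hnorm (fun x y => b x.1 y.1 + b' x.2 y.2)))
    (fun t => (f t, g t)).
Proof.
move=> ib ib' bf bg; have ip := inner_prod ib ib'.
have s0 := subsp0 (inner_subsp ib); have s0' := subsp0 (inner_subsp ib').
have z0 (U : lmodType R) (E : set U) k : inner_on E k -> k 0 0 = 0.
  move=> ik; have [l _] := inner_bilin ik; have s := inner_subsp ik.
  exact: (lin0 s (l _ (subsp0 s))).
have h1 := @bochner_L2_linear _ _ D b (D `*` D') (fun x y => b x.1 y.1 + b' x.2 y.2)
  (fun x => (x, 0)) f.
have h2 := @bochner_L2_linear _ _ D' b' (D `*` D') (fun x y => b x.1 y.1 + b' x.2 y.2)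
  (fun x => (0, x)) (fun t => 0 - g t).
have := bochner_L2B ip (h1 _ _ _ bf) (h2 _ _ _ (bochner_L2B ib' (bochner_L2_cst T ib' s0') bg)).
rewrite (_ : _ - _ = fun t => (f t, g t)).
  apply.
  - move=> a x y; transitivity (a *: x + y, a *: (0 : V') + 0); last by [].
    by rewrite scaler0 addr0.
  - by [].
  - by move=> x; rewrite /= (z0 _ _ _ ib') addr0.
  - move=> a x y; transitivity (a *: (0 : V) + 0, a *: x + y); last by [].
    by rewrite scaler0 addr0.
  - by [].
  - by move=> x; rewrite /= (z0 _ _ _ ib) add0r.
apply/funext => t; have -> : (f t, g t) = (f t - 0, 0 - (0 - g t)) by rewrite subr0 !sub0r opprK.
by [].
Qed.

End bochner_pair.

(** * The difference of two weak solutions *)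

Section difference.
Variable R : realType.
Local Notation mu := (@lebesgue_measure R).
Local Notation R3 := (R * R * R)%type.
Local Notation sfield := (R3 -> R).
Local Notation vfield := ('I_3 -> R3 -> R).
Local Notation Ob := (@Omega_b R).
Local Notation Of := (@Omega_f R).
Local Notation D0 := (vec (L2box Ob) : set vfield).
Local Notation D1 := (vec (@H1star_b R) : set vfield).
Local Notation Dv := (vec (@H1star_f R) `&` @Vset R : set vfield).
Local Notation D2 := (@H1star_b R `*` Dv : set (sfield * vfield)).
Variables (T : R) (c : coeffs R).
Hypothesis T_gt0 : 0 < T.

Lemma inner_L2vec : inner_on D0 (ipv Ob).
Proof. exact: (inner_vec (inner_box Ob)). Qed.

Lemma H1star_L2vec : D1 `<=` D0.
Proof. by move=> f h i; have [[[]]] := h i. Qed.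

Lemma ipv_bdd : bdd_form D0 (ipv Ob) D1 (ipvH1 Ob) (ipv Ob).
Proof.
have H : @H1star_b R `<=` H1 Ob by move=> f [[]].
have h0 : bdd_map (L2box Ob : set sfield) (ipbox Ob) (L2box Ob) (ipbox Ob) id.
  split; first by split=> [f //|w Lw]; exact: ipbox_linl.
  by exists 1 => // f Lf; rewrite mul1r.
apply: bdd_form_sum => i.
exact: (bdd_map_form (inner_box Ob) (inner_subsp (@inner_u R))
  (bdd_map_vec i (inner_box Ob) h0) (bdd_vec_id (@subsp_H1star_b R) H i)).
Qed.

Section pair_of_solutions.
Variables (u ut : R -> vfield) (p : R -> sfield) (v : R -> vfield).
Variables (u' ut' : R -> vfield) (p' : R -> sfield) (v' : R -> vfield).
Hypotheses (bu : bochner_L2 T (Uspace R) u) (bu' : bochner_L2 T (Uspace R) u').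
Hypotheses (but : bochner_L2 T (bL2_b R) ut) (but' : bochner_L2 T (bL2_b R) ut').
Hypotheses (bp : bochner_L2 T (Hstar_b R) p) (bp' : bochner_L2 T (Hstar_b R) p').
Hypotheses (bv : bochner_L2 T (HVspace R) v) (bv' : bochner_L2 T (HVspace R) v').

Let mT := measurable_itv0 T.
Let y t : sfield * vfield := (p t, v t).
Let y' t : sfield * vfield := (p' t, v' t).

Lemma bochner_y q w : bochner_L2 T (Hstar_b R) q -> bochner_L2 T (HVspace R) w ->
  bochner_L2 T (NSpace D2 (hnorm (@ip_pv R))) (fun t => (q t, w t)).
Proof. exact: (bochner_L2_pair (@inner_p R) (@inner_v R)). Qed.

Let by_ := bochner_y bp bv.
Let by_' := bochner_y bp' bv'.

Lemma bochner_state (w : R -> vfield) q z : bochner_L2 T (Uspace R) w ->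
  bochner_L2 T (Hstar_b R) q -> bochner_L2 T (HVspace R) z ->
  bochner_L2 T (NSpace (D1 `*` D2) (hnorm (@ip_state R))) (fun t => (w t, (q t, z t))).
Proof.
by move=> bw bq bz; exact: (bochner_L2_pair (@inner_u R) (@inner_y R) bw (bochner_y bq bz)).
Qed.

Hypothesis same_lhs : forall xi xit q qt zeta zetat,
  C1_0 T (Uspace R) xi xit -> C1_0 T (Hstar_b R) q qt -> C1_0 T (HVspace R) zeta zetat ->
  weak_lhs T c u ut p v xi xit q qt zeta zetat =
  weak_lhs T c u' ut' p' v' xi xit q qt zeta zetat.

Lemma weak_difference e r z : D1 e -> D2 (r, z) -> {ae mu, forall t, itv0 T t ->
  (mass_at c u ut p v e r z t - mass_at c u' ut' p' v' e r z t) +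
  \int[mu]_(s in itv0 t) (work_at c u p v e r z s - work_at c u' p' v' e r z s) = 0}.
Proof.
move=> De Dw; have [Dr Dz] := Dw.
have h := weak_lhs_prim c (bochner_state bu bp bv) but De Dw.
have h' := weak_lhs_prim c (bochner_state bu' bp' bv') but' De Dw.
(* An arbitrary bump, used only to extract the integrability of [mass_at] and [work_at], which does
   not depend on it. *)
have tb0 := time_bump_rbump (0, 0, 0%N) T_gt0.
have [Im [Iw _]] := h _ tb0; have [Im' [Iw' _]] := h' _ tb0.
apply: (ae_eq0_of_weak_eq (intbleB mT Im Im') (intbleB mT Iw Iw')) => psi tb.
have [_ [_ E]] := h _ tb; have [_ [_ E']] := h' _ tb.
have Ipsi : intble mu (itv0 T) psi by apply: intble_continuous; exact: (smooth_continuous tb.1).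
have I m : intble mu (itv0 T) m ->
    intble mu (itv0 T) (fun t => (prim psi T - prim psi t) * m t).
  move=> Ih; apply: (intble_eq mT _ (intbleB mT (intbleZ (prim psi T) mT Ih) (prim_triangle Ipsi Ih))) => t _.
  by rewrite mulrBl.
have := same_lhs (C1_0_prim (@inner_u R) tb De) (C1_0_prim (@inner_p R) tb Dr)
  (C1_0_prim (@inner_v R) tb Dz).
rewrite E E' => /eqP; rewrite -subr_eq0 => /eqP <-.
rewrite /tint -(RintegralB mT (intbleD mT (intble_time_bump tb Im) (I _ Iw))
  (intbleD mT (intble_time_bump tb Im') (I _ Iw'))).
apply: intR_eq => t _.
move: (mass_at _ _ _ _ _ _ _ _ t) (mass_at _ _ _ _ _ _ _ _ t) => a1 a2.
move: (work_at _ _ _ _ _ _ _ t) (work_at _ _ _ _ _ _ _ t) => a3 a4; ring.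
Qed.

Let du := u - u'.
Let dut := ut - ut'.
Let dy t : sfield * vfield := y t - y' t.

Let bdu : bochner_L2 T (NSpace D1 (hnorm (ipvH1 Ob))) du.
Proof. exact: (bochner_L2B (@inner_u R) bu bu'). Qed.
Let bdut : bochner_L2 T (NSpace D0 (hnorm (ipv Ob))) dut.
Proof. exact: (bochner_L2B inner_L2vec but but'). Qed.
Let bdy : bochner_L2 T (NSpace D2 (hnorm (@ip_pv R))) dy.
Proof. exact: (bochner_L2B (@inner_y R) by_ by_'). Qed.

Let form_diff (V V' : lmodType R) (D : set V) b (D' : set V') b' (F : V -> V' -> R) x x' w :
  bdd_form D b D' b' F -> D x -> D x' -> D' w -> F (x - x') w = F x w - F x' w.
Proof. by move=> [[l _] _] Dx Dx' Dw; exact: (linB (l _ Dw)). Qed.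

Let form_0r (V V' : lmodType R) (D : set V) b (D' : set V') b' (F : V -> V' -> R) x :
  subsp D' -> bdd_form D b D' b' F -> D x -> F x 0 = 0.
Proof. by move=> sD' [[_ l] _] Dx; exact: (lin0 sD' (l _ Dx)). Qed.

Let Du t : itv0 T t -> D1 (u t). Proof. exact: (sm_dom bu.1). Qed.
Let Du' t : itv0 T t -> D1 (u' t). Proof. exact: (sm_dom bu'.1). Qed.
Let Dut t : itv0 T t -> D0 (ut t). Proof. exact: (sm_dom but.1). Qed.
Let Dut' t : itv0 T t -> D0 (ut' t). Proof. exact: (sm_dom but'.1). Qed.
Let Dy t : itv0 T t -> D2 (y t). Proof. exact: (sm_dom by_.1). Qed.
Let Dy' t : itv0 T t -> D2 (y' t). Proof. exact: (sm_dom by_'.1). Qed.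
Let Ddu t : itv0 T t -> D1 (du t). Proof. exact: (sm_dom bdu.1). Qed.
Let Ddy t : itv0 T t -> D2 (dy t). Proof. exact: (sm_dom bdy.1). Qed.

Let mass_diff e r z t : D1 e -> D2 (r, z) -> itv0 T t ->
  mass_at c u ut p v e r z t - mass_at c u' ut' p' v' e r z t =
  rho_b c * ipv Ob (dut t) e +
  (form_uu c (du t) e + form_uy c (du t) (r, z) + form_mass c (dy t) (r, z)).
Proof.
move=> De Dw Tt.
have E1 := form_diff ipv_bdd (Dut Tt) (Dut' Tt) De.
have E2 := form_diff (bdd_form_uu c) (Du Tt) (Du' Tt) De.
have E3 := form_diff (bdd_form_uy c) (Du Tt) (Du' Tt) Dw.
have E4 := form_diff (bdd_form_mass c) (Dy Tt) (Dy' Tt) Dw.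
rewrite /mass_at.
rewrite (E1 : ipv Ob (dut t) e = _) (E2 : form_uu c (du t) e = _).
rewrite (E3 : form_uy c (du t) (r, z) = _) (E4 : form_mass c (dy t) (r, z) = _).
rewrite /y /y'.
do !(move: (ipv Ob _ _) => ?); do !(move: (form_uu _ _ _) => ?).
by do !(move: (form_uy _ _ _) => ?); do !(move: (form_mass _ _ _) => ?); ring.
Qed.

Let work_diff e r z t : D1 e -> D2 (r, z) -> itv0 T t ->
  work_at c u p v e r z t - work_at c u' p' v' e r z t =
  form_el c (du t) e + form_yu c (dy t) e + form_yy c (dy t) (r, z).
Proof.
move=> De Dw Tt.
have E2 := form_diff (bdd_form_el c) (Du Tt) (Du' Tt) De.
have E3 := form_diff (bdd_form_yu c) (Dy Tt) (Dy' Tt) De.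
have E4 := form_diff (bdd_form_yy c) (Dy Tt) (Dy' Tt) Dw.
rewrite /work_at (E2 : form_el c (du t) e = _).
rewrite (E3 : form_yu c (dy t) e = _) (E4 : form_yy c (dy t) (r, z) = _).
rewrite /y /y'.
do !(move: (form_el _ _ _) => ?).
by do !(move: (form_yu _ _ _) => ?); do !(move: (form_yy _ _ _) => ?); ring.
Qed.

Let sD1 := inner_subsp (@inner_u R).
Let sD2 := inner_subsp (@inner_y R).

Let It t : itv0 T t -> itv0 t `<=` itv0 T.
Proof. by rewrite itv0E => /andP[_ /ltW]; exact: itv0S. Qed.

Lemma solid_equation e : D1 e -> {ae mu, forall t, itv0 T t ->
  rho_b c * ipv Ob (dut t) e + form_uu c (du t) e +
  \int[mu]_(s in itv0 t) form_el c (du s) e +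
  \int[mu]_(s in itv0 t) form_yu c (dy s) e = 0}.
Proof.
move=> De; have Dw : D2 (0, 0) := subsp0 sD2.
apply: aeS (weak_difference De Dw) => t E Tt; have {E} := E Tt.
have Z1 : form_uy c (du t) (0, 0) = 0 := form_0r sD2 (bdd_form_uy c) (Ddu Tt).
have Z2 : form_mass c (dy t) (0, 0) = 0 := form_0r sD2 (bdd_form_mass c) (Ddy Tt).
rewrite (mass_diff De Dw Tt) Z1 Z2 !addr0.
have I1 := intbleS (measurable_itv0 t) mT (It Tt)
  (intble_form_linl (@inner_u R) (@inner_u R) (bdd_form_el c) bdu De).
have I2 := intbleS (measurable_itv0 t) mT (It Tt)
  (intble_form_linl (@inner_y R) (@inner_u R) (bdd_form_yu c) bdy De).
have -> : \int[mu]_(s in itv0 t) (work_at c u p v e 0 0 s - work_at c u' p' v' e 0 0 s) =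
    \int[mu]_(s in itv0 t) (form_el c (du s) e + form_yu c (dy s) e).
  apply: intR_eq => s ts; rewrite (work_diff De Dw (It Tt ts)).
  have Z3 : form_yy c (dy s) (0, 0) = 0 := form_0r sD2 (bdd_form_yy c) (Ddy (It Tt ts)).
  by rewrite Z3 addr0.
by rewrite (RintegralD (measurable_itv0 t) I1 I2) addrA.
Qed.

Lemma fluid_equation w : D2 w -> {ae mu, forall t, itv0 T t ->
  form_uy c (du t) w + form_mass c (dy t) w +
  \int[mu]_(s in itv0 t) form_yy c (dy s) w = 0}.
Proof.
case: w => r z Dw; have De : D1 0 := subsp0 sD1.
apply: aeS (weak_difference De Dw) => t E Tt; have {E} := E Tt.
have Z1 : form_uu c (du t) 0 = 0 := form_0r sD1 (bdd_form_uu c) (Ddu Tt).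
have Z2 : ipv Ob (dut t) 0 = 0 := form_0r sD1 ipv_bdd (sm_dom bdut.1 Tt).
rewrite (mass_diff De Dw Tt) Z1 Z2 mulr0 !add0r.
have -> : \int[mu]_(s in itv0 t) (work_at c u p v 0 r z s - work_at c u' p' v' 0 r z s) =
    \int[mu]_(s in itv0 t) form_yy c (dy s) (r, z).
  apply: intR_eq => s ts; rewrite (work_diff De Dw (It Tt ts)).
  have Z3 : form_el c (du s) 0 = 0 := form_0r sD1 (bdd_form_el c) (Ddu (It Tt ts)).
  have Z4 : form_yu c (dy s) 0 = 0 := form_0r sD1 (bdd_form_yu c) (Ddy (It Tt ts)).
  by rewrite Z3 Z4 !add0r.
by [].
Qed.

Hypotheses (wdt : is_weak_dt T D0 (ipv Ob) u ut) (wdt' : is_weak_dt T D0 (ipv Ob) u' ut').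
Variable u0 : vfield.
Hypotheses (Du0 : D0 u0) (iu : initial_value T (bL2_b R) u u0).
Hypothesis (iu' : initial_value T (bL2_b R) u' u0).

(** Paired with a fixed [e], the weak derivative is a derivative up to a constant of integration,
    and this constant is zero because both displacements start from [u0]. *)
Lemma displacement_primitive e : D0 e -> {ae mu, forall t, itv0 T t ->
  ipv Ob (du t) e - \int[mu]_(s in itv0 t) ipv Ob (dut s) e = 0}.
Proof.
move=> De; have i0 := inner_L2vec; have i1 := @inner_u R.
have B1 : bdd_form D1 (ipvH1 Ob) D0 (ipv Ob) (ipv Ob).
  have -> : ipv Ob = fun f g => ipv Ob g f.
    apply/funext => f; apply/funext => g.
    by apply: eq_bigr => i _; exact: ipboxC.
  exact: (bdd_form_flip ipv_bdd).
have I1 := intble_form_linl i1 i0 B1 bu De; have I1' := intble_form_linl i1 i0 B1 bu' De.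
have I2 := intble_form_linl i0 i0 (bdd_form_inner i0) but De.
have I2' := intble_form_linl i0 i0 (bdd_form_inner i0) but' De.
have Ig := intble_form_linl i1 i0 B1 bdu De.
have Ih := intble_form_linl i0 i0 (bdd_form_inner i0) bdut De.
have [C hC] : exists C, {ae mu, forall t, itv0 T t ->
    ipv Ob (du t) e - \int[mu]_(s in itv0 t) ipv Ob (dut s) e = C}.
  apply: weak_derivative_primitive => // phi tphi; have [dphi _ _] := tphi.
  have cphi : continuous phi.
    by move=> t; apply/differentiable_continuous/derivable1_diffP; exact: (dphi 0%N t).
  have cphi' : continuous (derive1 phi).
    by move=> t; apply/differentiable_continuous/derivable1_diffP; exact: (dphi 1%N t).
  have E := wdt De tphi; have E' := wdt' De tphi.
  have J1 := intble_continuousM cphi' I1; have J1' := intble_continuousM cphi' I1'.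
  have J2 := intble_continuousM cphi I2; have J2' := intble_continuousM cphi I2'.
  transitivity (\int[mu]_(t in itv0 T) (derive1 phi t * ipv Ob (u t) e) -
     \int[mu]_(t in itv0 T) (derive1 phi t * ipv Ob (u' t) e)).
    rewrite -(RintegralB mT J1 J1'); apply: intR_eq => t Tt.
    by rewrite -mulrBr; congr (_ * _); exact: (form_diff B1 (Du Tt) (Du' Tt) De).
  rewrite E E' -opprD; congr (- _).
  rewrite -(RintegralB mT J2 J2'); apply: intR_eq => t Tt.
  rewrite -mulrBr; congr (_ * _); apply: esym.
  exact: (form_diff (bdd_form_inner i0) (Dut Tt) (Dut' Tt) De).
have D0u t : itv0 T t -> D0 (u t) by move=> /Du; exact: H1star_L2vec.
have D0u' t : itv0 T t -> D0 (u' t) by move=> /Du'; exact: H1star_L2vec.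
have C0 := initial_value_cst i0 T_gt0 Du0 De D0u D0u' iu iu' Ih hC.
by rewrite C0 in hC.
Qed.

Hypotheses (rho_b_gt0 : 0 < rho_b c) (rho_f_gt0 : 0 < rho_f c) (nu_gt0 : 0 < nu c).
Hypotheses (mu_gt0 : 0 < Defs.mu c) (k_gt0 : 0 < kperm c) (beta_gt0 : 0 < beta c).
Hypotheses (lambda_ge0 : 0 <= lambda c) (c0_ge0 : 0 <= c0 c).

Lemma difference_eq0 : {ae mu, forall t, itv0 T t ->
  [/\ ipv Ob (du t) (du t) = 0, form_mass c (dy t) (dy t) = 0 &
      form_flux c (dy t) (dy t) = 0]}.
Proof.
apply: (abstract_uniqueness inner_L2vec (@inner_u R) (@inner_y R) ipv_bdd H1star_L2vec
  (bdd_form_uu c) (bdd_form_el c) (bdd_form_uy c) (bdd_form_yu c) (bdd_form_mass c)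
  (bdd_form_yy c) (bdd_form_flux c) _ _ _ _ _ _ _ rho_b_gt0 bdu bdut bdy
  solid_equation fluid_equation displacement_primitive).
- by move=> *; exact: form_el_sym.
- by move=> *; exact: form_mass_sym.
- by move=> *; exact: form_flux_sym.
- by move=> *; exact: form_el_ge0.
- by move=> *; exact: form_mass_ge0.
- by move=> *; exact: form_flux_ge0.
- by move=> *; exact: form_dissipation.
Qed.

End pair_of_solutions.
End difference.

Lemma psum3_eq0 (R : realDomainType) (f : 'I_3 -> R) : (forall i, 0 <= f i) ->
  \sum_(i < 3) f i = 0 -> forall i, f i = 0.
Proof.
move=> f0 s0 i; apply/eqP; rewrite eq_le f0 andbT -s0 (bigD1 i)//= lerDl.
exact: sumr_ge0.
Qed.

Unset Implicit Arguments.

Theorem theorem3p1 (R : realType) (T : R) (c : coeffs R)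
    (u0 u1 : 'I_3 -> R * R * R -> R) (p0 : R * R * R -> R)
    (v0 : 'I_3 -> R * R * R -> R)
    (Fb : R -> 'I_3 -> R * R * R -> R)
    (S : R -> (R * R * R -> R) -> R)
    (Ff : R -> ('I_3 -> R * R * R -> R) -> R)
    (u u' : R -> 'I_3 -> R * R * R -> R)
    (p p' : R -> R * R * R -> R)
    (v v' : R -> 'I_3 -> R * R * R -> R) :
  0 < T ->
  0 < rho_b c -> 0 < rho_f c -> 0 < nu c -> 0 < alpha c -> 0 < mu c ->
  0 < kperm c -> 0 < beta c -> 0 <= lambda c -> 0 <= c0 c ->
  dom (Uspace R) u0 -> dom (bL2_b R) u1 -> dom (L2_b R) p0 ->
  dom (Vspace R) v0 ->
  bochner_L2 T (dual (HVspace R)) Ff ->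
  bochner_L2 T (bL2_b R) Fb ->
  bochner_L2 T (dual (Hstar_b R)) S ->
  weak_solution T c u0 u1 (fluid_content c u0 p0) v0 Fb S Ff u p v ->
  weak_solution T c u0 u1 (fluid_content c u0 p0) v0 Fb S Ff u' p' v' ->
  {ae @lebesgue_measure R, forall t, 0 < t < T ->
    [/\ forall i, ae_eq (leb3 R) (inside Omega_b) (u t i) (u' t i),
        ae_eq (leb3 R) (inside Omega_b) (p t) (p' t) &
        forall i, ae_eq (leb3 R) (inside Omega_f) (v t i) (v' t i)]}.
Proof.
move=> T0 rb rf nu0 _ mu0 k0 be0 la0 c00 Du0 _ _ _ _ _ _.
move=> [ut [[[Lu _ Lut wdt] [bp _] [_ bv]] iu eqn _]].
move=> [ut' [[[Lu' _ Lut' wdt'] [bp' _] [_ bv']] iu' eqn' _]].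
have bu := bochner_L2_of_Linf (@inner_u R) Lu.
have bu' := bochner_L2_of_Linf (@inner_u R) Lu'.
have but := bochner_L2_of_Linf (@inner_L2vec R) Lut.
have but' := bochner_L2_of_Linf (@inner_L2vec R) Lut'.
have same xi xit q qt zeta zetat : C1_0 T (Uspace R) xi xit -> C1_0 T (Hstar_b R) q qt ->
    C1_0 T (HVspace R) zeta zetat ->
    weak_lhs T c u ut p v xi xit q qt zeta zetat =
    weak_lhs T c u' ut' p' v' xi xit q qt zeta zetat.
  by move=> h1 h2 h3; rewrite (eqn _ _ _ _ _ _ h1 h2 h3) (eqn' _ _ _ _ _ _ h1 h2 h3).
have := difference_eq0 T0 bu bu' but but' bp bp' bv bv' same wdt wdt'
  (H1star_L2vec Du0) iu iu' rb rf nu0 mu0 k0 be0 la0 c00.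
have mb := measurable_inside (@Omega_b R); have mf := measurable_inside (@Omega_f R).
apply: aeS => t h Tt; have [hu hm hk] := h Tt.
have Du := sm_dom bu.1 Tt; have Du' := sm_dom bu'.1 Tt.
have Dp := sm_dom bp.1 Tt; have Dp' := sm_dom bp'.1 Tt.
have [Dv _] := sm_dom bv.1 Tt; have [Dv' _] := sm_dom bv'.1 Tt.
have Lui i : L2box Omega_b (u t i) by have [[[]]] := Du i.
have Lui' i : L2box Omega_b (u' t i) by have [[[]]] := Du' i.
have Lvi i : L2box Omega_f (v t i) by have [[[]]] := Dv i.
have Lvi' i : L2box Omega_f (v' t i) by have [[[]]] := Dv' i.
have Ddp := subspB (@subsp_H1star_b R) Dp Dp'.
have [[Hdp _] tdp] := Ddp.
have sb := subsp_L2box (@Omega_b R); have sf := subsp_L2box (@Omega_f R).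
split.
- move=> i; apply: (ip_sub_ae mb (Lui i) (Lui' i)).
  apply: (psum3_eq0 (f := fun i => ipbox Omega_b (u t i - u' t i) (u t i - u' t i)) _ hu i).
  by move=> j; apply: ipbox_ge0; exact: (subspB sb (Lui j) (Lui' j)).
- apply: (ip_sub_ae mb); [by have [[[]]] := Dp|by have [[[]]] := Dp'|].
  (* This covers all values of c_0 at once: the vanishing flux makes the x_3-derivative of p - p'
     null, and its trace at the top is zero. *)
  apply: (trace0_partial0_eq0 Hdp tdp).
  apply: (psum3_eq0 (f := fun i => ipbox Omega_b (partial Omega_b i (p t - p' t))
    (partial Omega_b i (p t - p' t))) _ _ e3).
    by move=> i; exact: ipbox_partial_ge0.
  by move/eqP: hk; rewrite mulf_eq0 (gt_eqF k0) => /eqP.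
- move=> i; apply: (ip_sub_ae mf (Lvi i) (Lvi' i)).
  have nn j : 0 <= ipbox Omega_f (v t j - v' t j) (v t j - v' t j).
    by apply: ipbox_ge0; exact: (subspB sf (Lvi j) (Lvi' j)).
  apply: (psum3_eq0 (f := fun i => ipbox Omega_f (v t i - v' t i) (v t i - v' t i)) nn _ i).
  have pp : 0 <= c0 c * ipbox Omega_b (p t - p' t) (p t - p' t).
    by apply: mulr_ge0 => //; apply: ipbox_ge0; exact: Hdp.1.
  have vv : 0 <= rho_f c * \sum_(j < 3) ipbox Omega_f (v t j - v' t j) (v t j - v' t j).
    by apply: mulr_ge0; [exact: ltW|exact: sumr_ge0].
  (* Both summands of the mass form are nonnegative, so the kinetic one vanishes on its own, and
     rho_f is positive. *)
  move/eqP: hm; rewrite (paddr_eq0 pp vv) => /andP[_].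
  by rewrite mulf_eq0 (gt_eqF rf) => /eqP.
Qed.
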